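(* Let $1<q<\infty$ and $s>n/q'$. Let $f\in\mathcal{F}L^q_s(\mathbb{R}^n)$ be real-valued, and let $F$ be a function analytic on an open neighborhood in $\mathbb{C}$ of $f(\mathbb{R}^n)\cup\{0\}$ with $F(0)=0$. Then there exists $g\in\mathcal{F}L^q_s(\mathbb{R}^n)$ such that $g(x)=F(f(x))$ for all $x\in\mathbb{R}^n$.
   Context: $q'$ is the conjugate exponent, $1/q+1/q'=1$; $\langle\xi\rangle=(1+|\xi|^2)^{1/2}$; $\hat f(\xi)=\int f(x)e^{-ix\cdot\xi}dx$. $\mathcal{F}L^q_s(\mathbb{R}^n)$ is the space of tempered distributions $f$ with $\|f\|_{\mathcal{F}L^q_s}=\big(\int(\langle\xi\rangle^s|\hat f(\xi)|)^q d\xi\big)^{1/q}<\infty$; for $s>n/q'$ its elements are continuous functions vanishing at infinity (so $f(\mathbb{R}^n)\cup\{0\}$ is a compact subset of $\mathbb{R}$) and it is an algebra under pointwise multiplication. *)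

(* Defs.v *)
From HB Require Import structures.
From mathcomp Require Import all_boot all_order all_algebra.
From mathcomp Require Import all_classical all_reals all_analysis.
From mathcomp Require Import complex.

Set Implicit Arguments.
Unset Strict Implicit.
Unset Printing Implicit Defensive.

Import Order.TTheory GRing.Theory Num.Theory.
Import numFieldNormedType.Exports.

Local Open Scope classical_set_scope.
Local Open Scope ring_scope.

Section FourierLebesgue.
Variable R : realType.

Definition cmod (z : R[i]) : R := Num.sqrt (complex.Re z ^+ 2 + complex.Im z ^+ 2).

Definition dotRn (n : nat) (x y : 'rV[R]_n) : R := \sum_(i < n) x ord0 i * y ord0 i.

Definition jbracket (n : nat) (xi : 'rV[R]_n) : R :=
  Num.sqrt (1 + \sum_(i < n) xi ord0 i ^+ 2).

Definition borelRn (n : nat) (A : set 'rV[R]_n) : Prop :=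
  <<s [set B : set 'rV[R]_n | open B] >> A.

Definition measurableRn (n : nat) (u : 'rV[R]_n -> R) : Prop :=
  forall B : set R, measurable B -> borelRn (u @^-1` B).

(** Lebesgue integral on R^n of a nonnegative (Borel) function, written as the
    iterated integral over the coordinates (equal to the integral against
    n-dimensional Lebesgue measure by Tonelli). For n = 0, R^0 is a point. *)
Fixpoint iintRn (n : nat) : ('rV[R]_n -> \bar R) -> \bar R :=
  match n return ('rV[R]_n -> \bar R) -> \bar R with
  | 0 => fun G => G 0
  | n'.+1 => fun G =>
      (\int[@lebesgue_measure R]_(t in setT)
          iintRn (fun v : 'rV[R]_n' => G (row_mx (const_mx t : 'rV[R]_1) v)))%E
  end.

Definition pospart (a : R) : R := Num.max a 0.
Definition negpart (a : R) : R := Num.max (- a) 0.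

Definition measurableRnC (n : nat) (h : 'rV[R]_n -> R[i]) : Prop :=
  measurableRn (fun x => complex.Re (h x)) /\ measurableRn (fun x => complex.Im (h x)).

Definition integrableRnC (n : nat) (h : 'rV[R]_n -> R[i]) : Prop :=
  measurableRnC h /\ (iintRn (fun x => (cmod (h x))%:E) < +oo)%E.

Definition cintRn (n : nat) (h : 'rV[R]_n -> R[i]) : R[i] :=
  let I u := fine (iintRn (fun x => (u x)%:E)) in
  complex.Complex
    (I (fun x => pospart (complex.Re (h x))) - I (fun x => negpart (complex.Re (h x))))
    (I (fun x => pospart (complex.Im (h x))) - I (fun x => negpart (complex.Im (h x)))).

Definition expi (t : R) : R[i] := complex.Complex (cos t) (sin t).

(** Inverse Fourier transform (for \hat f(xi) = \int f(x) e^{-i x.xi} dx):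
    f(x) = (2 pi)^{-n} \int \hat f(xi) e^{i x.xi} dxi. *)
Definition invFourier (n : nat) (h : 'rV[R]_n -> R[i]) (x : 'rV[R]_n) : R[i] :=
  ((2 * pi) ^- n)%:C%C * cintRn (fun xi => h xi * expi (dotRn x xi)).

(** Fourier-Lebesgue space FL^q_s(R^n), s > n/q': f is (everywhere equal to) the
    inverse Fourier transform of a measurable h with
    \int (<xi>^s |h(xi)|)^q dxi < oo  (h is then automatically integrable). *)
Definition FLqs (n : nat) (q s : R) (f : 'rV[R]_n -> R[i]) : Prop :=
  exists h : 'rV[R]_n -> R[i],
    [/\ measurableRnC h,
        (iintRn (fun xi => ((jbracket xi `^ s * cmod (h xi)) `^ q)%:E) < +oo)%E,
        integrableRnC h
      & forall x, f x = invFourier h x].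

Definition conj_exp (q : R) : R := q / (q - 1).

Definition open_in_C (U : set R[i]) : Prop :=
  forall z, U z -> exists2 r : R, 0 < r & forall w, cmod (w - z) < r -> U w.

Definition analytic_onC (U : set R[i]) (F : R[i] -> R[i]) : Prop :=
  forall z0, U z0 -> exists2 r : R, 0 < r & exists a : nat -> R[i],
    forall z, U z -> cmod (z - z0) < r ->
      (fun N : nat => cmod (\sum_(k < N) a k * (z - z0) ^+ k - F z)) @ \oo --> (0 : R).

End FourierLebesgue.

(* Main.v *)
Require Import Defs.
From HB Require Import structures.
From mathcomp Require Import all_boot all_order all_algebra.
From mathcomp Require Import all_classical all_reals all_analysis.
From mathcomp Require Import measurable_realfun.
From mathcomp Require Import complex ring lra.

(** The real and imaginary parts of [F] are real analytic on the real points of [U],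
    so it suffices to treat a real analytic [phi] with [phi 0 = 0]. The range of the
    real-valued [f], which is continuous and vanishes at infinity, lies in an interval
    [[c - d, c + d]] of [U] containing 0. Writing [y = (f - c) / d], expand [phi] in
    Chebyshev polynomials [T_k], whose coefficients decrease faster than any power of
    [k]; since [phi 0 = 0] we get [phi f = sum_k a_k (T_k y - T_k y0)] with
    [y0 = - c / d], and it remains to see that the norm of [T_k y - T_k y0] grows
    at most polynomially in [k].

    To this end truncate [hat f] to frequencies at most [N], with [N] a power of [k]
    such that the remainder [rho] has [L^1]-norm at most [ka / k^4], and expand [T_k]
    around the truncation. The [j]-th derivative of [T_k] is at most [k^(2 j)] on
    [[-1, 1]], so the factor [k^4j] that it brings is absorbed by [rho^j]. The derivatives
    of [T_k] at the truncation are, up to constants, band-limited and square-integrable,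
    and by Plancherel the [L^1]-norms of their transforms are polynomial in [k].

    Real-valued functions are represented by their Hartley transform, with kernel
    [cas t = cos t + sin t], so that only real integrals occur. *)

Set Implicit Arguments.
Unset Strict Implicit.
Unset Printing Implicit Defensive.

Import Order.TTheory GRing.Theory Num.Theory.
Import numFieldNormedType.Exports.
Local Open Scope classical_set_scope.
Local Open Scope ring_scope.

(** * Borel structure and Lebesgue measure on row vectors *)

(** A product in the algebra costs a constant factor, so estimating a polynomial of degree [k] in
    [f] through the powers of [f] gives a bound that is geometric in [k], and no decay of the
    coefficients by powers of [k] can compensate it. Truncation separates the two kinds of factors.
    The values of the truncation stay in the interval on which the derivatives of [T_k] are bounded,
    and a polynomial of degree about [k] in it has frequencies at most about [k N], so Plancherel
    turns pointwise bounds into norm bounds without any product estimate; such factors act as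
    multipliers with a finite weighted [L^1]-norm. The powers of the remainder do pay the product
    constants, but each of them contains the weighted [L^q]-norm only once and otherwise
    [L^1]-norms, which are as small as desired. An interval slightly larger than the range of [f] is
    taken so that the range of the truncation still fits into it. *)

Definition rV_opens (R : realType) n : set (set 'rV[R]_n) := open.

(* Row vectors carry the Borel sigma-algebra, so that [measurableRn] is
   measurability for this instance. *)
HB.instance Definition _ (R : realType) (n : nat) :=
  Measurable.copy 'rV[R]_n (g_sigma_algebraType (@rV_opens R n)).

Section euclidean_measurability.
Context {R : realType}.

Lemma measurable_coord n (i : 'I_n) :
  measurable_fun [set: 'rV[R]_n] (fun x : 'rV[R]_n => x ord0 i).
Proof.
apply: (measurability _ (RGenOpens.measurableE R)).
move=> _ [_ [a [b ->] <-]].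
rewrite setTI; apply: sub_sigma_algebra => /=.
have /continuousP := @coord_continuous R 1 n ord0 i.
by apply; exact: interval_open.
Qed.

Lemma rV_norm_lt n (x : 'rV[R]_n) (e : R) :
  0 < e -> (forall i, `|x ord0 i| < e) -> `|x| < e.
Proof.
move=> e0 xe; rewrite [`|x|]mx_normrE; apply: bigmax_lt => // -[i j] _ /=.
by rewrite ord1.
Qed.

Lemma rV_coord_le n (x : 'rV[R]_n) i : `|x ord0 i| <= `|x|.
Proof.
rewrite [`|x|]mx_normrE.
exact: (@le_bigmax_cond _ R _ 0 (ord0, i) xpredT (fun ij => `|x ij.1 ij.2|)).
Qed.

(** An open set is the union of the rational cubes contained in it, which are countably many, and
    the preimage of a cube is a finite intersection of preimages under the coordinates; the
    induction on [s] builds this intersection. *)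
Lemma measurable_rV d (T : measurableType d) n (D : set T) (f : T -> 'rV[R]_n) :
  measurable D ->
  (forall i, measurable_fun D (fun x => f x ord0 i)) -> measurable_fun D f.
Proof.
move=> mD mf.
apply: (@measurability _ _ _ _ D f (@rV_opens R n)) => //.
move=> _ [W oW <-].
pose box (p : 'rV[rat]_n * nat) : set 'rV[R]_n :=
  [set y | forall i, `|ratr (p.1 ord0 i) - y ord0 i| < p.2.+1%:R^-1].
pose F p := if `[< box p `<=` W >] then D `&` f @^-1` (box p) else set0.
have -> : D `&` f @^-1` W = \bigcup_p F p.
  apply/seteqP; split => x.
    move=> [Dx Wfx].
    have := open_nbhs_nbhs (conj oW Wfx).
    rewrite -nbhs_ballE => -[e /= e0 beO].
    have [k hk] : exists k : nat, k.+1%:R^-1 < e / 2.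
      by exists (Num.truncn (e / 2)^-1); rewrite invf_plt ?posrE ?divr_gt0 ?ltr0Sn ?truncnS_gt.
    have /choice[c hc] : forall i, exists r : rat,
        `|ratr r - f x ord0 i| < k.+1%:R^-1.
      move=> i; have k0 : (0 : R) < k.+1%:R^-1 by rewrite invr_gt0.
      have [r /[!in_itv]/= /andP[r1 r2]] :
          exists r : rat, ratr r \in `](f x ord0 i - k.+1%:R^-1),
                                      (f x ord0 i + k.+1%:R^-1)[.
        by apply: rat_in_itvoo; rewrite ltrBlDr -addrA ltrDl addr_gt0.
      by exists r; rewrite ltr_distl r1 r2.
    exists (\row_i c i, k) => //; rewrite /F asboolT.
      by split => //= i; rewrite mxE.
    move=> y /= hy; apply: beO.
    rewrite mx_norm_ball /ball_ /=.
    apply: rV_norm_lt => // j; rewrite !mxE.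

    have := hc j; have := hy j; rewrite mxE.
    set r := ratr _; set kk := _^-1 in hk *; move=> h1 h2.
    rewrite (_ : _ - _ = (r - y ord0 j) - (r - f x ord0 j)); last by ring.
    apply: le_lt_trans (ler_normB _ _) _; lra.
  move=> [p _]; rewrite /F; case: asboolP => // pW [Dx /= hx]; split => //.
  exact: pW.
apply: countable_bigcupT_measurable; first exact: countableP.
move=> p; rewrite /F; case: ifP => // _.
suff: forall s : seq 'I_n, measurable [set x | D x /\
    forall i, i \in s -> `|ratr (p.1 ord0 i) - f x ord0 i| < p.2.+1%:R^-1].
  move=> /(_ (enum 'I_n)); congr measurable; apply/seteqP; split=> x /= [Dx h].
    by split => // i; apply: h; rewrite mem_enum.
  by split => // i _; exact: h.
elim=> [|i s ih].
  by rewrite (_ : [set x | _] = D)//; apply/seteqP; split=> x //= -[].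
have : measurable (D `&` (fun x => f x ord0 i) @^-1`
   `](ratr (p.1 ord0 i) - p.2.+1%:R^-1), (ratr (p.1 ord0 i) + p.2.+1%:R^-1)[).
  exact: mf.
move=> /measurableI /(_ ih); congr measurable; apply/seteqP; split=> x /=.
  rewrite in_itv/= -ltr_distl distrC => -[[Dx h] [_ h']]; split=> // j.
  by rewrite inE => /predU1P[->//|]; exact: h'.
move=> [Dx h]; split; split=> //.
  by rewrite in_itv/= -ltr_distl distrC; apply: h; rewrite mem_head.
by move=> j js; apply: h; rewrite inE js orbT.
Qed.
End euclidean_measurability.
(** The same term as in the recursion of [iintRn], so that the two recursions match by conversion in
    [iintRnE]. *)
Definition consv {R : realType} n (t : R) (v : 'rV[R]_n) : 'rV[R]_n.+1 :=
  row_mx (const_mx t : 'rV[R]_1) v.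

Section euclidean_measure.
Context {R : realType}.

Lemma consv0 n (t : R) (v : 'rV[R]_n) : consv t v ord0 ord0 = t.
Proof.
rewrite /consv mxE; case: splitP => [j _|k /= k0]; first by rewrite mxE.
by have := congr1 (fun m => (0 < m)%N) k0.
Qed.

Lemma consvS n (t : R) (v : 'rV[R]_n) i : consv t v ord0 (lift ord0 i) = v ord0 i.
Proof.
rewrite /consv mxE; case: splitP => [j|k]; first by rewrite ord1.
by move=> ik; congr (v _ _); apply: val_inj; apply/eqP; rewrite -(eqn_add2l 1) -ik.
Qed.

Lemma consvE n (x : 'rV[R]_n.+1) :
  x = consv (x ord0 ord0) (\row_i x ord0 (lift ord0 i)).
Proof.
apply/rowP => i; have [j ->|->] := unliftP ord0 i; last by rewrite consv0.
by rewrite consvS mxE.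
Qed.

Lemma measurable_consv n :
  measurable_fun [set: R * 'rV[R]_n] (fun p => consv p.1 p.2).
Proof.
apply: measurable_rV => // i; have [j ->|->] := unliftP ord0 i.
  under eq_fun do rewrite consvS.
  exact: (measurableT_comp (measurable_coord j) measurable_snd).
under eq_fun do rewrite consv0.
exact: measurable_fst.
Qed.

Section successor_measure.
Variables (n : nat) (m : {sigma_finite_measure set 'rV[R]_n -> \bar R}).

Definition succ_measure :=
  pushforward (@lebesgue_measure R \x m)%E (fun p => consv p.1 p.2).

HB.instance Definition _ := Measure.copy succ_measure
  (measure_function_pushforward__canonical__measure_function_Measure
     (@lebesgue_measure R \x m)%E (@measurable_consv n)).

(** Needed both to iterate the product and to apply Fubini. The cover consists of the products of
    the two given covers, enumerated through [unpickle]. *)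
Lemma sigma_finite_succ_measure : sigma_finite setT succ_measure.
Proof.
have [A AT mA] := sigma_finiteT (@lebesgue_measure R).
have [B BT mB] := sigma_finiteT m.
pose box (p : nat * nat) : set 'rV[R]_n.+1 :=
  [set x | A p.1 (x ord0 ord0) /\ B p.2 (\row_i x ord0 (lift ord0 i))].
pose F k := if @unpickle (nat * nat)%type k is Some p then box p else set0.
exists F.
  apply/esym; rewrite -subTset => x _.
  have [i _ Ai] : (\bigcup_i A i) (x ord0 ord0) by rewrite -AT.
  have [j _ Bj] : (\bigcup_i B i) (\row_i x ord0 (lift ord0 i)) by rewrite -BT.
  by exists (pickle (i, j)) => //; rewrite /F pickleK.
move=> k; rewrite /F; case: unpickle => [[i j]|]; last first.
  by split; [exact: measurable0|rewrite measure0].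
split.
  rewrite (_ : box _ = (fun x : 'rV_n.+1 => x ord0 ord0) @^-1` A i `&`
    (fun x : 'rV_n.+1 => \row_i x ord0 (lift ord0 i)) @^-1` B j)//.
  apply: measurableI.
    rewrite -[X in measurable X]setTI; apply: measurable_coord => //.
    by have [] := mA i.
  rewrite -[X in measurable X]setTI.
  apply: measurable_rV => //; last by have [] := mB j.
  move=> l; under eq_fun do rewrite mxE.
  exact: measurable_coord.
rewrite /succ_measure /pushforward.
rewrite (_ : _ @^-1` _ = A i `*` B j); last first.
  have E (t : R) (v : 'rV[R]_n) : \row_l consv t v ord0 (lift ord0 l) = v.
    by apply/rowP => l; rewrite mxE consvS.
  by apply/seteqP; split=> -[t v]; rewrite /box/= consv0 E.
have [mAi Ai] := mA i; have [mBj Bj] := mB j.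
by rewrite product_measure1E// lte_mul_pinfty// ge0_fin_numE.
Qed.

HB.instance Definition _ := @Measure_isSigmaFinite.Build _ _ _ succ_measure
  sigma_finite_succ_measure.

End successor_measure.

(* Follows the recursion of [iintRn], see [iintRnE]. *)
Fixpoint mu n : {sigma_finite_measure set 'rV[R]_n -> \bar R} :=
  match n return {sigma_finite_measure set 'rV[R]_n -> \bar R} with
  | 0 => @dirac _ 'rV[R]_0 0 R
  | k.+1 => succ_measure (mu k)
  end.

Local Open Scope ereal_scope.

Lemma integral_muS n (f : 'rV[R]_n.+1 -> \bar R) :
  measurable_fun [set: 'rV[R]_n.+1] f -> (forall x, 0 <= f x) ->
  \int[mu n.+1]_x f x =
  \int[@lebesgue_measure R]_t \int[mu n]_v f (consv t v).
Proof.
move=> mf f0.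
rewrite /= ge0_integral_pushforward//=; last exact: measurable_consv.
rewrite preimage_setT.
apply: (@fubini_tonelli1 _ _ _ _ _ (@lebesgue_measure R) (mu n)
  (fun p => f (consv p.1 p.2))) => //.
exact: (measurableT_comp mf (@measurable_consv n)).
Qed.

Lemma integral_muS2 n (f : 'rV[R]_n.+1 -> \bar R) :
  measurable_fun [set: 'rV[R]_n.+1] f -> (forall x, 0 <= f x) ->
  \int[mu n.+1]_x f x =
  \int[mu n]_v \int[@lebesgue_measure R]_t f (consv t v).
Proof.
move=> mf f0; rewrite integral_muS//.
apply: (@fubini_tonelli _ _ _ _ _ (@lebesgue_measure R) (mu n)
  (fun p => f (consv p.1 p.2))) => //.
exact: (measurableT_comp mf (@measurable_consv n)).
Qed.

Lemma integral_mu0 (f : 'rV[R]_0 -> \bar R) :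
  measurable_fun [set: 'rV[R]_0] f -> (forall x, 0 <= f x) -> \int[mu 0]_x f x = f 0%R.
Proof. by move=> mf f0; rewrite /= integral_dirac//= diracT mul1e. Qed.

Lemma iintRnE n (f : 'rV[R]_n -> \bar R) :
  measurable_fun [set: 'rV[R]_n] f -> (forall x, 0 <= f x) -> iintRn f = \int[mu n]_x f x.
Proof.
elim: n f => [|n ih] f mf f0; first by rewrite integral_mu0.
rewrite integral_muS//=; apply: eq_integral => t _.
apply: ih => //; apply: (measurableT_comp mf).
exact: (measurableT_comp (@measurable_consv n) (measurable_pair1 t)).
Qed.

End euclidean_measure.

(** * Affine invariance *)

Section affine_invariance.
Context {R : realType}.
Local Open Scope ereal_scope.

Lemma preimage_affine_itv (a b x y : R) : a != 0%R ->
  @lebesgue_measure R ((fun t => a * t + b)%R @^-1` `]x, y]%classic) =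
  `|a|^-1%:E * @lebesgue_measure R `]x, y]%classic.
Proof.
move=> a0; have [a_lt0|a_gt0|/eqP] := ltgtP a 0%R; last by rewrite (negbTE a0).
-
  rewrite (_ : _ @^-1` _ = `[((y - b) / a), ((x - b) / a)[%classic)%R.
    rewrite !lebesgue_measure_itv/= !lte_fin ltr_nM2r ?invr_lt0// ltrBlDr subrK.
    case: ifPn => _; last by rewrite mule0.
    by rewrite -EFinM ltr0_norm//; congr EFin; field.
  apply/seteqP; split=> t; rewrite /= !in_itv/=.
    by rewrite ler_ndivrMr// ltr_ndivlMr// lerBrDr ltrBlDr ![(t * a)%R]mulrC andbC.
  by rewrite ler_ndivrMr// ltr_ndivlMr// lerBrDr ltrBlDr ![(t * a)%R]mulrC andbC.
- rewrite (_ : _ @^-1` _ = `]((x - b) / a), ((y - b) / a)]%classic)%R.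
    rewrite !lebesgue_measure_itv/= !lte_fin ltr_pM2r ?invr_gt0// ltrBlDr subrK.
    case: ifPn => _; last by rewrite mule0.
    by rewrite -EFinM gtr0_norm//; congr EFin; field.
  apply/seteqP; split=> t; rewrite /= !in_itv/=.
    by rewrite ler_pdivlMr// ltr_pdivrMr// lerBrDr ltrBlDr ![(t * a)%R]mulrC.
  by rewrite ler_pdivlMr// ltr_pdivrMr// lerBrDr ltrBlDr ![(t * a)%R]mulrC.
Qed.

Lemma measurable_affineR (a b : R) :
  measurable_fun [set: R] (fun t => a * t + b)%R.
Proof. by apply: measurable_funD => //; exact: measurable_funM. Qed.

(** Uniqueness of Lebesgue measure: its image under the affine map, multiplied by [|a|], agrees with
    it on half-open intervals. *)
Lemma integral_affineR (a b : R) (g : R -> \bar R) : a != 0%R ->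
  measurable_fun [set: R] g -> (forall x, 0 <= g x) ->
  `|a|%:E * \int[@lebesgue_measure R]_t g (a * t + b)%R =
  \int[@lebesgue_measure R]_t g t.
Proof.
move=> a0 mg g0.
pose m := measure_function_pushforward__canonical__measure_function_Measure
  (@lebesgue_measure R) (measurable_affineR a b : measurable_fun
     [set: measurableTypeR R] (_ : _ -> measurableTypeR R)).
have an0 : (0 <= `|a|)%R by [].
rewrite [RHS](eq_measure_integral (mscale (NngNum an0) m)); last first.
  move=> A mA _; apply: lebesgue_measure_unique => //= X -[[x y] _ <-].
  rewrite /mscale/= /pushforward preimage_affine_itv// muleA -EFinM.
  by rewrite mulfV ?mul1e// normr_eq0.
rewrite ge0_integral_mscale//; congr (_ * _).
by rewrite ge0_integral_pushforward//; exact: measurable_affineR.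
Qed.

Lemma consv_affine n (a t b : R) (v w : 'rV[R]_n) :
  (a *: consv t v + consv b w)%R = consv (a * t + b)%R (a *: v + w)%R.
Proof.
apply/rowP => i; have [j ->|->] := unliftP ord0 i.
  by rewrite [LHS]mxE [X in (X + _)%R]mxE !consvS [RHS]mxE [X in _ = (X + _)%R]mxE.
by rewrite [LHS]mxE [X in (X + _)%R]mxE !consv0.
Qed.

Lemma measurable_affine n (a : R) (b : 'rV[R]_n) :
  measurable_fun [set: 'rV[R]_n] (fun x => a *: x + b)%R.
Proof.
apply: measurable_rV => // i; under eq_fun do rewrite !mxE.
by apply: measurable_funD => //; apply: measurable_funM => //;
  exact: measurable_coord.
Qed.

Lemma measurable_consvr n (t : R) :
  measurable_fun [set: 'rV[R]_n] (fun v => consv t v).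
Proof.
exact: (measurableT_comp (@measurable_consv R n) (measurable_pair1 t)).
Qed.

Lemma measurable_consvl n (v : 'rV[R]_n) :
  measurable_fun [set: R] (fun t => consv t v).
Proof.
exact: (measurableT_comp (@measurable_consv R n) (measurable_pair2 v)).
Qed.

Lemma measurable_integral_consv n (f : 'rV[R]_n.+1 -> \bar R) :
  measurable_fun [set: 'rV[R]_n.+1] f -> (forall x, 0 <= f x) ->
  measurable_fun [set: R] (fun t => \int[mu n]_v f (consv t v)).
Proof.
move=> mf f0.
apply: (@measurable_fun_fubini_tonelli_F _ _ _ _ _ (mu n)
  (fun p => f (consv p.1 p.2))) => //.
exact: (measurableT_comp mf (@measurable_consv R n)).
Qed.

(** One coordinate at a time. The cases in use are translations ([a = 1]), the reflection ([a = -1])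
    and dilations. *)
Lemma integral_affine n (a : R) (b : 'rV[R]_n) (g : 'rV[R]_n -> \bar R) :
  a != 0%R -> measurable_fun [set: 'rV[R]_n] g -> (forall x, 0 <= g x) ->
  (`|a| ^+ n)%:E * \int[mu n]_x g (a *: x + b)%R = \int[mu n]_x g x.
Proof.
move=> a0; elim: n b g => [|n ih] b g mg g0.
  rewrite expr0 mul1e !integral_mu0//.
    by congr g; apply/rowP => -[].
  exact: (measurableT_comp mg (measurable_affine a b)).
rewrite !integral_muS//; last first.
  exact: (measurableT_comp mg (measurable_affine a b)).
rewrite exprS EFinM -muleA -ge0_integralZl//; last 2 first.
  apply: (@measurable_integral_consv _ (fun x => g (a *: x + b)%R)) => //.
  exact: (measurableT_comp mg (measurable_affine a b)).
  by move=> t _; exact: integral_ge0.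
rewrite [b]consvE; set b0 := b _ _; set b' := \row__ _.
rewrite -[RHS](integral_affineR b0 a0); last 2 first.
  exact: measurable_integral_consv.
  by move=> t; exact: integral_ge0.
congr (_ * _); apply: eq_integral => t _.
under eq_integral do rewrite consv_affine.
rewrite (ih b' (fun v => g (consv (a * t + b0)%R v)))//.
exact: (measurableT_comp mg (measurable_consvr _)).
Qed.

End affine_invariance.

(** * Continuity of translations in L1 *)

Section translation_continuity.
Context {R : realType}.
Local Open Scope ereal_scope.

Lemma cvge0_near_le (u : nat -> \bar R) (e : R) : (0 < e)%R ->
  u @ \oo --> 0 -> \forall k \near \oo, u k <= e%:E.
Proof.
move=> e0 /fine_cvgP[ufin /cvgr0Pnorm_le uz].
near=> k; rewrite -[u k]fineK; last by near: k.
rewrite lee_fin; apply: le_trans (ler_norm _) _.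
by near: k; exact: uz.
Unshelve. all: by end_near. Qed.

Lemma near_le_cvge0 (u : nat -> \bar R) : (forall k, 0 <= u k) ->
  (forall e : R, (0 < e)%R -> \forall k \near \oo, u k <= e%:E) ->
  u @ \oo --> 0.
Proof.
move=> u0 h; apply/fine_cvgP; split.
  near=> k; rewrite ge0_fin_numE// (@le_lt_trans _ _ 1) ?ltry//.
  by near: k; exact: h.
apply/cvgr0Pnorm_le => e e0; near=> k.
have uke : u k <= e%:E by near: k; exact: h.
rewrite /= ger0_norm ?fine_ge0// -lee_fin fineK//.
by rewrite ge0_fin_numE// (le_lt_trans uke) ?ltry.
Unshelve. all: by end_near. Qed.

Lemma dominated_cvge0 d (T : measurableType d) (m : {measure set T -> \bar R})
    (f_ : nat -> T -> \bar R) (g : T -> \bar R) :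
  (forall k, measurable_fun setT (f_ k)) ->
  (forall k x, 0 <= f_ k x <= g x) ->
  (\forall x \ae m, f_ ^~ x @ \oo --> 0) ->
  m.-integrable setT g ->
  \int[m]_x f_ k x @[k --> \oo] --> 0.
Proof.
move=> mf f0g f0 ig.
have := @dominated_convergence _ T R m setT measurableT f_ (cst 0) g mf.
case=> //.
- by apply: filterS f0 => x fx _.
- by apply: aeW => x k _; have /andP[f0k fg] := f0g k x; rewrite gee0_abs.
- by move=> _ _; rewrite integral0.
Qed.

Lemma measurable_shift n (b : 'rV[R]_n) :
  measurable_fun [set: 'rV[R]_n] (fun x => x + b)%R.
Proof.
by under eq_fun do rewrite -[X in (X + _)%R]scale1r; exact: measurable_affine.
Qed.

Lemma integral_shift n (b : 'rV[R]_n) (g : 'rV[R]_n -> \bar R) :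
  measurable_fun [set: 'rV[R]_n] g -> (forall x, 0 <= g x) ->
  \int[mu n]_x g (x + b)%R = \int[mu n]_x g x.
Proof.
move=> mg g0; rewrite -[RHS](integral_affine b (oner_neq0 R))// normr1 expr1n.
by rewrite mul1e; under [in RHS]eq_integral do rewrite scale1r.
Qed.

Lemma integral_shiftR (b : R) (g : R -> \bar R) :
  measurable_fun [set: R] g -> (forall x, 0 <= g x) ->
  \int[@lebesgue_measure R]_x g (x + b)%R = \int[@lebesgue_measure R]_x g x.
Proof.
move=> mg g0; rewrite -[RHS](integral_affineR b (oner_neq0 R))// normr1.
by rewrite mul1e; under [in RHS]eq_integral do rewrite mul1r.
Qed.

Lemma measurable_shiftR (b : R) : measurable_fun [set: R] (fun x => x + b)%R.
Proof. exact: measurable_funD. Qed.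

(** The approximant is a continuous function cut off sharply at [-M] and [M], so it may jump at
    these two points; no smooth cut-off is constructed. *)
Lemma compactly_supported_approximation (h : R -> R) (e : R) : (0 < e)%R ->
  (@lebesgue_measure R).-integrable setT (EFin \o h) ->
  exists M C : R, exists g : R -> R,
  [/\ continuous g, measurable_fun setT (g \_ `[(- M)%R, M]%classic),
      (forall x, `|(g \_ `[(- M)%R, M]%classic) x| <= C)%R &
      \int[@lebesgue_measure R]_x `|h x - (g \_ `[(- M)%R, M]%classic) x|%:E
        <= e%:E].
Proof.
move=> e0 ih.
have mh : measurable_fun setT h by apply/measurable_EFinP; case/integrableP: ih.
pose E k : set R := `[(- k%:R)%R, k%:R]%classic.
have tail : \int[@lebesgue_measure R]_x `|h x - (h \_ (E k)) x|%:E
    @[k --> \oo] --> 0.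
  rewrite -[X in _ --> X](@integral0 _ _ _ (@lebesgue_measure R) setT).
  apply: (@dominated_cvg _ _ _ (@lebesgue_measure R) setT measurableT
    (fun k x => `|h x - (h \_ (E k)) x|%:E) (cst 0) (fun x => `|h x|%:E)) => //.
  - move=> k; apply/measurable_EFinP; apply: measurableT_comp => //.
    apply: measurable_funB => //; apply/measurable_restrict => //.
      exact: measurable_itv.
    exact: measurable_funTS.
  - move=> x _; apply: cvg_near_cst; near=> k.
    rewrite patchE ifT ?subrr ?normr0//.
    rewrite inE /E/= in_itv/= -ler_norml.
    by near: k; exact: nbhs_infty_ger.
  - exact: integrable_abse ih.
  - move=> k x _; rewrite lee_fin normr_id patchE.
    by case: ifPn => _; rewrite ?subrr ?normr0// subr0.
have e20 : (0 < e / 2)%R by rewrite divr_gt0.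
have [k _ /(_ k (leqnn k)) hk] := cvge0_near_le e20 tail.
pose M : R := k%:R.
have EM : E k = `[(- M)%R, M]%classic by [].
have mE : measurable (E k) by exact: measurable_itv.
have Efin : @lebesgue_measure R (E k) < +oo.
  by rewrite /E lebesgue_measure_itv/=; case: ifPn => _; rewrite ?ltry.
have ihE : (@lebesgue_measure R).-integrable (E k) (EFin \o h).
  exact: integrableS ih.
have [g_ [gc gi /(cvge0_near_le e20)[j _ /(_ j (leqnn j)) hj]]] :=
  approximation_continuous_integrable mE Efin ihE.
have mhE : measurable_fun setT (h \_ (E k)).
  by apply/measurable_restrict => //; exact: measurable_funTS.
have mg : measurable_fun setT (g_ j \_ (E k)).
  apply/measurable_restrict => //.
  by apply: measurable_funTS; apply: continuous_measurable_fun; exact: gc.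
have [c _ hc] : exists2 c, c \in `[- M, M]%R &
    forall t, t \in `[- M, M]%R -> (`|g_ j t| <= `|g_ j c|)%R.
  apply: EVT_max; first by rewrite ge0_cp.
  apply: continuous_subspaceT => x.
  by apply: continuous_comp; [exact: gc|exact: norm_continuous].
exists M, `|g_ j c|%R, (g_ j); split => //.
  move=> x; rewrite patchE; case: ifPn => [|_]; last by rewrite normr0.
  by rewrite inE => /hc.
apply: (@le_trans _ _ (\int[@lebesgue_measure R]_x
    (`|h x - (h \_ (E k)) x|%:E + `|(h \_ (E k)) x - (g_ j \_ (E k)) x|%:E))).
  apply: ge0_le_integral => //.
  - apply/measurable_EFinP; apply: measurableT_comp => //.
    exact: measurable_funB.
  - apply/measurable_EFinP.
    by apply: measurable_funD; apply: measurableT_comp => //; apply: measurable_funB.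
  - move=> x _; rewrite -EFinD lee_fin.
    by rewrite (le_trans _ (ler_normD _ _))// addrA subrK.
rewrite ge0_integralD//; last 2 first.
  by apply/measurable_EFinP; apply: measurableT_comp => //; apply: measurable_funB.
  by apply/measurable_EFinP; apply: measurableT_comp => //; apply: measurable_funB.
rewrite [e in X in _ <= X]splitr EFinD leeD//.
apply: le_trans hj; rewrite [leRHS]integral_mkcond.
apply: ge0_le_integral => //.
  by apply/measurable_EFinP; apply: measurableT_comp => //; apply: measurable_funB.
  apply/(measurable_restrictT _ _).1 => //; apply/measurable_EFinP.
  apply: measurableT_comp => //; apply: measurable_funB; apply: measurable_funTS => //.
  by apply: continuous_measurable_fun; exact: gc.
move=> x _; rewrite !patchE; case: ifPn => _; rewrite ?lexx//.
by rewrite subrr normr0.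
Unshelve. all: by end_near. Qed.

(** Dominated convergence. The translates converge pointwise except at the two possible jumps, and
    all of them live on an interval enlarged by a bound [A] of the sequence [a]. *)
Lemma translation_cvgR_bounded (g : R -> R) (M C : R) (a : R^nat) :
  continuous g -> measurable_fun setT (g \_ `[(- M)%R, M]%classic) ->
  (forall x, `|(g \_ `[(- M)%R, M]%classic) x| <= C)%R ->
  (a @ \oo --> 0)%R ->
  \int[@lebesgue_measure R]_x
    `|(g \_ `[(- M)%R, M]%classic) (x + a k)%R - (g \_ `[(- M)%R, M]%classic) x|%:E
    @[k --> \oo] --> 0.
Proof.
move=> gc mg gC a0; set p := g \_ _.
have [A hA] : exists A : R, forall k, (`|a k| <= A)%R.
  have /cvg_seq_bounded[A [Ar hA]] : cvgn a by apply/cvg_ex; exists 0%R.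
  exists (A + 1)%R => k; apply: hA => //; rewrite ltrDl//.
have C0 : (0 <= C)%R by apply: le_trans (gC 0%R).
pose D : set R := `[(- (M + A))%R, (M + A)%R]%classic.
have mD : measurable D by exact: measurable_itv.
apply: (@dominated_cvge0 _ _ (@lebesgue_measure R) _ (fun x => (C *+ 2 * \1_D x)%:E)).
- move=> k; apply/measurable_EFinP; apply: measurableT_comp => //.
  apply: measurable_funB => //.
  exact: (measurableT_comp mg (measurable_shiftR _)).
- move=> k x; rewrite lee_fin normr_ge0/= lee_fin indicE.
  have [_|xD] := boolP (x \in D).
    by rewrite mulr1 mulr2n (le_trans (ler_normB _ _))// lerD ?gC.
  rewrite mulr0 /p !patchE !ifN ?subrr ?normr0//.
    apply: contra xD; rewrite !inE /D /= !in_itv/= -!ler_norml => xM.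
    by rewrite (le_trans xM)// lerDl (le_trans _ (hA 0%N)).
  apply: contra xD; rewrite !inE /D /= !in_itv/= -!ler_norml => xM.
  rewrite -[x](addrK (a k)) (le_trans (ler_normB _ _))// lerD//.
- exists [set M; (- M)%R]; split.
  + exact: measurableU.
  + by apply: countable_lebesgue_measure0; exact: finite_set_countable.
  + move=> x /= hx; apply: contrapT => /not_orP[xM xNM]; apply: hx.
    apply/fine_cvgP; split; first by apply: nearW.
    apply/cvgr0Pnorm_lt => /= e e0.
    have xa : (x + a k @[k --> \oo] --> x)%R.
      by rewrite -[X in _ --> X]addr0; apply: cvgD => //; exact: cvg_cst.
    have a0' := (cvgr0Pnorm_lt a).1 a0.
    have ga : (g (x + a k) @[k --> \oo] --> g x)%R.
      exact: (cvg_comp _ _ xa (gc x)).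
    move/cvgrPdist_lt in ga.
    have [xlt|xle] := ltP `|x|%R M.
      have xM1 : (0 < M - `|x|)%R by rewrite subr_gt0.
      near=> k.
      have ak : (`|a k| < M - `|x|)%R by near: k; exact: a0'.
      rewrite /= normr_id /p !patchE !ifT.
      * by near: k; under eq_near do rewrite distrC; exact: ga.
      * by rewrite inE/= in_itv/= -ler_norml ltW.
      * rewrite inE/= in_itv/= -ler_norml (le_trans (ler_normD _ _))//.
        by rewrite -lerBrDl ltW.
    have xM1 : (0 < `|x| - M)%R.
      rewrite subr_gt0 lt_neqAle xle andbT; apply/eqP => Mx.
      have [x0|x0] := leP 0%R x; first by apply: xM; rewrite Mx ger0_norm.
      by apply: xNM; rewrite Mx ltr0_norm// opprK.
    near=> k.
    have ak : (`|a k| < `|x| - M)%R by near: k; exact: a0'.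
    rewrite /= normr_id /p !patchE !ifN ?subrr ?normr0//.
    * apply/negP; rewrite inE/= in_itv/= -ler_norml => h; lra.
    * apply/negP; rewrite inE/= in_itv/= -ler_norml => h.
      have := ler_normB (x + a k : R)%R (a k); rewrite addrK; lra.
- under eq_fun do rewrite EFinM.
  by apply: integrableZl => //; exact: integrable_indic_itv.
Unshelve. all: by end_near. Qed.

(** The usual approximation argument for an arbitrary measure-preserving [tau]: invariance makes the
    two errors [h - p] equal in norm, whence the factor 2. *)
Lemma le_integral_translation d (T : measurableType d)
    (m : {measure set T -> \bar R}) (tau : T -> T) (h p : T -> R) :
  measurable_fun setT tau -> measurable_fun setT h -> measurable_fun setT p ->
  (forall g : T -> \bar R, measurable_fun setT g -> (forall x, 0 <= g x) ->
     \int[m]_x g (tau x) = \int[m]_x g x) ->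
  \int[m]_x `|h (tau x) - h x|%:E <=
  2%:E * \int[m]_x `|h x - p x|%:E + \int[m]_x `|p (tau x) - p x|%:E.
Proof.
move=> mtau mh mp inv.
have mhp : measurable_fun setT (fun x => `|h x - p x|%:E).
  by apply/measurable_EFinP; apply: measurableT_comp => //; exact: measurable_funB.
have mp2 : measurable_fun setT (fun x => `|p (tau x) - p x|%:E).
  apply/measurable_EFinP; apply: measurableT_comp => //; apply: measurable_funB => //.
  exact: measurableT_comp.
have -> : 2%:E * \int[m]_x `|h x - p x|%:E =
    \int[m]_x `|h (tau x) - p (tau x)|%:E + \int[m]_x `|h x - p x|%:E.
  by rewrite (inv (fun x => `|h x - p x|%:E))// -mule2n mule_natl.
rewrite -ge0_integralD//; last exact: (measurableT_comp mhp mtau).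
rewrite -ge0_integralD//; last 2 first.
  by move=> x _; rewrite adde_ge0.
  by apply: emeasurable_funD => //; exact: (measurableT_comp mhp mtau).
apply: ge0_le_integral => //.
- apply/measurable_EFinP; apply: measurableT_comp => //; apply: measurable_funB => //.
  exact: measurableT_comp.
- apply: emeasurable_funD => //; apply: emeasurable_funD => //.
  exact: (measurableT_comp mhp mtau).
- move=> x _; rewrite -!EFinD lee_fin.
  rewrite (_ : h _ - h _ = (h (tau x) - p (tau x)) - (h x - p x) + (p (tau x) - p x))%R.
    by rewrite (le_trans (ler_normD _ _))// lerD2r ler_normB.
  by ring.
Qed.

Lemma translation_cvgR (h : R -> R) (a : R^nat) :
  (@lebesgue_measure R).-integrable setT (EFin \o h) -> (a @ \oo --> 0)%R ->
  \int[@lebesgue_measure R]_x `|h (x + a k)%R - h x|%:E @[k --> \oo] --> 0.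
Proof.
move=> ih a0; apply: near_le_cvge0 => [k|e e0]; first exact: integral_ge0.
have mh : measurable_fun setT h by apply/measurable_EFinP; case/integrableP: ih.
have e4 : (0 < e / 4)%R by rewrite divr_gt0.
have [M [C [g [gc mg gC hg]]]] := compactly_supported_approximation e4 ih.
have e2 : (0 < e / 2)%R by rewrite divr_gt0.
have := cvge0_near_le e2 (translation_cvgR_bounded gc mg gC a0).
apply: filterS => k hk.
apply: (le_trans (@le_integral_translation _ _ (@lebesgue_measure R)
  (fun x => x + a k)%R h _ _ mh mg _)).
- exact: measurable_shiftR.
- exact: integral_shiftR.
- apply: (@le_trans _ _ (2%:E * (e / 4)%:E + (e / 2)%:E)).
    by apply: leeD hk; apply: lee_wpmul2l.
  by rewrite -EFinM -EFinD lee_fin; lra.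
Qed.

End translation_continuity.

Section translation_continuity_rV.
Context {R : realType}.
Local Open Scope ereal_scope.

Lemma integrable_consvr n (h : 'rV[R]_n.+1 -> R) :
  (mu n.+1).-integrable setT (EFin \o h) ->
  \forall t \ae @lebesgue_measure R,
    (mu n).-integrable setT (fun v => (h (consv t v))%:E).
Proof.
move=> /integrableP[mh ih].
have mh2 : measurable_fun [set: R * 'rV[R]_n] (fun p => (h (consv p.1 p.2))%:E).
  exact: (measurableT_comp mh (@measurable_consv R n)).
apply: (@ae_integrable1 _ _ _ _ _ (@lebesgue_measure R) (mu n)
  (fun p => (h (consv p.1 p.2))%:E)).
apply/integrable12ltyP => //=.
by rewrite -(integral_muS (f := fun x => `|(h x)%:E|))//; exact: measurableT_comp.
Qed.

Lemma integrable_consvl n (h : 'rV[R]_n.+1 -> R) :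
  (mu n.+1).-integrable setT (EFin \o h) ->
  \forall v \ae mu n,
    (@lebesgue_measure R).-integrable setT (fun t => (h (consv t v))%:E).
Proof.
move=> /integrableP[mh ih].
have mh2 : measurable_fun [set: R * 'rV[R]_n] (fun p => (h (consv p.1 p.2))%:E).
  exact: (measurableT_comp mh (@measurable_consv R n)).
apply: (@ae_integrable2 _ _ _ _ _ (@lebesgue_measure R) (mu n)
  (fun p => (h (consv p.1 p.2))%:E)).
apply/integrable21ltyP => //=.
by rewrite -(integral_muS2 (f := fun x => `|(h x)%:E|))//; exact: measurableT_comp.
Qed.

Lemma consv_add n (t b : R) (v w : 'rV[R]_n) :
  (consv t v + consv b w)%R = consv (t + b)%R (v + w)%R.
Proof. by rewrite -[X in (X + _)%R]scale1r consv_affine mul1r scale1r. Qed.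

(** The case [p = 0] of the preceding estimate; it supplies the dominating functions for the slices
    in [translation_cvg] and for [plancherel_cvg]. *)
Lemma le_integral_translation2 d (T : measurableType d)
    (m : {measure set T -> \bar R}) (tau : T -> T) (h : T -> R) :
  measurable_fun setT tau -> measurable_fun setT h ->
  (forall g : T -> \bar R, measurable_fun setT g -> (forall x, 0 <= g x) ->
     \int[m]_x g (tau x) = \int[m]_x g x) ->
  \int[m]_x `|h (tau x) - h x|%:E <= 2%:E * \int[m]_x `|h x|%:E.
Proof.
move=> mtau mh inv.
have := le_integral_translation (p := fun=> 0%R) mtau mh (measurable_cst _) inv.
move=> /le_trans; apply; under eq_integral do rewrite subr0.
rewrite [X in _ + X]integral0_eq ?adde0// => x _.
by rewrite /= subrr normr0.
Qed.

Lemma measurable_integral_consvl n (f : 'rV[R]_n.+1 -> \bar R) :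
  measurable_fun [set: 'rV[R]_n.+1] f -> (forall x, 0 <= f x) ->
  measurable_fun [set: 'rV[R]_n] (fun v => \int[@lebesgue_measure R]_t f (consv t v)).
Proof.
move=> mf f0.
apply: (@measurable_fun_fubini_tonelli_G _ _ _ _ _ (@lebesgue_measure R)
  (fun p => f (consv p.1 p.2))) => //.
exact: (measurableT_comp mf (@measurable_consv R n)).
Qed.

Lemma integrable_integral_consvr n (f : 'rV[R]_n.+1 -> \bar R) :
  (mu n.+1).-integrable [set: 'rV[R]_n.+1] f -> (forall x, 0 <= f x) ->
  (@lebesgue_measure R).-integrable setT (fun t => \int[mu n]_v f (consv t v)).
Proof.
move=> /integrableP[mf intf] f0; apply/integrableP; split.
  exact: measurable_integral_consv.
under eq_integral do rewrite gee0_abs ?integral_ge0//.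
rewrite -integral_muS//; apply: le_lt_trans intf.
apply: ge0_le_integral => //; first exact: measurableT_comp.
by move=> x _; rewrite gee0_abs.
Qed.

Lemma integrable_integral_consvl n (f : 'rV[R]_n.+1 -> \bar R) :
  (mu n.+1).-integrable [set: 'rV[R]_n.+1] f -> (forall x, 0 <= f x) ->
  (mu n).-integrable setT (fun v => \int[@lebesgue_measure R]_t f (consv t v)).
Proof.
move=> /integrableP[mf intf] f0; apply/integrableP; split.
  exact: measurable_integral_consvl.
under eq_integral do rewrite gee0_abs ?integral_ge0//.
rewrite -integral_muS2//; apply: le_lt_trans intf.
apply: ge0_le_integral => //; first exact: measurableT_comp.
by move=> x _; rewrite gee0_abs.
Qed.

(** The translation is the composite of one in the first coordinate and one in the others. For each
    of the two, almost every slice of [h] is integrable and its translation error tends to 0, by the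
    one-dimensional result or by induction; the errors of the slices are dominated by twice their
    norms. *)
Lemma translation_cvg n (h : 'rV[R]_n -> R) (a : nat -> 'rV[R]_n) :
  (mu n).-integrable setT (EFin \o h) ->
  (forall i, a k ord0 i @[k --> \oo] --> 0%R) ->
  \int[mu n]_x `|h (x + a k)%R - h x|%:E @[k --> \oo] --> 0.
Proof.
elim: n h a => [|n ih] h a inth a0.
  rewrite (_ : (fun k => _) = cst 0); first exact: cvg_cst.
  apply/funext => k; apply: integral0_eq => x _.
  by rewrite (_ : (x + a k)%R = x) ?subrr ?normr0//; apply/rowP => -[].
have mh : measurable_fun setT h.
  by apply/measurable_EFinP; case/integrableP: inth.
pose b k := a k ord0 ord0; pose c k : 'rV[R]_n := \row_i a k ord0 (lift ord0 i).
have ak k : a k = consv (b k) (c k) by exact: consvE.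
pose b' k : 'rV[R]_n.+1 := consv (b k) 0%R.
pose c' k : 'rV[R]_n.+1 := consv 0%R (c k).
have akE k : a k = (c' k + b' k)%R by rewrite consv_add add0r addr0.
pose D (u x : 'rV[R]_n.+1) : \bar R := `|h (x + u)%R - h x|%:E.
have mD u : measurable_fun [set: 'rV[R]_n.+1] (D u).
  apply/measurable_EFinP; apply: measurableT_comp => //; apply: measurable_funB => //.
  exact: (measurableT_comp mh (measurable_shift _)).
have D0 u x : 0 <= D u x by rewrite lee_fin.
pose Phi k v := \int[@lebesgue_measure R]_t D (b' k) (consv t v).
pose Psi k t := \int[mu n]_v D (c' k) (consv t v).
have bound k : \int[mu n.+1]_x D (a k) x <=
    \int[mu n]_v Phi k v + \int[@lebesgue_measure R]_t Psi k t.
  rewrite /Phi -integral_muS2// /Psi -integral_muS//.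
  rewrite -[X in _ <= X + _](integral_shift (c' k))// -ge0_integralD//; last first.
    exact: (measurableT_comp (mD _) (measurable_shift _)).
  apply: ge0_le_integral => //.
    apply: emeasurable_funD => //.
    exact: (measurableT_comp (mD _) (measurable_shift _)).
  move=> x _; rewrite -EFinD lee_fin akE addrA.
  by rewrite (le_trans _ (ler_normD _ _))// addrA subrK.
have inth1 : (mu n.+1).-integrable setT (fun x => `|h x|%:E).
  exact: integrable_abse inth.
have mh1 : measurable_fun setT (fun x => `|h x|%:E) by case/integrableP: inth1.
have cvPhi : \int[mu n]_v Phi k v @[k --> \oo] --> 0.
  apply: (@dominated_cvge0 _ _ _ _ _
    (fun v => 2%:E * \int[@lebesgue_measure R]_t `|h (consv t v)|%:E)).
  - by move=> k; exact: measurable_integral_consvl.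
  - move=> k v; rewrite integral_ge0//=.
    rewrite /Phi /D; under eq_integral do rewrite consv_add addr0.
    apply: (@le_integral_translation2 _ _ (@lebesgue_measure R) (fun t => t + b k)%R
        (fun t => h (consv t v))).
    + exact: measurable_shiftR.
    + exact: (measurableT_comp mh (measurable_consvl _)).
    + exact: integral_shiftR.
  - have := integrable_consvl inth; apply: filterS => v iv.
    rewrite /Phi /D.
    under eq_fun do under eq_integral do rewrite consv_add addr0.
    exact: (translation_cvgR (h := fun t => h (consv t v)) iv (a0 ord0)).
  - by apply: integrableZl => //; exact: (integrable_integral_consvl inth1).
have cvPsi : \int[@lebesgue_measure R]_t Psi k t @[k --> \oo] --> 0.
  apply: (@dominated_cvge0 _ _ _ (@lebesgue_measure R) _
    (fun t => 2%:E * \int[mu n]_v `|h (consv t v)|%:E)).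
  - by move=> k; exact: measurable_integral_consv.
  - move=> k t; rewrite integral_ge0//=.
    rewrite /Psi /D; under eq_integral do rewrite consv_add addr0.
    apply: (@le_integral_translation2 _ _ (mu n) (fun v => v + c k)%R
        (fun v => h (consv t v))).
    + exact: measurable_shift.
    + exact: (measurableT_comp mh (measurable_consvr _)).
    + exact: integral_shift.
  - apply: (@filterS _ _ (ae_filter_ringOfSetsType (@lebesgue_measure R)) _ _ _
      (integrable_consvr inth)) => t iv.
    rewrite /Psi /D.
    under eq_fun do under eq_integral do rewrite consv_add addr0.
    apply: (ih (fun v => h (consv t v)) c iv) => i.
    by under eq_fun do rewrite mxE; exact: a0.
  - by apply: integrableZl => //; exact: (integrable_integral_consvr inth1).
have PhiPsi : \int[mu n]_v Phi k v + \int[@lebesgue_measure R]_t Psi k t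
    @[k --> \oo] --> 0.
  by rewrite -[X in _ --> X]adde0; apply: cvgeD.
apply: near_le_cvge0 => [k|e e0]; first exact: integral_ge0.
by have := cvge0_near_le e0 PhiPsi; apply: filterS => k; apply: le_trans; exact: bound.
Qed.
End translation_continuity_rV.

(** * Real integrable functions *)

Section integrable_real.
Context d (T : measurableType d) {R : realType} (m : {measure set T -> \bar R}).
Implicit Types f g : T -> R.

Definition L1 f := m.-integrable [set: T] (EFin \o f).

Lemma L1P f : L1 f <->
  measurable_fun setT f /\ (\int[m]_x (`|f x|)%:E < +oo)%E.
Proof.
split=> [/integrableP[/measurable_EFinP]//|[mf intf]].
by apply/integrableP; split=> //; exact/measurable_EFinP.
Qed.

Lemma L1_measurable f : L1 f -> measurable_fun setT f.
Proof. by case/L1P. Qed.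

Lemma le_L1 f g : measurable_fun setT f -> (forall x, `|f x| <= `|g x|) ->
  L1 g -> L1 f.
Proof.
move=> mf fg; apply: le_integrable => //; first exact/measurable_EFinP.
by move=> x _; rewrite lee_fin.
Qed.

Lemma L1D f g : L1 f -> L1 g -> L1 (fun x => f x + g x).
Proof.
move=> /L1P[mf intf] /L1P[mg intg]; apply/L1P; split.
  exact: measurable_funD.
apply: (@le_lt_trans _ _ (\int[m]_x (`|f x|%:E + `|g x|%:E))%E).
  apply: ge0_le_integral => //.
  - by apply/measurable_EFinP; apply: measurableT_comp => //; exact: measurable_funD.
  - by apply: emeasurable_funD; apply/measurable_EFinP; exact: measurableT_comp.
  - by move=> x _; rewrite -EFinD lee_fin ler_normD.
rewrite ge0_integralD//; first exact: lte_add_pinfty.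
- by apply/measurable_EFinP; exact: measurableT_comp.
- by apply/measurable_EFinP; exact: measurableT_comp.
Qed.

Lemma L1Z (k : R) f : L1 f -> L1 (fun x => k * f x).
Proof.
move=> Lf; rewrite /L1 (_ : _ \o _ = (fun x => k%:E * (f x)%:E)%E)//.
exact: integrableZl.
Qed.

Lemma L1N f : L1 f -> L1 (fun x => - f x).
Proof. by move=> /(L1Z (-1)); under eq_fun do rewrite mulN1r. Qed.

Lemma L1B f g : L1 f -> L1 g -> L1 (fun x => f x - g x).
Proof. by move=> Lf Lg; apply: L1D => //; exact: L1N. Qed.

Lemma L1_norm f : L1 f -> L1 (fun x => `|f x|).
Proof.
move=> Lf; apply: (le_L1 _ _ Lf) => [|x]; last by rewrite normr_id.
by apply: measurableT_comp => //; exact: L1_measurable.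
Qed.

Lemma L1M (C : R) f g : L1 f -> measurable_fun setT g ->
  (forall x, `|g x| <= C) -> L1 (fun x => f x * g x).
Proof.
move=> Lf mg gC; have mf := L1_measurable Lf.
apply: (le_L1 (g := fun x => C * f x)); last exact: L1Z.
  exact: measurable_funM.
move=> x; rewrite !normrM mulrC ler_wpM2r// (le_trans (gC x))//.
exact: ler_norm.
Qed.

Lemma Rintegral_norm_le f (b : R) : (\int[m]_x `|f x|%:E <= b%:E)%E ->
  measurable_fun setT f -> `|\int[m]_x f x| <= b.
Proof.
move=> fb mf; have Lf : L1 f by apply/L1P; split=> //; rewrite (le_lt_trans fb)// ltry.
rewrite -lee_fin (le_trans _ fb)//.
by rewrite EFin_normr_Rintegral// le_abse_integral//; exact/measurable_EFinP.
Qed.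

Lemma Rintegral_norm_leE f : measurable_fun setT f ->
  ((`|\int[m]_x f x|)%:E <= \int[m]_x `|f x|%:E)%E.
Proof.
move=> mf; apply: (@le_trans _ _ (`|\int[m]_x (f x)%:E|)%E).
  by rewrite /Rintegral; case: (\int[m]_x _)%E => //= *; rewrite ?normr0 ?leey.
by rewrite le_abse_integral//; exact/measurable_EFinP.
Qed.

Lemma Rintegral_reindex (tau : T -> T) (h : T -> R) : measurable_fun [set: T] tau ->
  (forall g : T -> \bar R, measurable_fun [set: T] g -> (forall x, 0 <= g x)%E ->
    \int[m]_x g (tau x) = \int[m]_x g x)%E ->
  measurable_fun [set: T] h -> \int[m]_x h (tau x) = \int[m]_x h x.
Proof.
move=> mtau inv mh; congr fine.
have mh' : measurable_fun [set: T] (EFin \o h) by exact/measurable_EFinP.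
rewrite integralE [RHS]integralE; congr (_ - _)%E.
  rewrite -[RHS](inv (funepos (EFin \o h)))//; last exact: measurable_funepos.
  by apply: eq_integral => x _; rewrite !funeposE.
rewrite -[RHS](inv (funeneg (EFin \o h)))//; last exact: measurable_funeneg.
by apply: eq_integral => x _; rewrite !funenegE.
Qed.

Lemma L1_reindex (tau : T -> T) (h : T -> R) : measurable_fun [set: T] tau ->
  (forall g : T -> \bar R, measurable_fun [set: T] g -> (forall x, 0 <= g x)%E ->
    \int[m]_x g (tau x) = \int[m]_x g x)%E ->
  L1 h -> L1 (fun x => h (tau x)).
Proof.
move=> mtau inv /L1P[mh ih]; apply/L1P; split; first exact: (measurableT_comp mh mtau).
rewrite (inv (fun x => `|h x|%:E))//.
by apply/measurable_EFinP; exact: measurableT_comp.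
Qed.

End integrable_real.
Arguments L1 {d T R} m f.

(** * Fubini's theorem for real-valued integrals *)

Section fubini_real.
Context d1 d2 (T1 : measurableType d1) (T2 : measurableType d2) {R : realType}.
Variables (m1 : {sigma_finite_measure set T1 -> \bar R}).
Variables (m2 : {sigma_finite_measure set T2 -> \bar R}).
Variable f : T1 * T2 -> R.

Lemma L1_fubini_fst : L1 (m1 \x m2)%E f -> L1 m1 (fun x => \int[m2]_y f (x, y)).
Proof.
move=> Lf; have iF := integrable_fubini_F Lf.
apply: (le_integrable measurableT _ _ iF).
  apply/measurable_EFinP; apply: (measurableT_comp (fine_measurable measurableT)).
  by case/integrableP: iF.
move=> x _ /=; rewrite /Rintegral/fubini_F/=.
by case: (\int[m2]_y _)%E => //=; rewrite ?leey// normr0 leey.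
Qed.

(** The inner [Rintegral] is [fine] of an extended integral. The two agree where that integral is
    finite, hence almost everywhere, which suffices for the outer integral. *)
Lemma Rintegral_fubini1 : L1 (m1 \x m2)%E f ->
  \int[m1]_x \int[m2]_y f (x, y) = \int[(m1 \x m2)%E]_z f z.
Proof.
move=> Lf; rewrite [RHS]/Rintegral -(integral12_prod_meas1 Lf).
have iF := integrable_fubini_F Lf.
congr fine; apply: ae_eq_integral => //.
- by have /integrableP[] := L1_fubini_fst Lf.
- by case/integrableP: iF.
- have := integrable_ae measurableT iF; apply: filterS => x /(_ I) + _.
  by rewrite /fubini_F/= /Rintegral => /fineK.
Qed.

Lemma L1_prod : measurable_fun setT f ->
  (\int[m2]_y \int[m1]_x `|f (x, y)|%:E < +oo)%E -> L1 (m1 \x m2)%E f.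
Proof. by move=> mf h; apply/integrable21ltyP => //; exact/measurable_EFinP. Qed.

End fubini_real.

Section fubini_real_swap.
Context d1 d2 (T1 : measurableType d1) (T2 : measurableType d2) {R : realType}.
Variables (m1 : {sigma_finite_measure set T1 -> \bar R}).
Variables (m2 : {sigma_finite_measure set T2 -> \bar R}).
Variable f : T1 * T2 -> R.

Let integrable_fubini_G : L1 (m1 \x m2)%E f ->
  m2.-integrable setT (fubini_G m1 (EFin \o f)).
Proof.
move=> Lf; have [mf _] := integrableP _ _ _ Lf.
apply/integrableP; split; first exact: (measurable_fubini_G Lf).
apply: (le_lt_trans _ ((integrable21ltyP m1 m2 mf).1 Lf)).
apply: ge0_le_integral => //.
- by apply: measurableT_comp => //; exact: (measurable_fubini_G Lf).
- apply: (measurable_fun_fubini_tonelli_G (abse \o (EFin \o f))) => //.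
    exact: measurableT_comp.
  by move=> x; exact: abse_ge0.
- move=> y _; apply: le_abse_integral => //.
  exact: (measurableT_comp mf (measurable_pair2 y)).
Qed.

Lemma L1_fubini_snd : L1 (m1 \x m2)%E f -> L1 m2 (fun y => \int[m1]_x f (x, y)).
Proof.
move=> Lf; have iG := integrable_fubini_G Lf.
apply: (le_integrable measurableT _ _ iG).
  apply/measurable_EFinP; apply: (measurableT_comp (fine_measurable measurableT)).
  by case/integrableP: iG.
move=> y _ /=; rewrite /Rintegral/fubini_G/=.
by case: (\int[m1]_x _)%E => //=; rewrite ?leey// normr0 leey.
Qed.

Lemma Rintegral_fubini : L1 (m1 \x m2)%E f ->
  \int[m1]_x \int[m2]_y f (x, y) = \int[m2]_y \int[m1]_x f (x, y).
Proof.
move=> Lf; rewrite Rintegral_fubini1// [LHS]/Rintegral -(integral21_prod_meas1 Lf).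
have iG := integrable_fubini_G Lf.
congr fine; apply: ae_eq_integral => //.
- by case/integrableP: iG.
- by have /integrableP[] := L1_fubini_snd Lf.
- have := integrable_ae measurableT iG; apply: filterS => x /(_ I) + _.
  by rewrite /fubini_G/= /Rintegral => /fineK.
Qed.

End fubini_real_swap.

(** * The Hartley transform *)

Definition cas {R : realType} (t : R) : R := cos t + sin t.

Section cas.
Context {R : realType}.
Implicit Types s t : R.

Lemma cas_le2 t : `|cas t| <= 2.
Proof.
by rewrite (le_trans (ler_normD _ _))// -[2]/(1 + 1) lerD// ler_norml;
  rewrite ?cos_geN1 ?cos_le1 ?sin_geN1 ?sin_le1.
Qed.

Lemma cas_pi t : cas (t + pi) = - cas t.
Proof. by rewrite /cas cosDpi sinDpi opprD. Qed.

Lemma continuous_cas : continuous (@cas R).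
Proof.
by move=> t; apply: cvgD; [exact: continuous_cos|exact: continuous_sin].
Qed.

End cas.

Section hartley.
Context {R : realType} {n : nat}.
Local Notation V := ('rV[R]_n).
Local Notation m := (@mu R n).
Implicit Types (g h : V -> R) (x y xi eta : V).

Lemma dotRnC x y : dotRn x y = dotRn y x.
Proof. by apply: eq_bigr => i _; rewrite mulrC. Qed.

Lemma dotRnDr x y z : dotRn x (y + z) = dotRn x y + dotRn x z :> R.
Proof. by rewrite -big_split/=; apply: eq_bigr => i _; rewrite mxE mulrDr. Qed.

Lemma dotRnNr x y : dotRn x (- y) = - dotRn x y :> R.
Proof. by rewrite -sumrN; apply: eq_bigr => i _; rewrite mxE mulrN. Qed.

Lemma dotRnNl x y : dotRn (- x) y = - dotRn x y :> R.
Proof. by rewrite dotRnC dotRnNr dotRnC. Qed.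

Lemma measurable_dotRn2 :
  measurable_fun [set: V * V] (fun p : V * V => dotRn p.1 p.2).
Proof.
apply: measurable_sum => i; apply: measurable_funM.
  exact: (measurableT_comp (measurable_coord i) measurable_fst).
exact: (measurableT_comp (measurable_coord i) measurable_snd).
Qed.

Lemma measurable_dotRn x : measurable_fun [set: V] (dotRn x).
Proof. exact: (measurableT_comp measurable_dotRn2 (measurable_pair1 x)). Qed.

Lemma measurable_sub2 : measurable_fun [set: V * V] (fun p : V * V => p.1 - p.2).
Proof.
apply: measurable_rV => // i; under eq_fun do rewrite !mxE.
apply: measurable_funB.
  exact: (measurableT_comp (measurable_coord i) measurable_fst).
exact: (measurableT_comp (measurable_coord i) measurable_snd).
Qed.

Lemma measurable_opprV : measurable_fun [set: V] (fun x => - x).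
Proof.
apply: measurable_rV => // i; under eq_fun do rewrite mxE.
by apply: measurableT_comp => //; exact: measurable_coord.
Qed.

Lemma integral_oppr (g : V -> \bar R) : measurable_fun [set: V] g ->
  (forall x, (0 <= g x)%E) -> (\int[m]_x g (- x)%R = \int[m]_x g x)%E.
Proof.
move=> mg g0; have N1 : (-1 : R) != 0 by rewrite oppr_eq0 oner_neq0.
rewrite -[RHS](integral_affine 0 N1)// normrN1 expr1n mul1e.
by under [in RHS]eq_integral do rewrite addr0 scaleN1r.
Qed.

Definition reflect h xi := h (- xi).
Definition evenpart h xi := (h xi + h (- xi)) / 2.
Definition oddpart h xi := (h xi - h (- xi)) / 2.
Definition hartley h x := \int[m]_xi (h xi * cas (dotRn x xi)).
Definition cosT h x := \int[m]_xi (h xi * cos (dotRn x xi)).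
Definition sinT h x := \int[m]_xi (h xi * sin (dotRn x xi)).
Definition conv g h xi := \int[m]_eta (g (xi - eta) * h eta).

Lemma L1_reflect h : L1 m h -> L1 m (reflect h).
Proof. exact: (L1_reindex measurable_opprV integral_oppr). Qed.

Lemma L1_evenpart h : L1 m h -> L1 m (evenpart h).
Proof.
move=> Lh; have := L1Z 2^-1 (L1D Lh (L1_reflect Lh)).
by congr L1; apply/funext => xi; rewrite /evenpart mulrC.
Qed.

Lemma L1_oddpart h : L1 m h -> L1 m (oddpart h).
Proof.
move=> Lh; have := L1Z 2^-1 (L1B Lh (L1_reflect Lh)).
by congr L1; apply/funext => xi; rewrite /oddpart mulrC.
Qed.

Lemma measurable_comp_dotRn (f : R -> R) x : continuous f ->
  measurable_fun [set: V] (fun xi => f (dotRn x xi)).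
Proof.
move=> cf; apply: (measurableT_comp (continuous_measurable_fun cf)).
exact: measurable_dotRn.
Qed.

Lemma L1_cas h x : L1 m h -> L1 m (fun xi => h xi * cas (dotRn x xi)).
Proof.
move=> Lh; apply: (@L1M _ _ _ _ 2) => //; last by move=> ?; exact: cas_le2.
by apply: measurable_comp_dotRn; exact: continuous_cas.
Qed.

Lemma L1_cos h x : L1 m h -> L1 m (fun xi => h xi * cos (dotRn x xi)).
Proof.
move=> Lh; apply: (@L1M _ _ _ _ 1) => //; first by apply: measurable_comp_dotRn; exact: continuous_cos.
by move=> ?; rewrite ler_norml cos_geN1 cos_le1.
Qed.

Lemma L1_sin h x : L1 m h -> L1 m (fun xi => h xi * sin (dotRn x xi)).
Proof.
move=> Lh; apply: (@L1M _ _ _ _ 1) => //; first by apply: measurable_comp_dotRn; exact: continuous_sin.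
by move=> ?; rewrite ler_norml sin_geN1 sin_le1.
Qed.

Lemma Rintegral_reflect h : measurable_fun setT h ->
  \int[m]_xi h (- xi) = \int[m]_xi h xi.
Proof. exact: (Rintegral_reindex measurable_opprV integral_oppr). Qed.

Lemma hartleyE h x : L1 m h -> hartley h x = cosT h x + sinT h x.
Proof.
move=> Lh; rewrite -RintegralD//; [|exact: L1_cos|exact: L1_sin].
by apply: eq_Rintegral => xi _; rewrite /cas mulrDr.
Qed.

Lemma cosT_reflect h x : L1 m h -> cosT (reflect h) x = cosT h x.
Proof.
move=> Lh; rewrite /cosT -[RHS]Rintegral_reflect; last exact: L1_measurable (L1_cos _ Lh).
by apply: eq_Rintegral => xi _; rewrite dotRnNr cosN.
Qed.

Lemma sinT_reflect h x : L1 m h -> sinT (reflect h) x = - sinT h x.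
Proof.
move=> Lh; rewrite /sinT -mulN1r -RintegralZl//; last exact: L1_sin.
rewrite -[RHS]Rintegral_reflect; last exact: L1_measurable (L1Z _ (L1_sin _ Lh)).
by apply: eq_Rintegral => xi _; rewrite dotRnNr sinN mulN1r mulrN opprK.
Qed.

Lemma cosT_evenpart h x : L1 m h -> cosT (evenpart h) x = cosT h x.
Proof.
move=> Lh; have Lrh := L1_reflect Lh.
transitivity (2^-1 * (cosT h x + cosT (reflect h) x)).
  rewrite -RintegralD//; [|exact: L1_cos|exact: L1_cos].
  rewrite -RintegralZl//; last by apply: L1D; exact: L1_cos.
  by apply: eq_Rintegral => xi _; rewrite /evenpart /reflect; ring.
by rewrite cosT_reflect//; field.
Qed.

Lemma sinT_evenpart h x : L1 m h -> sinT (evenpart h) x = 0.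
Proof.
move=> Lh; have Lrh := L1_reflect Lh.
transitivity (2^-1 * (sinT h x + sinT (reflect h) x)).
  rewrite -RintegralD//; [|exact: L1_sin|exact: L1_sin].
  rewrite -RintegralZl//; last by apply: L1D; exact: L1_sin.
  by apply: eq_Rintegral => xi _; rewrite /evenpart /reflect; ring.
by rewrite sinT_reflect// subrr mulr0.
Qed.

Lemma cosT_oddpart h x : L1 m h -> cosT (oddpart h) x = 0.
Proof.
move=> Lh; have Lrh := L1_reflect Lh.
transitivity (2^-1 * (cosT h x - cosT (reflect h) x)).
  rewrite -RintegralB//; [|exact: L1_cos|exact: L1_cos].
  rewrite -RintegralZl//; last by apply: L1B; exact: L1_cos.
  by apply: eq_Rintegral => xi _; rewrite /oddpart /reflect; ring.
by rewrite cosT_reflect// subrr mulr0.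
Qed.

Lemma sinT_oddpart h x : L1 m h -> sinT (oddpart h) x = sinT h x.
Proof.
move=> Lh; have Lrh := L1_reflect Lh.
transitivity (2^-1 * (sinT h x - sinT (reflect h) x)).
  rewrite -RintegralB//; [|exact: L1_sin|exact: L1_sin].
  rewrite -RintegralZl//; last by apply: L1B; exact: L1_sin.
  by apply: eq_Rintegral => xi _; rewrite /oddpart /reflect; ring.
by rewrite sinT_reflect//; field.
Qed.

(** Tonelli with the variable of [g] integrated first, so that translation invariance removes the
    shift. The bounded factor [phi] is a test function, later a kernel such as [cas]. *)
Lemma L1_conv_prod g h (phi : V -> R) (C : R) : L1 m g -> L1 m h ->
  measurable_fun setT phi -> (forall x, `|phi x| <= C) ->
  L1 (m \x m)%E (fun p : V * V => g (p.1 - p.2) * h p.2 * phi p.1).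
Proof.
move=> Lg Lh mphi phiC.
have [mg mh] := (L1_measurable Lg, L1_measurable Lh).
have mabsg : measurable_fun [set: V] (fun xi => `|g xi|%:E).
  by apply/measurable_EFinP; exact: measurableT_comp.
have C0 : 0 <= C by exact: le_trans (phiC 0).
have mf : measurable_fun [set: V * V]
    (fun p : V * V => g (p.1 - p.2) * h p.2 * phi p.1).
  apply: measurable_funM; last exact: measurableT_comp.
  apply: measurable_funM; last exact: measurableT_comp.
  exact: (measurableT_comp mg measurable_sub2).
apply: L1_prod => //=.
apply: (@le_lt_trans _ _ (\int[m]_eta ((C * `|h eta|)%:E * \int[m]_xi `|g xi|%:E))%E).
  apply: ge0_le_integral => //.
  - by move=> eta _; exact: integral_ge0.
  - apply: (measurable_fun_fubini_tonelli_G
      (fun p : V * V => `|g (p.1 - p.2) * h p.2 * phi p.1|%:E)) => //.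
    by apply/measurable_EFinP; exact: measurableT_comp.
  - apply: emeasurable_funM => //; apply/measurable_EFinP.
    by apply: measurable_funM => //; exact: measurableT_comp.
  - move=> eta _; rewrite -(integral_shift (- eta) mabsg)//.
    rewrite -ge0_integralZl//=; last 2 first.
      exact: (measurableT_comp mabsg (measurable_shift _)).
      by rewrite lee_fin mulr_ge0.
    apply: ge0_le_integral => //.
    + apply/measurable_EFinP; apply: measurableT_comp => //.
      exact: (measurableT_comp mf (measurable_pair2 eta)).
    + apply: emeasurable_funM => //.
      exact: (measurableT_comp mabsg (measurable_shift _)).
    + move=> xi _; rewrite -EFinM lee_fin !normrM.
      rewrite [leRHS]mulrC -mulrA ler_wpM2l// mulrC ler_wpM2r//.
have /L1P[_ Lg'] := Lg; have /L1P[_ Lh'] := Lh.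
under eq_integral do rewrite EFinM muleAC.
rewrite ge0_integralZl//=; last 2 first.
  by apply/measurable_EFinP; exact: measurableT_comp.
  by rewrite mule_ge0//; exact: integral_ge0.
by rewrite !lte_mul_pinfty// ?ge0_fin_numE ?mule_ge0 ?integral_ge0// ?lte_mul_pinfty// ?ltry.
Qed.

(** A factor may be moved into the integral only where the slice is integrable, which Fubini grants
    almost everywhere. *)
Lemma conv_ae g h (phi : V -> R) : L1 m g -> L1 m h ->
  \forall xi \ae m, conv g h xi * phi xi =
    \int[m]_eta (g (xi - eta) * h eta * phi xi).
Proof.
move=> Lg Lh.
have L := @L1_conv_prod g h (cst 1) 1 Lg Lh (measurable_cst _)
  (fun x => ltac:(by rewrite /= normr1)).
have := ae_integrable1 L; apply: filterS => xi Lxi.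
rewrite /conv RintegralZr//.
by move: Lxi; congr integrable; apply/funext => eta /=; rewrite mulr1.
Qed.

Lemma L1_conv g h : L1 m g -> L1 m h -> L1 m (conv g h).
Proof.
move=> Lg Lh.
have L := @L1_conv_prod g h (cst 1) 1 Lg Lh (measurable_cst _)
  (fun x => ltac:(by rewrite /= normr1)).
have := L1_fubini_fst L; congr L1; apply/funext => xi.
by apply: eq_Rintegral => eta _ /=; rewrite mulr1.
Qed.

Lemma Rintegral_conv g h (phi : V -> R) (C : R) : L1 m g -> L1 m h ->
  measurable_fun setT phi -> (forall x, `|phi x| <= C) ->
  \int[m]_xi (conv g h xi * phi xi) =
  \int[m]_eta (h eta * \int[m]_xi (g xi * phi (xi + eta))).
Proof.
move=> Lg Lh mphi phiC.
have L := L1_conv_prod Lg Lh mphi phiC.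
have mg := L1_measurable Lg.
transitivity (\int[m]_xi \int[m]_eta (g (xi - eta) * h eta * phi xi)).
  congr fine; apply: ae_eq_integral => //.
  - apply/measurable_EFinP; apply: measurable_funM => //.
    exact: L1_measurable (L1_conv Lg Lh).
  - by have /integrableP[] := L1_fubini_fst L.
  - by apply: filterS (conv_ae phi Lg Lh) => xi ->.
rewrite (Rintegral_fubini L)/=; apply: eq_Rintegral => eta _.
have mF : measurable_fun [set: V] (fun xi => g xi * phi (xi + eta)).
  apply: measurable_funM => //.
  exact: (measurableT_comp mphi (measurable_shift _)).
rewrite -(Rintegral_reindex (measurable_shift (- eta)) (integral_shift (- eta)) mF).
rewrite -RintegralZl//.
  by apply: eq_Rintegral => xi _; rewrite subrK; ring.
apply: (L1_reindex (measurable_shift (- eta)) (integral_shift (- eta))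
  (h := fun xi => g xi * phi (xi + eta))).
apply: (L1M (C := C)) => //.
exact: (measurableT_comp mphi (measurable_shift _)).
Qed.

(** The term with [cas (- s)] is the source of [hartley g (- x)] in the convolution formula. *)
Lemma casD (s t : R) : cas (s + t) = cas s * cos t + cas (- s) * sin t.
Proof. by rewrite /cas cosD sinD cosN sinN; ring. Qed.

Lemma hartley_conv g h x : L1 m g -> L1 m h ->
  hartley (conv g h) x = hartley g x * cosT h x + hartley g (- x) * sinT h x.
Proof.
move=> Lg Lh; rewrite /hartley (Rintegral_conv (C := 2)) => //; last 2 first.
- by apply: measurable_comp_dotRn; exact: continuous_cas.
- by move=> ?; exact: cas_le2.
rewrite -!RintegralZl//; [|exact: L1_sin|exact: L1_cos].
rewrite -RintegralD//; [|by apply: L1Z; exact: L1_cos|by apply: L1Z; exact: L1_sin].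
apply: eq_Rintegral => eta _.
under eq_Rintegral do rewrite dotRnDr casD -dotRnNl mulrDr !mulrA.
rewrite RintegralD//; last 2 first.
- under eq_fun do rewrite mulrC; apply: L1Z; exact: L1_cas.
- under eq_fun do rewrite mulrC; apply: L1Z; exact: L1_cas.
rewrite RintegralZr//; last exact: L1_cas.
rewrite RintegralZr//; last exact: L1_cas.
by ring.
Qed.

(* The kernel whose Hartley transform is the product of those of [g] and [h]:
   [hartley (conv g h)] alone mixes [hartley g x] with [hartley g (- x)]. *)
Definition hprod g h xi := conv g (evenpart h) xi + conv (reflect g) (oddpart h) xi.

Lemma L1_hprod g h : L1 m g -> L1 m h -> L1 m (hprod g h).
Proof.
move=> Lg Lh; apply: L1D; apply: L1_conv => //.
- exact: L1_evenpart.
- exact: L1_reflect.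
- exact: L1_oddpart.
Qed.

Lemma hartley_reflect h x : L1 m h -> hartley (reflect h) x = hartley h (- x).
Proof.
move=> Lh; rewrite /hartley -[RHS]Rintegral_reflect.
  by apply: eq_Rintegral => xi _; rewrite dotRnNr dotRnNl opprK.
exact: L1_measurable (L1_cas _ Lh).
Qed.

Lemma hartleyD g h x : L1 m g -> L1 m h ->
  hartley (fun xi => g xi + h xi) x = hartley g x + hartley h x.
Proof.
move=> Lg Lh; rewrite -RintegralD//; [|exact: L1_cas|exact: L1_cas].
by apply: eq_Rintegral => xi _; rewrite mulrDl.
Qed.

Lemma hartleyZ k h x : L1 m h -> hartley (fun xi => k * h xi) x = k * hartley h x.
Proof.
move=> Lh; rewrite -RintegralZl//; last exact: L1_cas.
by apply: eq_Rintegral => xi _; rewrite mulrA.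
Qed.

(** The even part of [h] has only a cosine transform and the odd part only a sine transform. The
    former multiplies [hartley g x]; the latter multiplies [hartley g (- x)], which reflecting [g]
    turns into [hartley g x]. The two transforms then add up to [hartley h x]. *)
Lemma hartleyM g h x : L1 m g -> L1 m h ->
  hartley (hprod g h) x = hartley g x * hartley h x.
Proof.
move=> Lg Lh; have Lrg := L1_reflect Lg.
have [Le Lo] := (L1_evenpart Lh, L1_oddpart Lh).
rewrite hartleyD; [|exact: L1_conv|exact: L1_conv].
rewrite !hartley_conv// sinT_evenpart// cosT_evenpart// cosT_oddpart// sinT_oddpart//.
by rewrite !hartley_reflect// opprK (hartleyE _ Lh); ring.
Qed.

End hartley.

(** * Weights and weighted norms *)

Section jensen.
Context d (T : measurableType d) {R : realType} (m : {measure set T -> \bar R}).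

(** For [a > t], write [a = a ^ (1 - q) * a ^ q]; the first factor decreases in [a]. *)
Lemma le_young_powR (q t a : R) : 1 < q -> 0 < t -> 0 <= a ->
  a <= t + t `^ (1 - q) * a `^ q.
Proof.
move=> q1 t0 a0; have [at_|ta] := leP a t.
  by rewrite (le_trans at_)// lerDl mulr_ge0 ?powR_ge0.
rewrite (@le_trans _ _ (t `^ (1 - q) * a `^ q))//; last by rewrite lerDr ltW.
have a0' : 0 < a by exact: lt_trans ta.
have -> : a `^ q = a * a `^ (q - 1).
  by rewrite -[X in X * _]powRr1// -powRD ?subrKC//; apply/implyP => _; exact: lt0r_neq0.
rewrite mulrCA ler_peMr// -(opprB q 1) powRN.
rewrite ler_pdivlMl ?powR_gt0// mulr1 ge0_ler_powR ?nnegrE ?subr_ge0 ?(ltW ta)//; exact: ltW.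
Qed.

(* The Jensen inequality, up to the constant [2 ^ q], from the pointwise bound
   [a <= t + t ^ (1 - q) * a ^ q] with [t = y / (2 * beta)]. *)
Lemma jensen_powR (q beta y : R) (a b : T -> R) : 1 < q -> 0 < beta ->
  measurable_fun setT a -> measurable_fun setT b ->
  (forall x, 0 <= a x) -> (forall x, 0 <= b x) ->
  (\int[m]_x (b x)%:E <= beta%:E)%E -> 0 <= y ->
  (y%:E <= \int[m]_x (a x * b x)%:E)%E ->
  ((y `^ q)%:E <= (2 `^ q * beta `^ (q - 1))%:E * \int[m]_x (a x `^ q * b x)%:E)%E.
Proof.
move=> q1 beta0 ma mb a0 b0 bbeta; rewrite le_eqVlt => /predU1P[<- _|y0 yab].
  rewrite powR0 ?gt_eqF ?(lt_trans ltr01)// mule_ge0//.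
    by rewrite lee_fin mulr_ge0 ?powR_ge0.
  by apply: integral_ge0 => x _; rewrite lee_fin mulr_ge0 ?powR_ge0.
have maq : measurable_fun setT (fun x => a x `^ q).
  exact: (measurableT_comp (measurable_powR q)).
set E := (\int[m]_x (a x `^ q * b x)%:E)%E.
have E0 : (0 <= E)%E.
  by apply: integral_ge0 => x _; rewrite lee_fin mulr_ge0 ?powR_ge0.
(* With this choice the term [t * beta] equals [y / 2] and is absorbed by the left-hand side. *)
pose t := y / (2 * beta); have t0 : 0 < t by rewrite divr_gt0 ?mulr_gt0.
have ytE : (y%:E <= t%:E * beta%:E + (t `^ (1 - q))%:E * E)%E.
  apply: (le_trans yab).
  apply: (@le_trans _ _ (t%:E * \int[m]_x (b x)%:E + (t `^ (1 - q))%:E * E)%E); last first.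
    by rewrite leeD2r// lee_wpmul2l// lee_fin ltW.
  rewrite -ge0_integralZl//; [|exact/measurable_EFinP|by move=> x _; rewrite lee_fin|
    by rewrite lee_fin ltW].
  rewrite -ge0_integralZl//; last 3 first.
  - by apply/measurable_EFinP; exact: measurable_funM.
  - by move=> x _; rewrite lee_fin mulr_ge0 ?powR_ge0.
  - by rewrite lee_fin powR_ge0.
  rewrite -ge0_integralD//; last 4 first.
  - by move=> x _; rewrite -EFinM lee_fin mulr_ge0// ltW.
  - by apply: emeasurable_funM => //; exact/measurable_EFinP.
  - by move=> x _; rewrite -EFinM lee_fin !mulr_ge0 ?powR_ge0.
  - by apply: emeasurable_funM => //; apply/measurable_EFinP; exact: measurable_funM.
  apply: ge0_le_integral => //.
  - by move=> x _; rewrite lee_fin mulr_ge0.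
  - by apply/measurable_EFinP; exact: measurable_funM.
  - apply/measurable_EFinP; apply: measurable_funD; apply: measurable_funM => //.
    exact: measurable_funM.
  - move=> x _; rewrite -!EFinM -EFinD lee_fin mulrA -mulrDl ler_wpM2r//.
    exact: le_young_powR.
move: E0 ytE; case: E => [E| |]//.
  rewrite -!EFinM -EFinD !lee_fin => E0.
  rewrite (_ : t * beta = y / 2); last first.
    by rewrite /t; field; exact: lt0r_neq0.
  move=> ytE; have {}ytE : y / 2 <= t `^ (1 - q) * E by lra.
  have tq0 : 0 < t `^ (q - 1) by rewrite powR_gt0.
  have : t `^ (q - 1) * (y / 2) <= E.
    by move: ytE; rewrite -(opprB q 1) powRN ler_pdivlMl.
  have c0 : 0 < 2 `^ q * beta `^ (q - 1) by rewrite mulr_gt0 ?powR_gt0.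
  move=> /(ler_wpM2l (ltW c0)); apply: le_trans; rewrite le_eqVlt; apply/orP; left; apply/eqP.
  have spl (x : R) : 0 < x -> x `^ q = x * x `^ (q - 1).
    move=> x0; rewrite -[X in X * _]powRr1 ?ltW// -powRD ?subrKC//.
    by apply/implyP => _; exact: lt0r_neq0.
  have -> : t `^ (q - 1) = y `^ (q - 1) * (2 * beta) `^ (- (q - 1)).
    rewrite /t powRM ?invr_ge0 ?mulr_ge0 ?ltW//; congr (_ * _).
    by rewrite -powR_inv1 ?mulr_ge0 ?ltW// -powRrM mulN1r.
  rewrite powRN powRM ?ltW// !spl//.
  by field; rewrite !lt0r_neq0 ?powR_gt0.
by move=> _ _; rewrite gt0_muley ?leey ?lte_fin ?mulr_gt0 ?powR_gt0.
Qed.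

End jensen.

Section jbracket.
Context {R : realType} {n : nat}.
Implicit Types x y : 'rV[R]_n.

Lemma jbracket_ge1 x : 1 <= jbracket x.
Proof.
rewrite -[leLHS]sqrtr1 ler_wsqrtr// lerDl sumr_ge0// => i _.
exact: sqr_ge0.
Qed.

Lemma jbracket_gt0 x : 0 < jbracket x.
Proof. exact: lt_le_trans (jbracket_ge1 x). Qed.

Lemma jbracketN x : jbracket (- x) = jbracket x.
Proof.
by congr (Num.sqrt (1 + _)); apply: eq_bigr => i _; rewrite mxE sqrrN.
Qed.

Lemma jbracket_sqr x : jbracket x ^+ 2 = 1 + \sum_i x ord0 i ^+ 2.
Proof.
by rewrite sqr_sqrtr// addr_ge0// sumr_ge0// => i _; exact: sqr_ge0.
Qed.

Lemma coord_le_jbracket x i : `|x ord0 i| <= jbracket x.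
Proof.
rewrite -ler_sqr ?nnegrE ?(ltW (jbracket_gt0 _))// real_normK ?num_real//.
rewrite jbracket_sqr (bigD1 i)//= addrCA lerDl addr_ge0// sumr_ge0// => j _.
exact: sqr_ge0.
Qed.

Lemma norm_le_jbracket x : `|x| <= jbracket x.
Proof.
apply/ler_addgt0Pr => e e0; rewrite ltW//; apply: rV_norm_lt.
  by rewrite addr_gt0// jbracket_gt0.
by move=> i; rewrite (le_lt_trans (coord_le_jbracket x i))// ltrDl.
Qed.

Lemma jbracket_le x : jbracket x <= n.+1%:R * (1 + `|x|).
Proof.
rewrite -ler_sqr ?nnegrE ?(ltW (jbracket_gt0 _)) ?mulr_ge0 ?addr_ge0//.
rewrite jbracket_sqr (@le_trans _ _ (1 + \sum_(i < n) `|x| ^+ 2))//.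
  rewrite lerD2l ler_sum// => i _.
  by rewrite -[leLHS]real_normK ?num_real// ler_sqr ?nnegrE// rV_coord_le.
rewrite sumr_const card_ord -[_ *+ n]mulr_natl exprMn.
have n1 : (1 : R) <= n.+1%:R by rewrite ler1n.
have nn : (n%:R : R) <= n.+1%:R by rewrite ler_nat.
have x0 : 0 <= `|x| by [].
move: n1 nn; move: (n.+1%:R) (n%:R : R) (`|x|) x0 => N k X X0 N1 kN.
have kN2 : k <= N ^+ 2 by rewrite (le_trans kN)// expr2 ler_peMl// (le_trans ler01).
rewrite (@le_trans _ _ (N ^+ 2 * (1 + X ^+ 2)))//.
  by rewrite mulrDr mulr1 lerD// ?exprn_ege1// ler_wpM2r// sqr_ge0.
by rewrite ler_wpM2l ?sqr_ge0//; nra.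
Qed.

Lemma jbracketD x y : jbracket (x + y) <= 2 * (jbracket x + jbracket y).
Proof.
have [jx jy] := (jbracket_gt0 x, jbracket_gt0 y).
have jxy0 : 0 <= 2 * (jbracket x + jbracket y) by lra.
rewrite -ler_sqr ?nnegrE ?(ltW (jbracket_gt0 _))//.
apply: (@le_trans _ _ (2 * (jbracket x ^+ 2 + jbracket y ^+ 2))); last by nra.
rewrite !jbracket_sqr addrACA mulrDr -big_split/= mulr_sumr lerD//; first by lra.
apply: ler_sum => i _; rewrite mxE -subr_ge0.
rewrite (_ : _ - _ = (x ord0 i - y ord0 i) ^+ 2) ?sqr_ge0//.
by ring.
Qed.

Lemma measurable_jbracket : measurable_fun [set: 'rV[R]_n] (@jbracket R n).
Proof.
rewrite (_ : @jbracket R n = fun x => (1 + \sum_i x ord0 i ^+ 2) `^ 2^-1); last first.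
  apply/funext => x; rewrite powR12_sqrt//.
  by rewrite addr_ge0// sumr_ge0// => i _; exact: sqr_ge0.
apply: (measurableT_comp (measurable_powR 2^-1)).
apply: measurable_funD => //; apply: measurable_sum => i.
by apply: measurable_funX; exact: measurable_coord.
Qed.

End jbracket.

Lemma le_add_twice_mul {R : realFieldType} (a b : R) :
  1 <= a -> 1 <= b -> a + b <= 2 * (a * b).
Proof. by nra. Qed.

Section weighted_norms.
Context {R : realType} {n : nat}.
Variables q s : R.
Hypotheses (q1 : 1 < q) (s0 : 0 <= s).
Local Notation V := ('rV[R]_n).
Local Notation m := (@mu R n).
Implicit Types (g h : V -> R) (x y xi eta : V).

Definition wt x : R := jbracket x `^ s.

(** No root is taken: this is homogeneous of degree [q], and its triangle inequality [qnormD]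
    carries the constant [2 ^ q]. *)
Definition qnorm h : \bar R := (\int[m]_xi ((wt xi * `|h xi|) `^ q)%:E)%E.

(** From [<x + y> <= 2 (<x> + <y>) <= 4 max(<x>, <y>)], raised to the power [s]. *)
Definition wt_cst : R := 4 `^ s.
Local Notation S := wt_cst.

Lemma wt_ge1 x : 1 <= wt x.
Proof. by rewrite -(powRr0 (jbracket x)) ler_powR ?jbracket_ge1. Qed.

Lemma wt_gt0 x : 0 < wt x.
Proof. exact: lt_le_trans (wt_ge1 x). Qed.

Lemma wt_ge0 x : 0 <= wt x.
Proof. exact: ltW (wt_gt0 x). Qed.

Lemma wtN x : wt (- x) = wt x.
Proof. by rewrite /wt jbracketN. Qed.

Lemma wtD x y : wt (x + y) <= S * (wt x + wt y).
Proof.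
have jge0 z : 0 <= jbracket z :> R by exact: ltW (jbracket_gt0 z).
wlog xy : x y / jbracket x <= jbracket y.
  move=> h; have [|/ltW] := leP (jbracket x) (jbracket y); first exact: h.
  by move=> /h; rewrite addrC [wt x + _]addrC.
apply: (@le_trans _ _ ((4 * jbracket y) `^ s)).
  rewrite ge0_ler_powR ?nnegrE ?mulr_ge0//.
  by rewrite (le_trans (jbracketD _ _))//; lra.
by rewrite powRM// ler_wpM2l ?powR_ge0// lerDr powR_ge0.
Qed.

Lemma S_ge0 : 0 <= S. Proof. exact: powR_ge0. Qed.

(** The sum form [wtD] weights one factor of a convolution at a time and serves products inside the
    algebra; this product form weights both and serves multipliers. *)
Lemma wtDM x y : wt (x + y) <= 2 * S * (wt x * wt y).
Proof.
rewrite (le_trans (wtD x y))// -mulrA mulrCA ler_wpM2l ?S_ge0//.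
exact: le_add_twice_mul (wt_ge1 x) (wt_ge1 y).
Qed.

Lemma measurable_wt : measurable_fun [set: V] wt.
Proof. exact: (measurableT_comp (measurable_powR s) measurable_jbracket). Qed.

Lemma integral_conv_ge0 (F G : V -> R) :
  measurable_fun setT F -> measurable_fun setT G ->
  (forall x, 0 <= F x) -> (forall x, 0 <= G x) ->
  (\int[m]_xi \int[m]_eta (F (xi - eta) * G eta)%:E =
   \int[m]_xi (F xi)%:E * \int[m]_xi (G xi)%:E)%E.
Proof.
move=> mF mG F0 G0.
have mFG : measurable_fun [set: V * V]
    (fun p : V * V => (F (p.1 - p.2) * G p.2)%:E).
  apply/measurable_EFinP; apply: measurable_funM.
    exact: (measurableT_comp mF measurable_sub2).
  exact: measurableT_comp.
rewrite (fubini_tonelli (fun p : V * V => (F (p.1 - p.2) * G p.2)%:E))//=; last first.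
  by move=> p; rewrite lee_fin mulr_ge0.
rewrite -ge0_integralZl//=; last 3 first.
- exact/measurable_EFinP.
- by move=> x _; rewrite lee_fin.
- by apply: integral_ge0 => x _; rewrite lee_fin.
apply: eq_integral => eta _; under eq_integral do rewrite EFinM muleC.
rewrite ge0_integralZl//=; last 3 first.
- apply/measurable_EFinP; exact: (measurableT_comp mF (measurable_shift _)).
- by move=> x _; rewrite lee_fin.
- by rewrite lee_fin.
rewrite muleC; congr (_ * _)%E.
by apply: (integral_shift (- eta) (g := EFin \o F)) => //; exact/measurable_EFinP.
Qed.

Lemma measurable_conv_ge0 (F G : V -> R) :
  measurable_fun setT F -> measurable_fun setT G ->
  (forall x, 0 <= F x) -> (forall x, 0 <= G x) ->
  measurable_fun setT (fun xi => \int[m]_eta (F (xi - eta) * G eta)%:E)%E.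
Proof.
move=> mF mG F0 G0.
apply: (measurable_fun_fubini_tonelli_F
  (fun p : V * V => (F (p.1 - p.2) * G p.2)%:E)) => //=.
  apply/measurable_EFinP; apply: measurable_funM.
    exact: (measurableT_comp mF measurable_sub2).
  exact: measurableT_comp.
by move=> p; rewrite lee_fin mulr_ge0.
Qed.

Lemma measurable_conv_integrand g h xi : measurable_fun setT g ->
  measurable_fun setT h -> measurable_fun setT (fun eta => g (xi - eta) * h eta).
Proof.
move=> mg mh; apply: measurable_funM => //.
by apply: (measurableT_comp mg); exact: (measurableT_comp measurable_sub2 (measurable_pair1 xi)).
Qed.

Lemma conv_norm_le g h xi : measurable_fun setT g -> measurable_fun setT h ->
  (`|conv g h xi|%:E <= \int[m]_eta (`|g (xi - eta)| * `|h eta|)%:E)%E.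
Proof.
move=> mg mh; under eq_integral do rewrite -normrM.
by apply: Rintegral_norm_leE; exact: measurable_conv_integrand.
Qed.

Lemma conv_norm1_le g h : L1 m g -> L1 m h ->
  (\int[m]_xi `|conv g h xi|%:E <=
   \int[m]_xi `|g xi|%:E * \int[m]_xi `|h xi|%:E)%E.
Proof.
move=> Lg Lh; have [mg mh] := (L1_measurable Lg, L1_measurable Lh).
have mng : measurable_fun setT (fun x => `|g x|) by exact: measurableT_comp.
have mnh : measurable_fun setT (fun x => `|h x|) by exact: measurableT_comp.
rewrite -(integral_conv_ge0 mng mnh)//.
apply: ge0_le_integral => //.
- apply/measurable_EFinP; apply: measurableT_comp => //.
  exact: L1_measurable (L1_conv Lg Lh).
- by apply: (measurable_conv_ge0 mng mnh).
- by move=> xi _; exact: conv_norm_le.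
Qed.

Definition wabs h x := wt x * `|h x|.

Let mwabs h : measurable_fun setT h -> measurable_fun setT (wabs h).
Proof.
by move=> mh; apply: measurable_funM; [exact: measurable_wt|exact: measurableT_comp].
Qed.

Let wabs0 h x : 0 <= wabs h x.
Proof. by rewrite mulr_ge0// wt_ge0. Qed.

Let mwabsq h : measurable_fun setT h -> measurable_fun setT (fun x => wabs h x `^ q).
Proof. by move=> mh; exact: (measurableT_comp (measurable_powR q) (mwabs mh)). Qed.

Lemma qnorm_ge0 h : (0 <= qnorm h)%E.
Proof. by apply: integral_ge0 => x _; rewrite lee_fin powR_ge0. Qed.

Lemma integral_subl xi (F : V -> R) : measurable_fun setT F ->
  (forall x, 0 <= F x) ->
  (\int[m]_eta (F (xi - eta)%R)%:E = \int[m]_eta (F eta)%:E)%E.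
Proof.
move=> mF F0.
have mF1 : measurable_fun setT (fun eta => (F (eta + xi))%:E).
  apply/measurable_EFinP; exact: (measurableT_comp mF (measurable_shift xi)).
rewrite -(integral_shift xi (g := EFin \o F))//; last exact/measurable_EFinP.
rewrite -(integral_oppr mF1)//; last by move=> x; rewrite lee_fin.
by apply: eq_integral => eta _; rewrite addrC.
Qed.

(** By [wtD] the left-hand side, before taking powers, is at most [S (X + Y)], where the weight
    falls on [g] in [X] and on [h] in [Y]. One of the two is at least [y / (2 S)], and the Jensen
    inequality applies to it with the unweighted factor as the density, of mass at most [b] or
    [c]. *)
Lemma qnorm_conv_pointwise g h (b c : R) xi : L1 m g -> L1 m h -> 0 < b -> 0 < c ->
  (\int[m]_xi `|h xi|%:E <= b%:E)%E -> (\int[m]_xi `|g xi|%:E <= c%:E)%E ->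
  (((wt xi * `|conv g h xi|) `^ q)%:E <=
    ((4 * S) `^ q)%:E *
    ((b `^ (q - 1))%:E * \int[m]_eta (wabs g (xi - eta)%R `^ q * `|h eta|)%:E +
     (c `^ (q - 1))%:E * \int[m]_eta (`|g (xi - eta)%R| * wabs h eta `^ q)%:E))%E.
Proof.
move=> Lg Lh b0 c0 hb gc; have [mg mh] := (L1_measurable Lg, L1_measurable Lh).
have Sgt0 : 0 < S by exact: powR_gt0.
have msub : measurable_fun setT (fun eta : V => xi - eta).
  exact: (measurableT_comp measurable_sub2 (measurable_pair1 xi)).
have mng : measurable_fun setT (fun x => `|g x|) by exact: measurableT_comp.
have mnh : measurable_fun setT (fun x => `|h x|) by exact: measurableT_comp.
have mng' : measurable_fun setT (fun eta => `|g (xi - eta)|).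
  exact: (measurableT_comp mng msub).
have mwg' : measurable_fun setT (fun eta => wabs g (xi - eta)).
  exact: (measurableT_comp (mwabs mg) msub).
have mwh := mwabs mh.
set y := wt xi * `|conv g h xi|.
have y0 : 0 <= y by rewrite mulr_ge0 ?wt_ge0.
pose X := (\int[m]_eta (wabs g (xi - eta)%R * `|h eta|)%:E)%E.
pose Y := (\int[m]_eta (wabs h eta * `|g (xi - eta)%R|)%:E)%E.
have X0 : (0 <= X)%E by apply: integral_ge0 => x _; rewrite lee_fin mulr_ge0.
have Y0 : (0 <= Y)%E by apply: integral_ge0 => x _; rewrite lee_fin mulr_ge0.
have yXY : (y%:E <= S%:E * (X + Y))%E.
  apply: (@le_trans _ _ ((wt xi)%:E *
      \int[m]_eta (`|g (xi - eta)%R| * `|h eta|)%:E)%E).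
    by rewrite EFinM lee_wpmul2l ?lee_fin ?wt_ge0// conv_norm_le.
  rewrite -ge0_integralD//; last 4 first.
  - by move=> x _; rewrite lee_fin mulr_ge0.
  - by apply/measurable_EFinP; exact: measurable_funM.
  - by move=> x _; rewrite lee_fin mulr_ge0.
  - by apply/measurable_EFinP; exact: measurable_funM.
  rewrite -ge0_integralZl//; last 3 first.
  - apply: emeasurable_funD; apply/measurable_EFinP; exact: measurable_funM.
  - by move=> x _; rewrite -EFinD lee_fin addr_ge0// mulr_ge0.
  - by rewrite lee_fin ltW.
  rewrite -ge0_integralZl//; last 2 first.
  - by apply/measurable_EFinP; exact: measurable_funM.
  - by rewrite lee_fin wt_ge0.
  apply: ge0_le_integral => //.
  - by move=> x _; rewrite -EFinM lee_fin !mulr_ge0// wt_ge0.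
  - by apply: emeasurable_funM => //; apply/measurable_EFinP; exact: measurable_funM.
  - apply: emeasurable_funM => //.
    by apply: emeasurable_funD; apply/measurable_EFinP; exact: measurable_funM.
  - move=> eta _; rewrite -EFinD -!EFinM lee_fin /wabs.
    have := wtD (xi - eta) eta; rewrite subrK => hw.
    rewrite (_ : S * _ = (S * (wt (xi - eta) + wt eta)) * (`|g (xi - eta)| * `|h eta|)).
      by rewrite ler_wpM2r// mulr_ge0.
    by ring.
have y20 : 0 <= y / (2 * S) by rewrite divr_ge0// mulr_ge0// ltW.
have yq (Z : \bar R) : (0 <= Z)%E -> ((((y / (2 * S)) `^ q)%:E <= (2 `^ q)%:E * Z)%E) ->
    ((y `^ q)%:E <= ((4 * S) `^ q)%:E * Z)%E.
  move=> Z0 h1.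
  have -> : y `^ q = (2 * S) `^ q * (y / (2 * S)) `^ q.
    rewrite -powRM// ?mulr_ge0 ?ltW//; congr (_ `^ _); field.
    by rewrite lt0r_neq0.
  rewrite EFinM (_ : (4 * S) `^ q = (2 * S) `^ q * 2 `^ q); last first.
    by rewrite -powRM ?mulr_ge0 ?ltW//; congr (_ `^ _); ring.
  by rewrite [in leRHS]EFinM -muleA lee_wpmul2l// lee_fin powR_ge0.
set E1 := (\int[m]_eta _)%E; set E2 := (\int[m]_eta _)%E.
have E10 : (0 <= E1)%E.
  by apply: integral_ge0 => x _; rewrite lee_fin mulr_ge0// powR_ge0.
have E20 : (0 <= E2)%E.
  by apply: integral_ge0 => x _; rewrite lee_fin mulr_ge0// powR_ge0.
have bE10 : (0 <= (b `^ (q - 1))%:E * E1)%E by rewrite mule_ge0// lee_fin powR_ge0.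
have cE20 : (0 <= (c `^ (q - 1))%:E * E2)%E by rewrite mule_ge0// lee_fin powR_ge0.
apply: yq; first by rewrite adde_ge0.
have [yX|Xy] := leP (y / (2 * S))%:E X.
  have := jensen_powR q1 b0 mwg' mnh (fun=> wabs0 _ _) (fun=> normr_ge0 _) hb y20 yX.
  move=> /le_trans; apply; rewrite EFinM -muleA lee_wpmul2l ?lee_fin ?powR_ge0//.
  by rewrite leeDl.
have yY : ((y / (2 * S))%:E <= Y)%E.
  rewrite leNgt; apply/negP => Yy; have := lteD Xy Yy.
  rewrite -EFinD (_ : _ + _ = y / S); last by field; rewrite lt0r_neq0.
  move=> XYy; move: yXY; rewrite leNgt => /negP; apply.
  by rewrite muleC -lte_pdivlMr// -EFinM.
have gc' : (\int[m]_eta `|g (xi - eta)%R|%:E <= c%:E)%E.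
  by rewrite (integral_subl xi mng).
have := jensen_powR q1 c0 mwh mng' (fun=> wabs0 _ _) (fun=> normr_ge0 _) gc' y20 yY.
move=> /le_trans; apply; rewrite EFinM -muleA lee_wpmul2l ?lee_fin ?powR_ge0//.
rewrite (_ : (\int[m]_x _)%E = E2) ?leeDr//.
by apply: eq_integral => eta _; rewrite mulrC.
Qed.
Lemma powR_split (b : R) : 0 < b -> b `^ q = b `^ (q - 1) * b.
Proof.
move=> b0; rewrite -[X in _ * X]powRr1 ?ltW// -powRD ?subrK//.
by apply/implyP => _; exact: lt0r_neq0.
Qed.

(** Integrate the pointwise bound: Tonelli yields one more factor [b] or [c], which raises the
    exponent [q - 1] to [q]. *)
Lemma qnorm_conv g h (b c : R) : L1 m g -> L1 m h -> 0 < b -> 0 < c ->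
  (\int[m]_xi `|h xi|%:E <= b%:E)%E -> (\int[m]_xi `|g xi|%:E <= c%:E)%E ->
  (qnorm (conv g h) <=
    ((4 * S) `^ q)%:E * ((b `^ q)%:E * qnorm g + (c `^ q)%:E * qnorm h))%E.
Proof.
move=> Lg Lh b0 c0 hb gc; have [mg mh] := (L1_measurable Lg, L1_measurable Lh).
have mng : measurable_fun setT (fun x => `|g x|) by exact: measurableT_comp.
have mnh : measurable_fun setT (fun x => `|h x|) by exact: measurableT_comp.
have [mgq mhq] := (mwabsq mg, mwabsq mh).
pose E1 xi := (\int[m]_eta (wabs g (xi - eta)%R `^ q * `|h eta|)%:E)%E.
pose E2 xi := (\int[m]_eta (`|g (xi - eta)%R| * wabs h eta `^ q)%:E)%E.
have mE1 : measurable_fun setT E1 by apply: (measurable_conv_ge0 mgq mnh) => // x; exact: powR_ge0.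
have mE2 : measurable_fun setT E2 by apply: (measurable_conv_ge0 mng mhq) => // x; exact: powR_ge0.
have E10 xi : (0 <= E1 xi)%E.
  by apply: integral_ge0 => x _; rewrite lee_fin mulr_ge0// powR_ge0.
have E20 xi : (0 <= E2 xi)%E.
  by apply: integral_ge0 => x _; rewrite lee_fin mulr_ge0// powR_ge0.
have P0 (x r : R) : (0 <= (x `^ r)%:E)%E by rewrite lee_fin powR_ge0.
apply: (@le_trans _ _ (\int[m]_xi (((4 * S) `^ q)%:E *
    ((b `^ (q - 1))%:E * E1 xi + (c `^ (q - 1))%:E * E2 xi)))%E).
  apply: ge0_le_integral => //.
  - apply/measurable_EFinP; apply: mwabsq.
    exact: L1_measurable (L1_conv Lg Lh).
  - by apply: emeasurable_funM => //; apply: emeasurable_funD; apply: emeasurable_funM.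
  - by move=> xi _; exact: qnorm_conv_pointwise.
rewrite ge0_integralZl//; last 2 first.
- by apply: emeasurable_funD; apply: emeasurable_funM.
- by move=> x _; rewrite adde_ge0// mule_ge0.
apply: lee_wpmul2l => //.
rewrite ge0_integralD//; last 4 first.
- by move=> x _; rewrite mule_ge0.
- exact: emeasurable_funM.
- by move=> x _; rewrite mule_ge0.
- exact: emeasurable_funM.
rewrite !ge0_integralZl//.
rewrite (integral_conv_ge0 mgq mnh)//; last by move=> x; exact: powR_ge0.
rewrite (integral_conv_ge0 mng mhq)//; last by move=> x; exact: powR_ge0.
apply: leeD.
  rewrite powR_split// EFinM -muleA lee_wpmul2l// muleC lee_wpmul2r//.
  exact: qnorm_ge0.
rewrite powR_split// EFinM -muleA lee_wpmul2l// lee_wpmul2r//.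
exact: qnorm_ge0.
Qed.

(** The Jensen inequality with the density [wt * |g|]. Only the weighted [L^1]-norm of [g] occurs,
    so [g] need not have a finite [qnorm]. *)
Lemma qnorm_conv_wt g h (c : R) : L1 m g -> L1 m h -> 0 < c ->
  (\int[m]_xi (wt xi * `|g xi|)%:E <= c%:E)%E ->
  (qnorm (conv g h) <= ((4 * S) `^ q * c `^ q)%:E * qnorm h)%E.
Proof.
move=> Lg Lh c0 gc; have [mg mh] := (L1_measurable Lg, L1_measurable Lh).
have Sgt0 : 0 < S by exact: powR_gt0.
have mng : measurable_fun setT (fun x => `|g x|) by exact: measurableT_comp.
have mnh : measurable_fun setT (fun x => `|h x|) by exact: measurableT_comp.
have [mwg mwh] := (mwabs mg, mwabs mh).
have mhq := mwabsq mh.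
pose E xi := (\int[m]_eta (wabs g (xi - eta)%R * wabs h eta `^ q)%:E)%E.
have mE : measurable_fun setT E by apply: (measurable_conv_ge0 mwg mhq) => // x; exact: powR_ge0.
have P0 (x r : R) : (0 <= (x `^ r)%:E)%E by rewrite lee_fin powR_ge0.
have E0 xi : (0 <= E xi)%E.
  by apply: integral_ge0 => x _; rewrite lee_fin mulr_ge0// powR_ge0.
apply: (@le_trans _ _ (\int[m]_xi (((4 * S) `^ q * c `^ (q - 1))%:E * E xi))%E); last first.
  rewrite ge0_integralZl//; last by rewrite lee_fin mulr_ge0 ?powR_ge0.
  rewrite (integral_conv_ge0 mwg mhq)//; last by move=> x; exact: powR_ge0.
  rewrite [c `^ q]powR_split// mulrA [in leRHS]EFinM -muleA lee_wpmul2l//.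
    by rewrite lee_fin mulr_ge0 ?powR_ge0.
  by apply: lee_wpmul2r => //; exact: qnorm_ge0.
apply: ge0_le_integral => //.
- by apply/measurable_EFinP; apply: mwabsq; exact: L1_measurable (L1_conv Lg Lh).
- exact: emeasurable_funM.
move=> xi _.
have msub : measurable_fun setT (fun eta : V => xi - eta).
  exact: (measurableT_comp measurable_sub2 (measurable_pair1 xi)).
have mwg' : measurable_fun setT (fun eta => wabs g (xi - eta)).
  exact: (measurableT_comp mwg msub).
have mng' : measurable_fun setT (fun eta => `|g (xi - eta)|).
  exact: (measurableT_comp mng msub).
set y := wt xi * `|conv g h xi|.
have y0 : 0 <= y by rewrite mulr_ge0 ?wt_ge0.
pose X := (\int[m]_eta (wabs h eta * wabs g (xi - eta)%R)%:E)%E.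
have yX : (y%:E <= (2 * S)%:E * X)%E.
  apply: (@le_trans _ _ ((wt xi)%:E *
      \int[m]_eta (`|g (xi - eta)%R| * `|h eta|)%:E)%E).
    by rewrite EFinM lee_wpmul2l ?lee_fin ?wt_ge0// conv_norm_le.
  rewrite -ge0_integralZl//; last 2 first.
  - by apply/measurable_EFinP; exact: measurable_funM.
  - by rewrite lee_fin wt_ge0.
  rewrite -ge0_integralZl//; last 3 first.
  - by apply/measurable_EFinP; exact: measurable_funM.
  - by move=> x _; rewrite lee_fin mulr_ge0.
  - by rewrite lee_fin mulr_ge0 ?ltW.
  apply: ge0_le_integral => //.
  - by move=> x _; rewrite -EFinM lee_fin !mulr_ge0// wt_ge0.
  - by apply: emeasurable_funM => //; apply/measurable_EFinP; exact: measurable_funM.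
  - by apply: emeasurable_funM => //; apply/measurable_EFinP; exact: measurable_funM.
  - move=> eta _; rewrite -!EFinM lee_fin /wabs.
    have := wtDM (xi - eta) eta; rewrite subrK => hw.
    rewrite (_ : 2 * S * (wt eta * _ * _) = (2 * S * (wt (xi - eta) * wt eta)) * (`|g (xi - eta)| * `|h eta|)).
      by rewrite ler_wpM2r// mulr_ge0.
    by ring.
have y20 : 0 <= y / (2 * S) by rewrite divr_ge0// mulr_ge0// ltW.
have {}yX : ((y / (2 * S))%:E <= X)%E.
  by rewrite EFinM lee_pdivrMr ?mulr_gt0// muleC.
have gc' : (\int[m]_eta (wabs g (xi - eta)%R)%:E <= c%:E)%E.
  by rewrite (integral_subl xi mwg).
have := jensen_powR q1 c0 mwh mwg' (fun=> wabs0 _ _) (fun=> wabs0 _ _) gc' y20 yX.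
rewrite (_ : (\int[m]_x _)%E = E xi); last by apply: eq_integral => eta _; rewrite mulrC.
have -> : y `^ q = (2 * S) `^ q * (y / (2 * S)) `^ q.
  rewrite -powRM// ?mulr_ge0 ?ltW//; congr (_ `^ _); field.
  by rewrite lt0r_neq0.
rewrite (_ : (4 * S) `^ q = (2 * S) `^ q * 2 `^ q); last first.
  by rewrite -powRM ?mulr_ge0 ?ltW//; congr (_ `^ _); ring.
move=> h1; rewrite [X in (X <= _)%E]EFinM.
by rewrite -[_ * _ * c `^ _]mulrA [((2 * S) `^ q * _)%:E]EFinM -[X in (_ <= X)%E]muleA lee_wpmul2l.
Qed.

End weighted_norms.

(** * Functions represented by a Hartley transform *)

Section representable.
Context {R : realType} {n : nat}.
Variables q s : R.
Hypotheses (q1 : 1 < q) (s0 : 0 <= s).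
Local Notation V := ('rV[R]_n).
Local Notation m := (@mu R n).
Local Notation wt := (wt s).
Local Notation qnorm := (qnorm q s).
Implicit Types (g h u v : V -> R) (a b c : R).

Let q0 : 0 < q. Proof. exact: lt_trans q1. Qed.

Lemma ge0_leint (f g : V -> \bar R) : (forall x, (0 <= f x)%E) ->
  measurable_fun [set: V] f -> measurable_fun [set: V] g ->
  (forall x, (f x <= g x)%E) -> (\int[m]_x f x <= \int[m]_x g x)%E.
Proof. by move=> f0 mf mg fg; apply: ge0_le_integral. Qed.

Lemma measurable_qnorm h : measurable_fun setT h ->
  measurable_fun setT (fun x => ((wt x * `|h x|) `^ q)%:E).
Proof.
move=> mh; apply/measurable_EFinP; apply: (measurableT_comp (measurable_powR q)).
by apply: measurable_funM; [exact: measurable_wt|exact: measurableT_comp].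
Qed.

Lemma measurable_wtabs h : measurable_fun setT h ->
  measurable_fun setT (fun x => (wt x * `|h x|)%:E).
Proof.
move=> mh; apply/measurable_EFinP.
by apply: measurable_funM; [exact: measurable_wt|exact: measurableT_comp].
Qed.

Lemma measurable_absE h : measurable_fun setT h ->
  measurable_fun setT (fun x => `|h x|%:E).
Proof. by move=> mh; apply/measurable_EFinP; exact: measurableT_comp. Qed.

Lemma qnormZ k h : measurable_fun setT h ->
  qnorm (fun x => k * h x) = ((`|k| `^ q)%:E * qnorm h)%E.
Proof.
move=> mh; rewrite /qnorm -ge0_integralZl//.
- apply: eq_integral => x _; rewrite -EFinM normrM mulrCA [in LHS]powRM//.
  by rewrite mulr_ge0// wt_ge0.
- exact: measurable_qnorm.
- by move=> x _; rewrite lee_fin powR_ge0.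
Qed.

Lemma powR_avg_le a b : 0 <= a -> 0 <= b -> ((a + b) / 2) `^ q <= a `^ q + b `^ q.
Proof.
move=> a0 b0; have [ab|/ltW ba] := leP a b.
  rewrite (@le_trans _ _ (b `^ q))//; last by rewrite lerDr powR_ge0.
  by rewrite ge0_ler_powR ?nnegrE ?divr_ge0 ?addr_ge0// ?(ltW q0)//; lra.
rewrite (@le_trans _ _ (a `^ q))//; last by rewrite lerDl powR_ge0.
by rewrite ge0_ler_powR ?nnegrE ?divr_ge0 ?addr_ge0// ?(ltW q0)//; lra.
Qed.

Lemma qnorm_avg g h : measurable_fun setT g -> measurable_fun setT h ->
  (qnorm (fun x => (g x + h x) / 2)%R <= qnorm g + qnorm h)%E.
Proof.
move=> mg mh; rewrite /qnorm -ge0_integralD//; last 4 first.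
- by move=> x _; rewrite lee_fin powR_ge0.
- exact: measurable_qnorm.
- by move=> x _; rewrite lee_fin powR_ge0.
- exact: measurable_qnorm.
apply: ge0_leint.
- by move=> x; rewrite lee_fin powR_ge0.
- apply: measurable_qnorm; under eq_fun do rewrite mulrC.
  by apply: measurable_funM => //; exact: measurable_funD.
- by apply: emeasurable_funD; exact: measurable_qnorm.
move=> x; rewrite -EFinD lee_fin.
have w0 := wt_ge0 s0 x.
apply: le_trans (powR_avg_le (mulr_ge0 w0 (normr_ge0 (g x))) (mulr_ge0 w0 (normr_ge0 (h x)))).
rewrite -mulrDr -mulrA ge0_ler_powR ?nnegrE ?mulr_ge0 ?addr_ge0 ?(ltW q0)//.
rewrite ler_wpM2l// normrM [`|2^-1|]ger0_norm// ler_wpM2r//.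
exact: ler_normD.
Qed.

Lemma qnormD g h : measurable_fun setT g -> measurable_fun setT h ->
  (qnorm (fun x => g x + h x)%R <= (2 `^ q)%:E * (qnorm g + qnorm h))%E.
Proof.
move=> mg mh; rewrite (_ : (fun x => _) = (fun x => 2 * ((g x + h x) / 2))); last first.
  by apply/funext => x; field.
have m2 : measurable_fun setT (fun x => (g x + h x) / 2).
  under eq_fun do rewrite mulrC.
  by apply: measurable_funM => //; exact: measurable_funD.
rewrite qnormZ// ger0_norm// lee_wpmul2l ?lee_fin ?powR_ge0//.
exact: qnorm_avg.
Qed.

Lemma measurable_reflect h : measurable_fun setT h -> measurable_fun setT (reflect h).
Proof. by move=> mh; exact: (measurableT_comp mh measurable_opprV). Qed.

Lemma qnorm_reflect h : measurable_fun setT h -> qnorm (reflect h) = qnorm h.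
Proof.
move=> mh; rewrite /qnorm -(integral_oppr (measurable_qnorm mh)); last first.
  by move=> x; rewrite lee_fin powR_ge0.
by apply: eq_integral => x _; rewrite wtN.
Qed.

Lemma n1_reflect h : measurable_fun setT h ->
  (\int[m]_x `|reflect h x|%:E = \int[m]_x `|h x|%:E)%E.
Proof. by move=> mh; rewrite -(integral_oppr (measurable_absE mh)). Qed.

Lemma w1_reflect h : measurable_fun setT h ->
  (\int[m]_x (wt x * `|reflect h x|)%:E = \int[m]_x (wt x * `|h x|)%:E)%E.
Proof.
move=> mh; rewrite -(integral_oppr (measurable_wtabs mh)); last first.
  by move=> x; rewrite lee_fin mulr_ge0// wt_ge0.
by apply: eq_integral => x _; rewrite wtN.
Qed.

Lemma n1D g h : measurable_fun setT g -> measurable_fun setT h ->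
  (\int[m]_x `|(g x + h x)%R|%:E <= \int[m]_x `|g x|%:E + \int[m]_x `|h x|%:E)%E.
Proof.
move=> mg mh; rewrite -ge0_integralD//; [|exact: measurable_absE|exact: measurable_absE].
apply: ge0_leint => //.
- by apply: measurable_absE; exact: measurable_funD.
- by apply: emeasurable_funD; exact: measurable_absE.
- by move=> x; rewrite -EFinD lee_fin ler_normD.
Qed.

Lemma n1Z k h : measurable_fun setT h ->
  (\int[m]_x `|(k * h x)%R|%:E = `|k|%:E * \int[m]_x `|h x|%:E)%E.
Proof.
move=> mh; rewrite -ge0_integralZl//; last exact: measurable_absE.
by apply: eq_integral => x _; rewrite normrM EFinM.
Qed.

Lemma evenpartE h : evenpart h = (fun x => (h x + reflect h x) / 2).
Proof. by []. Qed.

Lemma oddpartE h : oddpart h = (fun x => (h x + - reflect h x) / 2).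
Proof. by []. Qed.

Lemma parts_bounds h a b : L1 m h -> (\int[m]_x `|h x|%:E <= a%:E)%E ->
  (qnorm h <= b%:E)%E ->
  [/\ (\int[m]_x `|evenpart h x|%:E <= a%:E)%E, (qnorm (evenpart h) <= (b + b)%:E)%E,
      (\int[m]_x `|oddpart h x|%:E <= a%:E)%E & (qnorm (oddpart h) <= (b + b)%:E)%E].
Proof.
move=> Lh ha hb; have mh := L1_measurable Lh; have mr := measurable_reflect mh.
have mnr : measurable_fun setT (fun x => - reflect h x) by exact: measurableT_comp.
have half g : measurable_fun setT g -> (\int[m]_x `|g x|%:E = \int[m]_x `|h x|%:E)%E ->
    (\int[m]_x `|((h x + g x) / 2)%R|%:E <= a%:E)%E.
  move=> mg gE.
  under eq_integral do rewrite mulrC.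
  rewrite (n1Z 2^-1 (measurable_funD mh mg)) ger0_norm//.
  apply: (@le_trans _ _ (2^-1%:E * (a%:E + a%:E))%E).
    rewrite lee_wpmul2l// (le_trans (n1D mh mg))//.
    by rewrite leeD// gE.
  by rewrite -EFinD -EFinM lee_fin; lra.
split.
- by apply: half => //; exact: n1_reflect.
- rewrite evenpartE EFinD; apply: (le_trans (qnorm_avg mh mr)); apply: (leeD hb).
  by rewrite (qnorm_reflect mh); exact: hb.
- apply: half => //; rewrite -(n1_reflect mh).
  by apply: eq_integral => x _; rewrite normrN.
- rewrite oddpartE EFinD; apply: (le_trans (qnorm_avg mh mnr)); apply: (leeD hb).
  have -> : qnorm (fun x => - reflect h x) = qnorm (reflect h).
    by apply: eq_integral => x _; rewrite normrN.
  by rewrite (qnorm_reflect mh); exact: hb.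
Qed.

(* [repA u a b]: [u] belongs to the algebra, with [L^1]-norm at most [a] and the
   [q]-th power of its weighted [L^q]-norm at most [b].  Working with the
   [q]-th power avoids Minkowski's inequality.
   [repW u c]: [u] is a multiplier, with weighted [L^1]-norm at most [c]. *)
Definition repA u a b := exists h, [/\ L1 m h, (forall x, u x = hartley h x),
  (\int[m]_x `|h x|%:E <= a%:E)%E & (qnorm h <= b%:E)%E].

Definition repW u c := exists h, [/\ L1 m h, (forall x, u x = hartley h x) &
  (\int[m]_x (wt x * `|h x|)%:E <= c%:E)%E].

(** The product of [2 ^ q], for adding the two convolutions in [hprod], of [(4 * wt_cst s) ^ q],
    from the convolution estimates, and of 4: there are two convolutions, and [parts_bounds] doubles
    the bound of the even and odd parts. *)
Definition mul_cst : R := 4 * (8 * wt_cst s) `^ q.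

Lemma mul_cst_ge0 : 0 <= mul_cst.
Proof. by rewrite mulr_ge0 ?powR_ge0. Qed.

Let mul_cstE : mul_cst = 2 `^ q * ((4 * wt_cst s) `^ q * 4).
Proof.
rewrite /mul_cst [_ * 4]mulrC mulrCA; congr (_ * _).
rewrite -powRM ?mulr_ge0 ?powR_ge0//; congr (_ `^ _); ring.
Qed.

Lemma repA_mul u v a b a' b' : 0 < a -> 0 < a' -> repA u a b -> repA v a' b' ->
  repA (fun x => u x * v x) (2 * (a * a')) (mul_cst * (a' `^ q * b + a `^ q * b')).
Proof.
move=> a0 a'0 [g [Lg ug ga gb]] [h [Lh vh ha hb]].
have [Le Lo] := (L1_evenpart Lh, L1_oddpart Lh).
have [ea eb oa ob] := parts_bounds Lh ha hb.
have Lr := L1_reflect Lg.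
have [Lc1 Lc2] := (L1_conv Lg Le, L1_conv Lr Lo).
have [mc1 mc2] := (L1_measurable Lc1, L1_measurable Lc2).
have mg := L1_measurable Lg.
have b0 : 0 <= b by rewrite -lee_fin (le_trans _ gb)// qnorm_ge0.
have b'0 : 0 <= b' by rewrite -lee_fin (le_trans _ hb)// qnorm_ge0.
exists (hprod g h); split.
- exact: L1_hprod.
- by move=> x; rewrite ug vh hartleyM.
- rewrite (le_trans (n1D mc1 mc2))//.
  have le1 g' h' : L1 m g' -> L1 m h' -> (\int[m]_x `|g' x|%:E <= a%:E)%E ->
      (\int[m]_x `|h' x|%:E <= a'%:E)%E -> (\int[m]_x `|conv g' h' x|%:E <= (a * a')%:E)%E.
    move=> L' L'' h1 h2; rewrite (le_trans (conv_norm1_le L' L''))// EFinM.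
    by apply: lee_pmul => //; apply: integral_ge0 => x _; rewrite lee_fin.
  rewrite (_ : 2 * (a * a') = a * a' + a * a') ?mulr_natl ?mulr2n// EFinD leeD//.
    exact: le1.
  by apply: le1 => //; rewrite n1_reflect.
- rewrite (le_trans (qnormD mc1 mc2))// mul_cstE -[X in (_ <= X%:E)%E]mulrA EFinM.
  rewrite lee_wpmul2l ?lee_fin ?powR_ge0//.
  have P0 (x : R) : 0 <= x `^ q by exact: powR_ge0.
  have le2 g' h' : L1 m g' -> L1 m h' -> (\int[m]_x `|g' x|%:E <= a%:E)%E ->
      (\int[m]_x `|h' x|%:E <= a'%:E)%E -> (qnorm g' <= b%:E)%E ->
      (qnorm h' <= (b' + b')%:E)%E ->
      (qnorm (conv g' h') <=
        ((4 * wt_cst s) `^ q * (2 * (a' `^ q * b + a `^ q * b')))%:E)%E.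
    move=> L' L'' h1 h2 h3 h4.
    rewrite (le_trans (qnorm_conv q1 s0 L' L'' a'0 a0 h2 h1))//.
    rewrite EFinM lee_wpmul2l ?lee_fin//.
    apply: (@le_trans _ _ ((a' `^ q)%:E * b%:E + (a `^ q)%:E * (b' + b')%:E)%E).
      by rewrite leeD// lee_wpmul2l ?lee_fin.
    rewrite -!EFinM -EFinD lee_fin mulrDr mulr_natl mulr2n.
    have := P0 a'; have := P0 a; nra.
  apply: (@le_trans _ _ (((4 * wt_cst s) `^ q * (2 * (a' `^ q * b + a `^ q * b')))%:E +
     ((4 * wt_cst s) `^ q * (2 * (a' `^ q * b + a `^ q * b')))%:E)%E).
    apply: leeD; first exact: (le2 _ _ Lg Le ga ea gb eb).
    apply: (le2 _ _ Lr Lo _ oa _ ob); first by rewrite (n1_reflect mg).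
    by rewrite (qnorm_reflect mg); exact: gb.
  by rewrite -EFinD lee_fin le_eqVlt; apply/orP; left; apply/eqP; ring.
Qed.

Lemma repW_mul u v c a b : 0 < c -> repW u c -> repA v a b ->
  repA (fun x => u x * v x) (2 * (c * a)) (mul_cst * (c `^ q * b)).
Proof.
move=> c0 [g [Lg ug gc]] [h [Lh vh ha hb]].
have [Le Lo] := (L1_evenpart Lh, L1_oddpart Lh).
have [ea eb oa ob] := parts_bounds Lh ha hb.
have Lr := L1_reflect Lg.
have [Lc1 Lc2] := (L1_conv Lg Le, L1_conv Lr Lo).
have [mc1 mc2] := (L1_measurable Lc1, L1_measurable Lc2).
have mg := L1_measurable Lg.
have gc1 : (\int[m]_x `|g x|%:E <= c%:E)%E.
  apply: le_trans gc; apply: ge0_leint => //.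
  - exact: measurable_absE.
  - exact: measurable_wtabs.
  - by move=> x; rewrite lee_fin ler_peMl// wt_ge1.
have b0 : 0 <= b by rewrite -lee_fin (le_trans _ hb)// qnorm_ge0.
exists (hprod g h); split.
- exact: L1_hprod.
- by move=> x; rewrite ug vh hartleyM.
- rewrite (le_trans (n1D mc1 mc2))//.
  have le1 g' h' : L1 m g' -> L1 m h' -> (\int[m]_x `|g' x|%:E <= c%:E)%E ->
      (\int[m]_x `|h' x|%:E <= a%:E)%E -> (\int[m]_x `|conv g' h' x|%:E <= (c * a)%:E)%E.
    move=> L' L'' h1 h2; rewrite (le_trans (conv_norm1_le L' L''))// EFinM.
    by apply: lee_pmul => //; apply: integral_ge0 => x _; rewrite lee_fin.
  rewrite (_ : 2 * (c * a) = c * a + c * a) ?mulr_natl ?mulr2n// EFinD leeD//.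
    exact: le1.
  by apply: le1 => //; rewrite n1_reflect.
- rewrite (le_trans (qnormD mc1 mc2))// mul_cstE -[X in (_ <= X%:E)%E]mulrA EFinM.
  rewrite lee_wpmul2l ?lee_fin ?powR_ge0//.
  have le2 g' h' : L1 m g' -> L1 m h' -> (\int[m]_x (wt x * `|g' x|)%:E <= c%:E)%E ->
      (qnorm h' <= (b + b)%:E)%E ->
      (qnorm (conv g' h') <= ((4 * wt_cst s) `^ q * (2 * (c `^ q * b)))%:E)%E.
    move=> L' L'' h1 h2; rewrite (le_trans (qnorm_conv_wt q1 s0 L' L'' c0 h1))//.
    apply: (@le_trans _ _ (((4 * wt_cst s) `^ q * c `^ q)%:E * (b + b)%:E)%E).
      by rewrite lee_wpmul2l// lee_fin mulr_ge0 ?powR_ge0.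
    by rewrite -EFinM lee_fin le_eqVlt; apply/orP; left; apply/eqP; ring.
  apply: (@le_trans _ _ (((4 * wt_cst s) `^ q * (2 * (c `^ q * b)))%:E +
     ((4 * wt_cst s) `^ q * (2 * (c `^ q * b)))%:E)%E).
    rewrite leeD//; first exact: le2.
    by apply: le2 => //; rewrite w1_reflect.
  by rewrite -EFinD lee_fin le_eqVlt; apply/orP; left; apply/eqP; ring.
Qed.

Lemma repA_add u v a b a' b' : repA u a b -> repA v a' b' ->
  repA (fun x => u x + v x) (a + a') (2 `^ q * (b + b')).
Proof.
move=> [g [Lg ug ga gb]] [h [Lh vh ha hb]].
have [mg mh] := (L1_measurable Lg, L1_measurable Lh).
exists (fun x => g x + h x); split.
- exact: L1D.
- by move=> x; rewrite ug vh hartleyD.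
- by rewrite (le_trans (n1D mg mh))// EFinD leeD.
- rewrite (le_trans (qnormD mg mh))// EFinM lee_wpmul2l ?lee_fin ?powR_ge0//.
  by rewrite EFinD leeD.
Qed.

Lemma repA_scale k u a b : repA u a b ->
  repA (fun x => k * u x) (`|k| * a) (`|k| `^ q * b).
Proof.
move=> [h [Lh uh ha hb]]; have mh := L1_measurable Lh.
exists (fun x => k * h x); split.
- exact: L1Z.
- by move=> x; rewrite uh hartleyZ.
- by rewrite n1Z// EFinM lee_wpmul2l.
- by rewrite qnormZ// EFinM lee_wpmul2l// lee_fin powR_ge0.
Qed.

Lemma repA_le u a b a' b' : a <= a' -> b <= b' -> repA u a b -> repA u a' b'.
Proof.
move=> aa bb [h [Lh uh ha hb]]; exists h; split=> //.
- by rewrite (le_trans ha)// lee_fin.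
- by rewrite (le_trans hb)// lee_fin.
Qed.

End representable.

(** * Infinite sums in the algebra *)

Section series.
Context {R : realType}.

Lemma sum_inv_sqr_le2 (N : nat) : \sum_(0 <= k < N) (k.+1%:R ^+ 2)^-1 <= 2 :> R.
Proof.
case: N => [|N]; first by rewrite big_geq.
apply: (@le_trans _ _ (2 - N.+1%:R^-1)); last by rewrite lerBlDr lerDl.
elim: N => [|N ih]; first by rewrite big_nat1 expr1n invr1; lra.
rewrite big_nat_recr//= (le_trans (lerD ih (lexx _)))//.
have N0 : (0 : R) < N.+1%:R by [].
rewrite -[N.+2%:R]natr1; move: (N.+1%:R) N0 => x x0.
have x1 : 0 < x + 1 by rewrite addr_gt0.
rewrite -subr_ge0 (_ : _ - _ = (x * (x + 1) ^+ 2)^-1).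
  by rewrite invr_ge0 mulr_ge0 ?sqr_ge0// ltW.
by field; rewrite !lt0r_neq0.
Qed.

(** A replacement for the countable triangle inequality in [L^q]. If [T] is the series on the right,
    then [x k] is at most [(k + 1) ^ -2 * T ^ (1 / q)], and the inverse squares sum to at most 2.
    The price is the weight [(k + 1) ^ 2], harmless for rapidly decreasing terms. *)
Lemma powR_nneseries (q y : R) (x : R^nat) : 1 < q -> 0 <= y ->
  (forall k, 0 <= x k) -> (y%:E <= \sum_(0 <= k <oo) (x k)%:E)%E ->
  ((y `^ q)%:E <= (2 `^ q)%:E * \sum_(0 <= k <oo) ((k.+1%:R ^+ 2 * x k) `^ q)%:E)%E.
Proof.
move=> q1 y0 x0 yx; have q0 : 0 < q by exact: lt_trans q1.
pose z k := (k.+1%:R ^+ 2 * x k) `^ q.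
have z0 k : 0 <= z k by exact: powR_ge0.
have T0 : (0 <= \sum_(0 <= k <oo) (z k)%:E)%E.
  by apply: nneseries_ge0 => k _ _; rewrite lee_fin.
rewrite -[X in (_ <= _ * X)%E]/(\sum_(0 <= k <oo) (z k)%:E)%E.
have zT k : ((z k)%:E <= \sum_(0 <= k <oo) (z k)%:E)%E.
  apply: le_trans (nneseries_lim_ge k.+1 _) => /=; last by move=> *; rewrite lee_fin.
  by rewrite big_nat_recr//= leeDr// sume_ge0// => i _; rewrite lee_fin.
move: T0 zT; case: (\sum_(0 <= k <oo) (z k)%:E)%E => [T| |]//; last first.
  by rewrite gt0_muley ?leey// lte_fin powR_gt0.
rewrite lee_fin => T0 zT.
have xT k : x k <= (k.+1%:R ^+ 2)^-1 * T `^ q^-1.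
  have := zT k; rewrite lee_fin => /(ge0_ler_powR (r := q^-1)).
  rewrite invr_ge0 (ltW q0) !nnegrE => /(_ isT (z0 k) T0).
  rewrite /z -powRrM mulfV ?lt0r_neq0// powRr1; last by rewrite mulr_ge0.
  by rewrite -ler_pdivlMl.
have yT : y <= 2 * T `^ q^-1.
  rewrite -lee_fin (le_trans yx)//; apply: lime_le.
    by apply: is_cvg_nneseries => *; rewrite lee_fin.
  apply: nearW => N; rewrite sumEFin lee_fin.
  apply: (@le_trans _ _ (\sum_(0 <= k < N) (k.+1%:R ^+ 2)^-1 * T `^ q^-1)).
    exact: ler_sum.
  by rewrite -mulr_suml ler_wpM2r ?powR_ge0 ?sum_inv_sqr_le2.
rewrite -EFinM lee_fin (_ : 2 `^ q * T = (2 * T `^ q^-1) `^ q).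
  by rewrite ge0_ler_powR ?nnegrE ?(ltW q0) ?mulr_ge0 ?powR_ge0.
by rewrite powRM ?powR_ge0// -powRrM mulVf ?lt0r_neq0// powRr1.
Qed.

Lemma nneseries_le_partial (a : R^nat) (A : R) : (forall k, 0 <= a k) ->
  (forall N, \sum_(0 <= k < N) a k <= A) -> (\sum_(0 <= k <oo) (a k)%:E <= A%:E)%E.
Proof.
move=> a0 aA; apply: lime_le.
  by apply: is_cvg_nneseries => *; rewrite lee_fin.
by apply: nearW => N; rewrite sumEFin lee_fin.
Qed.

End series.

Section representable_series.
Context {R : realType} {n : nat}.
Variables q s : R.
Hypotheses (q1 : 1 < q) (s0 : 0 <= s).
Local Notation V := ('rV[R]_n).
Local Notation m := (@mu R n).

(** Completeness of the algebra in the form needed. The positive and negative parts of the kernels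
    are summed separately in the extended reals, and dominated convergence with the bound [2 G]
    identifies the transform of the sum. *)
Lemma repA_series (u : V -> R) (v : nat -> V -> R) (a b : nat -> R) (A B : R) :
  (forall k, repA q s (v k) (a k) (b k)) ->
  (forall N, \sum_(0 <= k < N) a k <= A) ->
  (forall N, \sum_(0 <= k < N) (k.+1%:R ^+ 2) `^ q * b k <= B) ->
  (forall x, \sum_(0 <= k < N) v k x @[N --> \oo] --> u x) ->
  repA q s u A (2 `^ q * B).
Proof.
move=> /choice[h hP] aA bB vu.
have Lh k : L1 m (h k) by have [] := hP k.
have mh k := L1_measurable (Lh k).
have ha k : (\int[m]_x `|h k x|%:E <= (a k)%:E)%E by have [] := hP k.
have hb k : (qnorm q s (h k) <= (b k)%:E)%E by have [] := hP k.
have a0 k : 0 <= a k.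
  by rewrite -lee_fin (le_trans _ (ha k))// integral_ge0.
have b0 k : 0 <= b k by rewrite -lee_fin (le_trans _ (hb k))// qnorm_ge0.
pose p k x := Num.max (h k x) 0; pose g k x := Num.max (- h k x) 0.
have p0 k x : 0 <= p k x by rewrite le_max lexx orbT.
have g0 k x : 0 <= g k x by rewrite le_max lexx orbT.
have hpg k x : h k x = p k x - g k x.
  rewrite /p /g; have [hk|hk] := leP (h k x) 0.
    by rewrite max_l ?sub0r ?opprK// oppr_ge0.
  by rewrite max_r ?subr0// oppr_le0 ltW.
have ph k x : p k x <= `|h k x| by rewrite ge_max ler_norm normr_ge0.
have gh k x : g k x <= `|h k x| by rewrite ge_max -normrN ler_norm normr_ge0.
have mp k : measurable_fun setT (p k) by exact: measurable_maxr.
have mg k : measurable_fun setT (g k).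
  by apply: measurable_maxr => //; exact: measurableT_comp.
pose P x := (\sum_(0 <= k <oo) (p k x)%:E)%E.
pose Q x := (\sum_(0 <= k <oo) (g k x)%:E)%E.
pose G x := (\sum_(0 <= k <oo) `|h k x|%:E)%E.
have P0 x : (0 <= P x)%E by apply: nneseries_ge0 => *; rewrite lee_fin.
have Q0 x : (0 <= Q x)%E by apply: nneseries_ge0 => *; rewrite lee_fin.
have G0 x : (0 <= G x)%E by apply: nneseries_ge0 => *; rewrite lee_fin.
have PG x : (P x <= G x)%E.
  by apply: lee_nneseries => [k _ _|k _]; rewrite lee_fin.
have QG x : (Q x <= G x)%E.
  by apply: lee_nneseries => [k _ _|k _]; rewrite lee_fin.
have mP : measurable_fun setT P.
  apply: ge0_emeasurable_sum => [k x _ _|k _]; first by rewrite lee_fin.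
  exact/measurable_EFinP.
have mQ : measurable_fun setT Q.
  apply: ge0_emeasurable_sum => [k x _ _|k _]; first by rewrite lee_fin.
  exact/measurable_EFinP.
have mG : measurable_fun setT G.
  apply: ge0_emeasurable_sum => [k x _ _|k _]; first by rewrite lee_fin.
  by apply/measurable_EFinP; exact: measurableT_comp.
(* Where a series is infinite [fine] gives 0. There [G] is infinite as well, so the bound [HG]
   persists, and integrability of [G] makes this a null set. *)
pose H x := fine (P x) - fine (Q x).
have mH : measurable_fun setT H.
  apply: measurable_funB; exact: (measurableT_comp (fine_measurable measurableT)).
have fineG (X Y : \bar R) : (0 <= X)%E -> (X <= Y)%E -> ((fine X)%:E <= Y)%E.
  case: X => [x _ //|_|]; last by rewrite leeNy_eq.
  by rewrite leye_eq => /eqP ->; rewrite leey.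
have HG x : (`|H x|%:E <= G x)%E.
  have [h1|h1] := leP (fine (Q x)) (fine (P x)).
    rewrite ger0_norm ?subr_ge0// (le_trans _ (fineG _ _ (P0 x) (PG x)))//.
    by rewrite lee_fin lerBlDr lerDl fine_ge0.
  rewrite ltr0_norm ?subr_lt0// opprB (le_trans _ (fineG _ _ (Q0 x) (QG x)))//.
  by rewrite lee_fin lerBlDr lerDl fine_ge0.
have intG : (\int[m]_x G x <= A%:E)%E.
  rewrite integral_nneseries//; last first.
    by move=> k; apply/measurable_EFinP; exact: measurableT_comp.
  apply: (le_trans _ (nneseries_le_partial a0 aA)).
  by apply: lee_nneseries => // k _ _; apply: integral_ge0.
have nH : (\int[m]_x `|H x|%:E <= A%:E)%E.
  apply: le_trans intG; apply: ge0_leint => //.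
  by apply/measurable_EFinP; exact: measurableT_comp.
have iG : m.-integrable setT G.
  apply/integrableP; split=> //.
  under eq_integral do rewrite gee0_abs//.
  by rewrite (le_lt_trans intG)// ltry.
have LH : L1 m H by apply/L1P; split=> //; rewrite (le_lt_trans nH)// ltry.
exists H; split => //.
- move=> x.
  have mc (f : V -> R) : measurable_fun setT f ->
      measurable_fun setT (fun xi => f xi * cas (dotRn x xi)).
    move=> mf; apply: measurable_funM => //.
    by apply: measurable_comp_dotRn; exact: continuous_cas.
  have [//| | | | |_ _] := @dominated_convergence _ _ _ m setT measurableT
    (fun N xi => ((\sum_(0 <= k < N) h k xi) * cas (dotRn x xi))%:E)
    (fun xi => (H xi * cas (dotRn x xi))%:E) (fun xi => 2%:E * G xi)%E.
  + move=> N; apply/measurable_EFinP; apply: mc.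
    by apply: measurable_sum => k; exact: mh.
  + by apply/measurable_EFinP; exact: mc.
  + have := integrable_ae measurableT iG; apply: filterS => xi /(_ I) Gfin _.
    apply: cvg_EFin; first by apply: nearW.
    apply: cvgMl.
    have -> : (fun N => \sum_(0 <= k < N) h k xi) =
        (fun N => (\sum_(0 <= k < N) p k xi) - \sum_(0 <= k < N) g k xi).
      apply/funext => N; rewrite -sumrB; apply: eq_bigr => k _; exact: hpg.
    have cvgfine (r : nat -> V -> R) (Z : \bar R) : (forall k x, 0 <= r k x) ->
        Z = (\sum_(0 <= k <oo) (r k xi)%:E)%E -> Z \is a fin_num ->
        \sum_(0 <= k < N) r k xi @[N --> \oo] --> fine Z.
      move=> r0 -> Zfin.
      have : (\sum_(0 <= k < N) (r k xi)%:E @[N --> \oo] -->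
          \sum_(0 <= k <oo) (r k xi)%:E)%E.
        by apply: is_cvg_nneseries => *; rewrite lee_fin.
      rewrite -{1}(fineK Zfin) => /fine_cvgP[_]; apply: cvg_trans.
      by apply: near_eq_cvg; apply: nearW => N /=; rewrite sumEFin.
    have finG (X : \bar R) : (0 <= X)%E -> (X <= G xi)%E -> X \is a fin_num.
      move=> X0 XG; rewrite ge0_fin_numE// (le_lt_trans XG)//.
      by rewrite -ge0_fin_numE.
    by apply: cvgB; apply: cvgfine => //; exact: finG.
  + exact: integrableZl.
  + apply: aeW => xi N _.
    apply: (@le_trans _ _ (2%:E * (\sum_(0 <= k < N) `|h k xi|)%:E)%E).
      rewrite -EFinM lee_fin normrM mulrC ler_pM//; first exact: cas_le2.
      exact: ler_norm_sum.
    rewrite lee_wpmul2l// -sumEFin.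
    by apply: nneseries_lim_ge => k _ _; rewrite lee_fin.
  have L1sum N : L1 m (fun xi => \sum_(0 <= k < N) h k xi).
    elim: N => [|N ih].
      under eq_fun do rewrite big_geq//; apply/L1P; split=> //.
      by rewrite integral0_eq// => y _; rewrite normr0.
    by under eq_fun do rewrite big_nat_recr//=; exact: L1D.
  have sumE N : hartley (fun xi => \sum_(0 <= k < N) h k xi) x =
      \sum_(0 <= k < N) v k x.
    elim: N => [|N ih].
      rewrite big_geq// /hartley /Rintegral integral0_eq// => y _.
      by rewrite big_geq// mul0r.
    under [X in hartley X]eq_fun do rewrite big_nat_recr//=.
    rewrite hartleyD// ih big_nat_recr//=; congr (_ + _).
    by have [_ ->] := hP N.
  move=> cv.
  have {cv} : (hartley (fun xi => \sum_(0 <= k < N) h k xi) x) @[N --> \oo]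
      --> hartley H x.
    have fin := integrable_fin_num measurableT (L1_cas x LH).
    by move: cv; rewrite -(fineK fin) => /fine_cvgP[_].
  under eq_fun do rewrite sumE.
  by move=> cv; apply: (cvg_unique _ (vu x) cv).
- have mw k : measurable_fun setT
      (fun x => (((k.+1%:R ^+ 2) `^ q) * (wt s x * `|h k x|) `^ q)%:E).
    rewrite (_ : (fun x => _) = (fun x => ((k.+1%:R ^+ 2) `^ q)%:E *
      ((wt s x * `|h k x|) `^ q)%:E)%E)//.
    by apply: emeasurable_funM => //; exact: measurable_qnorm.
  apply: (@le_trans _ _ (\int[m]_x ((2 `^ q)%:E *
     \sum_(0 <= k <oo) (((k.+1%:R ^+ 2) `^ q) * (wt s x * `|h k x|) `^ q)%:E))%E).
    apply: ge0_leint.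
    + by move=> x; rewrite lee_fin powR_ge0.
    + exact: measurable_qnorm.
    + apply: emeasurable_funM => //; apply: ge0_emeasurable_sum => [k x _ _|k _//].
      by rewrite lee_fin mulr_ge0 ?powR_ge0.
    + move=> x; under eq_eseriesr do rewrite -powRM ?mulr_ge0 ?wt_ge0//.
      apply: powR_nneseries => //; rewrite ?mulr_ge0 ?wt_ge0//.
        by move=> k; rewrite mulr_ge0// wt_ge0.
      rewrite EFinM (le_trans (lee_wpmul2l _ (HG x))) ?lee_fin ?wt_ge0//.
      rewrite -nneseriesZl//.
  rewrite ge0_integralZl//; last 2 first.
  + apply: ge0_emeasurable_sum => [k x _ _|k _//].
    by rewrite lee_fin mulr_ge0 ?powR_ge0.
  + by move=> x _; apply: nneseries_ge0 => *; rewrite lee_fin mulr_ge0 ?powR_ge0.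
  rewrite EFinM lee_wpmul2l ?lee_fin ?powR_ge0//.
  rewrite integral_nneseries//; last first.
    by move=> k x _; rewrite lee_fin mulr_ge0 ?powR_ge0.
  apply: (le_trans _ (nneseries_le_partial _ bB)); last first.
    by move=> k; rewrite mulr_ge0 ?powR_ge0.
  apply: lee_nneseries => [k _ _|k _].
    by apply: integral_ge0 => x _; rewrite lee_fin mulr_ge0 ?powR_ge0.
  under eq_integral do rewrite EFinM.
  rewrite ge0_integralZl//; last 2 first.
  + exact: measurable_qnorm.
  + by move=> x _; rewrite lee_fin powR_ge0.
  rewrite [X in (_ <= X)%E]EFinM; apply: lee_wpmul2l; last exact: hb.
  by rewrite lee_fin powR_ge0.
Qed.

End representable_series.

(** * The Lorentz kernel *)

Section lorentz_kernel.
Context {R : realType}.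
Local Notation leb := (@lebesgue_measure R).

Lemma even_integral (f F : R -> R) (l : R) : (forall x, 0 <= f x) ->
  continuous f -> (forall x, f (- x) = f x) ->
  (forall x : R, 0 <= x -> is_derive x 1 F (f x)) -> F x @[x --> +oo] --> l ->
  (\int[leb]_x (f x)%:E = (2 * (l - F 0))%:E)%E.
Proof.
move=> f0 cf evf dF Fl.
rewrite ge0_symfun_integralT//; last by move=> x /=; rewrite evf.
rewrite -set_itvcy (ge0_continuous_FTC2y (F := F) (l := l))//.
- exact: continuous_subspaceT.
- by move=> x x0; have [] := dF x (ltW x0).
- apply: cvg_at_right_filter; apply: differentiable_continuous.
  by apply/derivable1_diffP; have [] := dF 0 (lexx 0).
- by move=> x; rewrite in_itv/= andbT => /ltW x0; rewrite derive1E; have [_ ->] := dF x x0.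
Qed.

(** The Fourier transform of [exp (- |t|)], see [Rintegral_expR_abs_cos0]. *)
Definition pk (z : R) : R := 2 / (1 + z ^+ 2).

Lemma expR_abs_continuous : continuous (fun t : R => expR (- `|t|)).
Proof.
move=> t; apply: continuous_comp; last exact: continuous_expR.
by apply: continuousN; exact: norm_continuous.
Qed.

Lemma continuous_cosM (z c : R) : continuous (fun t : R => cos (t * z + c)).
Proof.
move=> t; apply: continuous_comp; last exact: continuous_cos.
by apply: cvgD; [apply: mulrr_continuous|exact: cvg_cst].
Qed.

(** The summand 1 makes the integrand nonnegative, as [even_integral] demands. On the half-line a
    primitive is [exp (- x) * k x]. *)
Lemma integral_expR_abs_cos (z : R) :
  (\int[leb]_t (expR (- `|t|) * (1 + cos (t * z)))%:E = (2 + pk z)%:E)%E.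
Proof.
have z0 : 1 <= 1 + z ^+ 2 by rewrite lerDl sqr_ge0.
have z1 : 1 + z ^+ 2 != 0 by rewrite gt_eqF// (lt_le_trans ltr01).
pose k : R -> R := fun x => - 1 + (z * sin (x * z) - cos (x * z)) / (1 + z ^+ 2).
have kC x : `|k x| <= 1 + (`|z| + 1).
  rewrite (le_trans (ler_normD _ _))// normrN1 lerD2l normrM.
  rewrite [X in _ * X]ger0_norm ?invr_ge0 ?(le_trans ler01)//.
  rewrite ler_pdivrMr ?(lt_le_trans ltr01)//.
  apply: (@le_trans _ _ (`|z| + 1)); last by rewrite ler_peMr// addr_ge0.
  rewrite (le_trans (ler_normB _ _))// lerD//; last by rewrite ler_norml cos_geN1 cos_le1.
  by rewrite normrM ler_piMr// ler_norml sin_geN1 sin_le1.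
apply: etrans.
  apply: (@even_integral (fun t => expR (- `|t|) * (1 + cos (t * z)))
    (fun x => expR (- x) * k x) 0); last first.
- have e0 (c : R) : expR (- x) * c @[x --> +oo] --> 0.
    by rewrite -[X in _ --> X](mul0r c); apply: cvgMl; exact: cvgr_expR.
  apply: (squeeze_cvgr _ (e0 (- (1 + (`|z| + 1)))) (e0 (1 + (`|z| + 1)))).
  apply: nearW => x; rewrite !ler_pM2l ?expR_gt0//.
  by have := kC x; rewrite ler_norml.
- move=> x x0; rewrite ger0_norm//.
  have dm : is_derive x 1 (fun x : R => x * z) z.
    rewrite (_ : (fun x : R => x * z) = (id : R -> R) * cst z)//.
    by apply: is_derive_eq; rewrite scaler0 add0r /GRing.scale/= mulr1.
  have de : is_derive x 1 (fun x : R => expR (- x)) (- expR (- x)).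
    by apply: is_derive_eq; rewrite /GRing.scale/= mulrN1.
  have ds : is_derive x 1 (fun x : R => sin (x * z)) (cos (x * z) * z).
    by apply: (@is_derive1_comp _ sin (fun x : R => x * z)).
  have dc : is_derive x 1 (fun x : R => cos (x * z)) (- sin (x * z) * z).
    by apply: (@is_derive1_comp _ cos (fun x : R => x * z)).
  rewrite /k; apply: is_derive_eq; rewrite /GRing.scale/= /k; by field.
- by move=> t; rewrite normrN mulNr cosN.
- move=> t; apply: (@cvgM _ _ (nbhs t) _ (fun t : R => expR (- `|t|)) (fun t => 1 + cos (t * z))).
    exact: expR_abs_continuous.
  apply: cvgD; first exact: cvg_cst.
  have := @continuous_cosM z 0 t; rewrite /continuous_at.
  by under eq_fun do rewrite addr0; rewrite addr0.
- by move=> t; rewrite mulr_ge0 ?expR_ge0// -lerBlDl sub0r cos_geN1.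
- by congr EFin; rewrite /k /pk oppr0 expR0 mul0r sin0 cos0; field.
Qed.

Lemma pk0 : pk 0 = 2.
Proof. by rewrite /pk expr0n addr0 divr1. Qed.

Lemma integral_expR_abs : (\int[leb]_t (expR (- `|t|))%:E = (2 : R)%:E)%E.
Proof.
have := integral_expR_abs_cos 0; rewrite pk0.
under eq_integral do rewrite mulr0 cos0 mulrC EFinM.
rewrite ge0_integralZl//; last first.
  by apply/measurable_EFinP; apply: continuous_measurable_fun; exact: expR_abs_continuous.
move=> /(congr1 (fun x => (2^-1)%:E * x)%E); rewrite muleA -!EFinM.
have -> : 2^-1 * (1 + 1) = 1 :> R by field.
by rewrite mul1e => ->; congr EFin; field.
Qed.

Lemma L1_expR_abs : L1 leb (fun t : R => expR (- `|t|)).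
Proof.
have mE : measurable_fun [set: R] (fun t : R => expR (- `|t|)).
  by apply: continuous_measurable_fun; exact: expR_abs_continuous.
apply/L1P; split=> //; under eq_integral do rewrite ger0_norm ?expR_ge0//.
by rewrite integral_expR_abs ltry.
Qed.

Lemma measurable_cosM (z c : R) : measurable_fun [set: R] (fun t : R => cos (t * z + c)).
Proof. by apply: continuous_measurable_fun; exact: continuous_cosM. Qed.

Lemma L1_expR_abs_cos (z c : R) : L1 leb (fun t : R => expR (- `|t|) * cos (t * z + c)).
Proof.
apply: (L1M (C := 1) L1_expR_abs (measurable_cosM z c)) => t.
by rewrite ler_norml cos_geN1 cos_le1.
Qed.

Lemma Rintegral_expR_abs_cos0 (z : R) :
  \int[leb]_t (expR (- `|t|) * cos (t * z)) = pk z.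
Proof.
have L : L1 leb (fun t : R => expR (- `|t|) * cos (t * z)).
  by have := L1_expR_abs_cos z 0; under eq_fun do rewrite addr0.
have := integral_expR_abs_cos z => /(congr1 fine)/=.
rewrite -/(Rintegral _ _ (fun t : R => expR (- `|t|) * (1 + cos (t * z)))) => h.
suff : 2 + \int[leb]_t (expR (- `|t|) * cos (t * z)) = 2 + pk z by move=> /addrI.
rewrite -h -[in LHS](_ : fine (\int[leb]_t (expR (- `|t|))%:E)%E = 2); last first.
  by rewrite integral_expR_abs.
rewrite -RintegralD//; last exact: L1_expR_abs.
by apply: eq_Rintegral => t _; rewrite mulrDr mulr1.
Qed.

Lemma RintegralN_R (h : R -> R) : measurable_fun [set: R] h ->
  \int[leb]_t h (- t) = \int[leb]_t h t.
Proof.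
move=> mh; apply: (Rintegral_reindex (m := leb) (tau := -%R)) => // g mg g0.
have N1 : (-1 : R) != 0 by rewrite oppr_eq0 oner_neq0.
rewrite -[RHS](integral_affineR 0 N1)// normrN1 mul1e.
by under [in RHS]eq_integral do rewrite addr0 mulN1r.
Qed.

(** Reflecting [t] shows that the integrals for [c] and [- c] coincide, and by the addition formula
    their sum is [2 cos c] times the integral without phase. *)
Lemma Rintegral_expR_abs_cos (z c : R) :
  \int[leb]_t (expR (- `|t|) * cos (t * z + c)) = cos c * pk z.
Proof.
pose I a := \int[leb]_t (expR (- `|t|) * cos (t * z + a)).
have IN : I c = I (- c).
  rewrite /I -[LHS]RintegralN_R; last exact: L1_measurable (L1_expR_abs_cos z c).
  by apply: eq_Rintegral => t _; rewrite normrN mulNr -[X in _ + X]opprK -opprD cosN.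
have : I c + I (- c) = 2 * cos c * pk z.
  rewrite -Rintegral_expR_abs_cos0 -RintegralZl//; last first.
    by have := L1_expR_abs_cos z 0; under eq_fun do rewrite addr0.
  rewrite /I -RintegralD//; [|exact: L1_expR_abs_cos|exact: L1_expR_abs_cos].
  by apply: eq_Rintegral => t _; rewrite !cosD cosN sinN; ring.
by rewrite -IN /I; lra.
Qed.

Lemma powR_decay_cvg (b : R) : 0 < b -> (1 + x) `^ (- b) @[x --> +oo] --> (0 : R).
Proof.
move=> b0; apply/cvgrPdist_le => /= e e0; near=> x.
have x0 : 0 <= x by near: x; exact: nbhs_pinfty_ge.
rewrite sub0r normrN ger0_norm ?powR_ge0// powRN.
rewrite invf_ple ?posrE ?powR_gt0 ?invr_gt0 ?ltr_pwDl//.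
have -> : e^-1 = (e `^ (- b^-1)) `^ b.
  by rewrite -powRrM mulNr mulVf ?gt_eqF// powR_inv1// ltW.
apply: ge0_ler_powR; rewrite ?nnegrE ?powR_ge0 ?addr_ge0 ?(ltW b0)//.
have : e `^ (- b^-1) <= x by near: x; apply: nbhs_pinfty_ge; rewrite num_real.
by move=> h; apply: (le_trans h); rewrite lerDr.
Unshelve. all: by end_near. Qed.

Lemma is_derive_powR_shift (b x : R) : 0 <= x ->
  is_derive x 1 (fun x : R => (1 + x) `^ b) (b * (1 + x) `^ (b - 1)).
Proof.
move=> x0; have x1 : 1 + x \in `]0, +oo[ by rewrite in_itv/= andbT ltr_pwDl.
have d1 : is_derive x 1 (fun x : R => 1 + x) 1.
  rewrite (_ : (fun x : R => 1 + x) = cst 1 + id)//.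
  by apply: is_derive_eq; rewrite add0r.
have d2 : is_derive (1 + x) 1 (fun y : R => y `^ b) (b * (1 + x) `^ (b - 1)).
  split; first exact: derivable_powR.
  by rewrite -derive1E powR_derive1.
have := @is_derive1_comp _ (fun y : R => y `^ b) (fun x : R => 1 + x) x _ _ d2 d1.
by rewrite mulr1.
Qed.

Definition decay (a t : R) := (1 + `|t|) `^ (- a).

Lemma continuous_decay a : continuous (decay a).
Proof.
rewrite (_ : decay a = (fun y : R => y `^ (- a)) \o (fun t => 1 + `|t|))// => t.
apply: continuous_comp.
  by apply: cvgD; [exact: cvg_cst|exact: norm_continuous].
apply: differentiable_continuous; apply/derivable1_diffP; apply: derivable_powR.
by rewrite in_itv/= andbT ltr_pwDl.
Qed.

Lemma decay_ge0 a t : 0 <= decay a t. Proof. exact: powR_ge0. Qed.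

Lemma integral_decay a : 1 < a ->
  (\int[leb]_t (decay a t)%:E = (2 / (a - 1))%:E)%E.
Proof.
move=> a1; have a0 : a - 1 != 0 by rewrite gt_eqF// subr_gt0.
apply: etrans.
  apply: (@even_integral (decay a)
    (fun x => - (a - 1)^-1 * (1 + x) `^ (- (a - 1))) 0 (decay_ge0 a)); last first.
  - rewrite -(mulr0 (- (a - 1)^-1)); apply: cvgMr; apply: powR_decay_cvg.
    by rewrite subr_gt0.
  - move=> x x0; have dp := is_derive_powR_shift (- (a - 1)) x0.
    apply: is_derive_eq; rewrite /GRing.scale/= /decay ger0_norm// mulrA.
    rewrite mulrNN mulVf// mul1r; congr (_ `^ _); ring.
  - by move=> x; rewrite /decay normrN.
  - exact: continuous_decay.
by congr EFin; rewrite addr0 powR1; field.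
Qed.

Lemma measurable_decay a : measurable_fun [set: R] (decay a).
Proof. by apply: continuous_measurable_fun; exact: continuous_decay. Qed.

Lemma pk_gt0 z : 0 < pk z.
Proof. by rewrite divr_gt0// ltr_pwDl// sqr_ge0. Qed.

Lemma pk_le z : pk z <= 4 * decay 2 z.
Proof.
have z2 : 0 < 1 + z ^+ 2 by rewrite ltr_pwDl// sqr_ge0.
have zz : 0 < 1 + `|z| by rewrite ltr_pwDl.
rewrite /decay powR_invn ?(ltW zz)// /pk -/(_ / _).
rewrite ler_pdivlMr ?exprn_gt0// mulrAC ler_pdivrMr//.
by have := sqr_ge0 (1 - `|z|); have := real_normK (num_real z); nra.
Qed.

Lemma continuous_pk : continuous pk.
Proof.
move=> z; apply: cvgM; first exact: cvg_cst.
apply: cvgV; first by rewrite gt_eqF// ltr_pwDl// sqr_ge0.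
apply: cvgD; first exact: cvg_cst.
exact: exprn_continuous.
Qed.

Lemma measurable_pk : measurable_fun [set: R] pk.
Proof. by apply: continuous_measurable_fun; exact: continuous_pk. Qed.

Lemma pkN z : pk (- z) = pk z. Proof. by rewrite /pk sqrrN. Qed.

Lemma pk_le2 z : pk z <= 2.
Proof.
have z2 : 0 < 1 + z ^+ 2 by rewrite ltr_pwDl// sqr_ge0.
by rewrite /pk ler_pdivrMr// mulrDr mulr1 lerDl mulr_ge0// sqr_ge0.
Qed.

Lemma L1_pk : L1 leb pk.
Proof.
apply: (@le_L1 _ _ _ leb pk (fun z => 4 * decay 2 z)); first exact: measurable_pk.
  move=> z; rewrite [`|pk z|]ger0_norm ?(ltW (pk_gt0 _))//.
  by rewrite ger0_norm ?mulr_ge0 ?decay_ge0 ?pk_le.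
apply: L1Z; apply/L1P; split; first exact: measurable_decay.
under eq_integral do rewrite ger0_norm ?decay_ge0//.
by rewrite integral_decay ?ltry// ltr1n.
Qed.

(** Only the sign of this integral enters: a power of it is the constant in Plancherel, which
    cancels when [plancherel_le] and [plancherel_ge] are combined in [repW_poly]. *)
Lemma Rintegral_pk_gt0 : 0 < \int[leb]_z pk z.
Proof.
have pk0' z : 0 <= pk z by exact: ltW (pk_gt0 z).
have := @ge0_subset_integral _ _ _ leb `[0, 1] setT (measurable_itv _) measurableT
  (fun z => (pk z)%:E).
move=> /(_ _ _ (@subsetT _ _)) h.
have : (1%:E <= \int[leb]_z (pk z)%:E)%E.
  apply: (le_trans _ (h _ _)); last 2 first.
  - by apply/measurable_EFinP; exact: measurable_pk.
  - by move=> x _; rewrite lee_fin.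
  have <- : (\int[leb]_(x in `[0%R, 1%R]) (1%:E) = 1%:E :> \bar R)%E.
    by rewrite integral_cst//= mul1e lebesgue_measure_itv/= lte_fin ltr01 oppr0 adde0.
  apply: ge0_le_integral => //.
  - by apply/measurable_EFinP; apply: measurable_funTS; exact: measurable_pk.
  - move=> x; rewrite /= in_itv/= => /andP[x0 x1]; rewrite lee_fin.
    rewrite /pk ler_pdivlMr ?ltr_pwDl ?sqr_ge0// mul1r -[leRHS]/(1 + 1) lerD2l.
    by rewrite expr_le1.
have fin : (\int[leb]_z (pk z)%:E)%E \is a fin_num.
  exact: (integrable_fin_num measurableT L1_pk).
by rewrite -(fineK fin) lee_fin; apply: lt_le_trans.
Qed.
End lorentz_kernel.

(** * Tensor powers of functions of one variable *)

Section product_integrals.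
Context {R : realType}.
Local Notation leb := (@lebesgue_measure R).

Definition tens n (f : R -> R) (x : 'rV[R]_n) : R := \prod_i f (x ord0 i).

Lemma tens_ge0 n f (x : 'rV[R]_n) : (forall t, 0 <= f t) -> 0 <= tens f x.
Proof. by move=> f0; apply: prodr_ge0. Qed.

Lemma tens_consv n f t (v : 'rV[R]_n) : tens f (consv t v) = f t * tens f v.
Proof.
rewrite /tens big_ord_recl consv0; congr (_ * _).
by apply: eq_bigr => i _; rewrite consvS.
Qed.

Lemma measurable_tens n f : measurable_fun [set: R] f ->
  measurable_fun [set: 'rV[R]_n] (tens f).
Proof.
move=> mf; apply: measurable_prod => i _.
exact: (measurableT_comp mf (measurable_coord i)).
Qed.

Lemma integral_tens n (f : R -> R) (c : R) : measurable_fun [set: R] f ->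
  (forall t, 0 <= f t) -> (\int[leb]_t (f t)%:E = c%:E)%E ->
  (\int[mu n]_x (tens f x)%:E = (c ^+ n)%:E)%E.
Proof.
move=> mf f0 fc; elim: n => [|n ih].
  rewrite integral_mu0; first by rewrite /tens big_ord0.
    by apply/measurable_EFinP; exact: measurable_tens.
  by move=> x; rewrite lee_fin tens_ge0.
rewrite integral_muS; last 2 first.
- by apply/measurable_EFinP; exact: measurable_tens.
- by move=> x; rewrite lee_fin tens_ge0.
transitivity (\int[leb]_t ((f t)%:E * (c ^+ n)%:E))%E.
  apply: eq_integral => t _; rewrite -ih -ge0_integralZl//.
  - by apply: eq_integral => v _; rewrite tens_consv.
  - by apply/measurable_EFinP; exact: measurable_tens.
  - by move=> x _; rewrite lee_fin tens_ge0.
  - by rewrite lee_fin.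
rewrite ge0_integralZr//.
- by rewrite fc -EFinM exprS.
- exact/measurable_EFinP.
- by move=> t _; rewrite lee_fin.
- rewrite lee_fin exprn_ge0// -lee_fin -fc.
  by apply: integral_ge0 => t _; rewrite lee_fin.
Qed.

Lemma L1_tens n (f : R -> R) : (forall t, 0 <= f t) -> L1 leb f -> L1 (mu n) (tens f).
Proof.
move=> f0 Lf; have mf := L1_measurable Lf.
have fin : (\int[leb]_t (f t)%:E)%E \is a fin_num.
  exact: (integrable_fin_num measurableT Lf).
apply/L1P; split; first exact: measurable_tens.
under eq_integral do rewrite ger0_norm ?tens_ge0//.
by rewrite (integral_tens n mf f0 (esym (fineK fin))) ltry.
Qed.

Lemma Rintegral_muS n (f : 'rV[R]_n.+1 -> R) : L1 (mu n.+1) f ->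
  \int[mu n.+1]_x f x = \int[leb]_t \int[mu n]_v f (consv t v).
Proof.
move=> Lf; have mf := L1_measurable Lf.
have L : L1 (leb \x mu n)%E (fun p : R * 'rV[R]_n => f (consv p.1 p.2)).
  have /L1P[_ Lf'] := Lf; apply/L1P; split.
    exact: (measurableT_comp mf (@measurable_consv R n)).
  move: Lf'; rewrite /= ge0_integral_pushforward//=; last 2 first.
  - exact: measurable_consv.
  - by apply/measurable_EFinP; exact: measurableT_comp.
rewrite (Rintegral_fubini1 L); congr fine.
rewrite /= integral_pushforward ?preimage_setT//=.
- exact: measurable_consv.
- exact/measurable_EFinP.
Qed.

Lemma dotRn_consv n t z0 (v z : 'rV[R]_n) :
  dotRn (consv t v) (consv z0 z) = t * z0 + dotRn v z.
Proof.
rewrite /dotRn big_ord_recl !consv0; congr (_ + _).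
by apply: eq_bigr => i _; rewrite !consvS.
Qed.

(** The first coordinate enters the inner integral as a shift of the phase, so the induction needs
    an arbitrary phase [c]. It also serves [cas], which is a sum of two cosines with phases 0 and
    [- pi / 2]. *)
Lemma Rintegral_lap n (z : 'rV[R]_n) c :
  \int[mu n]_x (tens (fun t => expR (- `|t|)) x * cos (dotRn x z + c)) =
  cos c * tens pk z.
Proof.
have L m' (z' : 'rV[R]_m') c' : L1 (mu m') (fun x =>
    tens (fun t => expR (- `|t|)) x * cos (dotRn x z' + c')).
  apply: (L1M (C := 1)); first by apply: L1_tens L1_expR_abs => t; exact: expR_ge0.
    under eq_fun do rewrite dotRnC.
    apply: (measurable_comp_dotRn (f := fun t => cos (t + c'))).
    by have := @continuous_cosM R 1 c'; under eq_fun do rewrite mulr1.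
  by move=> x; rewrite ler_norml cos_geN1 cos_le1.
elim: n z c => [|n ih] z c.
  rewrite /Rintegral /= integral_dirac//= ?diracT ?mul1e/=.
    by rewrite indicE in_setT mul1r /dotRn !big_ord0 /tens !big_ord0 add0r mulrC.
  exact/measurable_EFinP/L1_measurable/(L 0).
rewrite Rintegral_muS// (consvE z) tens_consv.
set z0 := z _ _; set z' := (X in consv _ X).
transitivity (\int[leb]_t ((expR (- `|t|) * cos (t * z0 + c)) * tens pk z')).
  apply: eq_Rintegral => t _; rewrite -mulrA -ih -RintegralZl//; last exact: L.
  apply: eq_Rintegral => v _; rewrite tens_consv mulrA; congr (_ * cos _).
  by rewrite dotRn_consv [_ + dotRn _ _]addrC -addrA.
rewrite RintegralZr//; last exact: L1_expR_abs_cos.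
by rewrite Rintegral_expR_abs_cos mulrA.
Qed.

End product_integrals.

(** * Plancherel *)

Lemma measurable_Rintegral_snd {R : realType} d1 d2 (T1 : measurableType d1) (T2 : measurableType d2)
    (m1 : {sigma_finite_measure set T1 -> \bar R}) (F : T1 * T2 -> R) :
  measurable_fun setT F -> measurable_fun setT (fun y : T2 => \int[m1]_x F (x, y)).
Proof.
move=> mF; have mE : measurable_fun setT (EFin \o F) by exact/measurable_EFinP.
have mp : measurable_fun setT (fubini_G m1 (funepos (EFin \o F))).
  by apply: measurable_fun_fubini_tonelli_G => //; exact: measurable_funepos.
have mn : measurable_fun setT (fubini_G m1 (funeneg (EFin \o F))).
  by apply: measurable_fun_fubini_tonelli_G => //; exact: measurable_funeneg.
rewrite [X in measurable_fun _ X](_ : _ = fun y : T2 => fine (fubini_G m1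
  (funepos (EFin \o F)) y - fubini_G m1 (funeneg (EFin \o F)) y)%E).
  apply: (measurableT_comp (fine_measurable measurableT)).
  exact: emeasurable_funB mp mn.
apply/funext => y; rewrite /Rintegral integralE; congr (fine (_ - _)%E).
  by apply: eq_integral => x _; rewrite !funeposE.
by apply: eq_integral => x _; rewrite !funenegE.
Qed.

Section plancherel.
Context {R : realType} {n : nat}.
Local Notation V := ('rV[R]_n).
Local Notation m := (@mu R n).
Implicit Types (g h : V -> R) (x y xi eta : V).

Lemma fine_mull (c : R) (x : \bar R) : 0 < c -> fine (c%:E * x)%E = c * fine x.
Proof.
move=> c0; case: x => [r//| |] /=; rewrite mulr0.
  by rewrite gt0_muley// lte_fin.
by rewrite gt0_muleNy// lte_fin.
Qed.

Lemma L1_affine (a : R) (b : V) g : a != 0 -> L1 m g -> L1 m (fun x => g (a *: x + b)).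
Proof.
move=> a0 /L1P[mg ig]; apply/L1P; split; first exact: (measurableT_comp mg (measurable_affine a b)).
have c0 : 0 < `|a| ^+ n by rewrite exprn_gt0// normr_gt0.
have := @integral_affine R n a b (fun x => `|g x|%:E) a0.
move=> /(_ (measurable_absE mg) (fun x => ltac:(by rewrite lee_fin))) h.
move: ig; rewrite -h; case: (\int[m]_x _)%E => [r||]//; rewrite ?ltry//.
by rewrite gt0_muley ?lte_fin.
Qed.

Lemma Rintegral_affine (a : R) (b : V) g : a != 0 -> L1 m g ->
  `|a| ^+ n * \int[m]_x g (a *: x + b) = \int[m]_x g x.
Proof.
move=> a0 Lg; have c0 : 0 < `|a| ^+ n by rewrite exprn_gt0// normr_gt0.
have key (f : V -> R) : measurable_fun setT f -> (forall x, 0 <= f x) ->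
    `|a| ^+ n * \int[m]_x f (a *: x + b) = \int[m]_x f x.
  move=> mf f0; rewrite -fine_mull// /Rintegral; congr fine.
  apply: (@integral_affine R n a b (fun x => (f x)%:E)) => //.
  exact/measurable_EFinP.
have Lng := L1_norm Lg; have Ls := L1D Lng Lg.
transitivity (\int[m]_x (`|g x| + g x) - \int[m]_x `|g x|); last first.
  by rewrite -RintegralB//; apply: eq_Rintegral => x _; rewrite addrC addKr.
rewrite -(key (fun x => `|g x|)) ?normr_ge0//; last exact: L1_measurable Lng.
rewrite -(key (fun x => `|g x| + g x)); last 2 first.
- exact: L1_measurable Ls.
- by move=> x; rewrite -lerBlDr sub0r -normrN ler_norm.
rewrite -mulrBr -RintegralB//; [|exact: (L1_affine b a0 Ls)|exact: (L1_affine b a0 Lng)].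
by congr (_ * _); apply: eq_Rintegral => x _; rewrite [RHS]addrC addKr.
Qed.

Lemma L1_mul_prod g h : L1 m g -> L1 m h -> L1 (m \x m)%E (fun p : V * V => g p.1 * h p.2).
Proof.
move=> Lg Lh; have [mg mh] := (L1_measurable Lg, L1_measurable Lh).
apply: L1_prod.
  apply: measurable_funM; first exact: (measurableT_comp mg measurable_fst).
  exact: (measurableT_comp mh measurable_snd).
have /L1P[_ Lg'] := Lg; have /L1P[_ Lh'] := Lh.
rewrite (_ : (\int[m]_y _)%E = (\int[m]_x `|g x|%:E * \int[m]_y `|h y|%:E)%E).
  by rewrite lte_mul_pinfty// ?integral_ge0// ge0_fin_numE// integral_ge0.
transitivity (\int[m]_y (\int[m]_x `|g x|%:E * `|h y|%:E))%E.
  apply: eq_integral => y _; rewrite -ge0_integralZr//; last exact: measurable_absE.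
  by apply: eq_integral => x _; rewrite normrM EFinM.
by rewrite ge0_integralZl//; [exact: measurable_absE|exact: integral_ge0].
Qed.

Lemma hartley_duality h psi : L1 m h -> L1 m psi ->
  \int[m]_x (hartley h x * psi x) = \int[m]_xi (h xi * \int[m]_x (psi x * cas (dotRn x xi))).
Proof.
move=> Lh Lpsi.
have L : L1 (m \x m)%E (fun p : V * V => psi p.1 * h p.2 * cas (dotRn p.1 p.2)).
  apply: (L1M (C := 2)); first exact: L1_mul_prod.
    apply: (measurableT_comp (continuous_measurable_fun continuous_cas)).
    exact: measurable_dotRn2.
  by move=> p; exact: cas_le2.
transitivity (\int[m]_x \int[m]_xi (psi x * h xi * cas (dotRn x xi))).
  apply: eq_Rintegral => x _; rewrite mulrC -RintegralZl//; last exact: L1_cas.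
  by apply: eq_Rintegral => xi _; rewrite mulrA.
rewrite (Rintegral_fubini L)/=; apply: eq_Rintegral => xi _.
rewrite -RintegralZl//; last first.
  by under eq_fun do rewrite dotRnC; exact: L1_cas.
by apply: eq_Rintegral => x _; rewrite mulrA [h xi * _]mulrC.
Qed.

(** The square is the transform of [hprod h h], and duality moves the transform onto [psi]. Since
    [K] is even, both convolutions pair with the same function [B], so that the even and odd parts
    of [h] recombine. *)
Lemma Rintegral_hartley_sqr h psi (K : V -> R) (C : R) : L1 m h -> L1 m psi ->
  measurable_fun setT K -> (forall z, `|K z| <= C) -> (forall z, K (- z) = K z) ->
  (forall xi, \int[m]_x (psi x * cas (dotRn x xi)) = K xi) ->
  \int[m]_x (hartley h x ^+ 2 * psi x) =
  \int[m]_eta (h eta * \int[m]_xi (h xi * K (xi - eta))).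
Proof.
move=> Lh Lpsi mK KC Ke psiK.
have Lr := L1_reflect Lh; have [Le Lo] := (L1_evenpart Lh, L1_oddpart Lh).
have mKs eta : measurable_fun setT (fun xi => K (xi + eta)).
  exact: (measurableT_comp mK (measurable_shift _)).
pose B eta := \int[m]_xi (h xi * K (xi - eta)).
have LK eta : L1 m (fun xi => h xi * K (xi + eta)) by apply: (L1M (C := C)).
have BC eta : `|B eta| <= fine (\int[m]_xi `|h xi|%:E)%E * C.
  have C0 : 0 <= C by rewrite (le_trans _ (KC 0)).
  apply: Rintegral_norm_le; last exact: L1_measurable.
  rewrite EFinM fineK; last exact: (integrable_fin_num measurableT (L1_norm Lh)).
  have mh := L1_measurable Lh.
  rewrite -ge0_integralZr//; last exact: measurable_absE.
  apply: ge0_leint => //; first exact: measurable_absE (L1_measurable (LK (- eta))).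
    by apply: emeasurable_funM => //; exact: measurable_absE.
  by move=> xi; rewrite -EFinM lee_fin normrM ler_wpM2l.
have mB : measurable_fun setT B.
  have mF : measurable_fun [set: V * V] (fun p : V * V => K (p.1 - p.2)).
    exact: (measurableT_comp mK measurable_sub2).
  have mh := L1_measurable Lh.
  have mG : measurable_fun [set: V * V] (fun p : V * V => h p.1 * K (p.1 - p.2)).
    by apply: measurable_funM => //; exact: measurableT_comp.
  exact: (measurable_Rintegral_snd m mG).
have LB g : L1 m g -> L1 m (fun eta => g eta * B eta).
  by move=> Lg; apply: (L1M (C := fine (\int[m]_xi `|h xi|%:E)%E * C)).
transitivity (\int[m]_xi (hprod h h xi * K xi)).
  transitivity (\int[m]_x (hartley (hprod h h) x * psi x)).
    by apply: eq_Rintegral => x _; rewrite hartleyM.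
  rewrite hartley_duality//; last exact: L1_hprod.
  by apply: eq_Rintegral => xi _; rewrite psiK.
transitivity (\int[m]_eta (evenpart h eta * B eta) + \int[m]_eta (oddpart h eta * B eta)); last first.
  rewrite -RintegralD//; [|exact: LB|exact: LB].
  by apply: eq_Rintegral => eta _; rewrite -mulrDl /evenpart /oddpart; congr (_ * _); field.
rewrite -[LHS](_ : \int[m]_xi (conv h (evenpart h) xi * K xi) +
  \int[m]_xi (conv (reflect h) (oddpart h) xi * K xi) = _); last first.
  rewrite -RintegralD//; last 2 first.
  - by apply: (L1M (C := C)) => //; exact: L1_conv.
  - by apply: (L1M (C := C)) => //; exact: L1_conv.
  by apply: eq_Rintegral => xi _; rewrite -mulrDl.
congr (_ + _).
  rewrite (Rintegral_conv Lh Le mK KC) -[RHS]Rintegral_reflect; last exact: L1_measurable (LB _ Le).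
  apply: eq_Rintegral => eta _; rewrite /evenpart opprK [h _ + _]addrC; congr (_ * _).
  by apply: eq_Rintegral => xi _; rewrite opprK.
rewrite (Rintegral_conv Lr Lo mK KC).
apply: eq_Rintegral => eta _; congr (_ * _).
rewrite -[RHS]Rintegral_reflect; last exact: L1_measurable (LK _).
by apply: eq_Rintegral => xi _; rewrite -opprD Ke.
Qed.

(* [lap] is the tensor power of [exp (- |t|)], and [pker] its transform. *)
Definition lap : V -> R := tens (fun t => expR (- `|t|)).
Definition pker : V -> R := tens pk.

Lemma measurable_lap : measurable_fun [set: V] lap.
Proof.
by apply: measurable_tens; apply: continuous_measurable_fun; exact: expR_abs_continuous.
Qed.

Lemma lap_ge0 x : 0 <= lap x.
Proof. by apply: tens_ge0 => t; exact: expR_ge0. Qed.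

Lemma lap_le1 x : lap x <= 1.
Proof.
apply: prodr_ile1 => i _; rewrite expR_ge0/= -expR0 ler_expR oppr_le0.
exact: normr_ge0.
Qed.

Lemma L1_lap : L1 m lap.
Proof. by apply: L1_tens L1_expR_abs => t; exact: expR_ge0. Qed.

Lemma pker_ge0 x : 0 <= pker x.
Proof. by apply: tens_ge0 => t; exact: ltW (pk_gt0 t). Qed.

Lemma pkerN x : pker (- x) = pker x.
Proof. by apply: eq_bigr => i _; rewrite mxE pkN. Qed.

Lemma pker_le x : pker x <= 2 ^+ n.
Proof.
rewrite -[n in leRHS]card_ord -prodr_const; apply: ler_prod => i _.
by rewrite ltW ?pk_gt0//= pk_le2.
Qed.

Lemma measurable_pker : measurable_fun [set: V] pker.
Proof. by apply: measurable_tens; exact: measurable_pk. Qed.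

Lemma L1_pker : L1 m pker.
Proof. by apply: L1_tens L1_pk => t; exact: ltW (pk_gt0 t). Qed.

Lemma Rintegral_pker_gt0 : 0 < \int[m]_x pker x.
Proof.
have fin : (\int[@lebesgue_measure R]_t (pk t)%:E)%E \is a fin_num.
  exact: (integrable_fin_num measurableT L1_pk).
rewrite /Rintegral (integral_tens n measurable_pk (fun t => ltW (pk_gt0 t)) (esym (fineK fin)))/=.
by rewrite exprn_gt0// Rintegral_pk_gt0.
Qed.

Lemma Rintegral_lap_cas z : \int[m]_x (lap x * cas (dotRn x z)) = pker z.
Proof.
have L c : L1 m (fun x => lap x * cos (dotRn x z + c)).
  apply: (L1M (C := 1)); first exact: L1_lap.
    under eq_fun do rewrite dotRnC.
    apply: (measurable_comp_dotRn (f := fun t => cos (t + c))).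
    by have := @continuous_cosM R 1 c; under eq_fun do rewrite mulr1.
  by move=> x; rewrite ler_norml cos_geN1 cos_le1.
transitivity (\int[m]_x (lap x * cos (dotRn x z + 0)) +
    \int[m]_x (lap x * cos (dotRn x z + - (pi / 2)))).
  rewrite -RintegralD; [|by []|exact: L|exact: L]; apply: eq_Rintegral => x _.
  by rewrite addr0 /cas mulrDr cosD cosN sinN cos_pihalf sin_pihalf; ring.
by rewrite !Rintegral_lap cosN cos_pihalf mul0r addr0 cos0 mul1r.
Qed.

Definition eps_seq (k : nat) : R := k.+1%:R^-1.

Lemma eps_gt0 k : 0 < eps_seq k. Proof. by rewrite invr_gt0. Qed.

Lemma Rintegral_lap_scaled_cas (e : R) z : 0 < e ->
  \int[m]_x (lap (e *: x) * cas (dotRn x z)) = (e ^+ n)^-1 * pker (e^-1 *: z).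
Proof.
move=> e0; have en0 : e ^+ n != 0 by rewrite gt_eqF// exprn_gt0.
apply: (mulfI en0); rewrite mulrA divff// mul1r -Rintegral_lap_cas.
rewrite -[RHS](@Rintegral_affine e 0) ?gt_eqF//; last first.
  by under eq_fun do rewrite dotRnC; apply: L1_cas; exact: L1_lap.
rewrite (ger0_norm (ltW e0)); congr (_ * _); apply: eq_Rintegral => x _.
rewrite addr0; congr (_ * cas _).
by apply: eq_bigr => i _; rewrite !mxE mulrACA divff ?mul1r// gt_eqF.
Qed.

Lemma L1_sqr h (C : R) : L1 m h -> (forall x, `|h x| <= C) -> L1 m (fun x => h x ^+ 2).
Proof.
by move=> Lh hC; apply: (L1M (C := C) Lh (L1_measurable Lh) hC).
Qed.

(** The substitution [xi = eta + e z] absorbs the factor [e ^ -n] of the transform of the dilated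
    [lap]. What remains after subtracting the limit is the integral of [h] against the average [D]
    of its translation differences with weight [pker], and [|h| <= C]. *)
Lemma plancherel_error h (C : R) (e : R) : 0 < e -> L1 m h -> (forall x, `|h x| <= C) ->
  (`| \int[m]_x (hartley h x ^+ 2 * lap (e *: x)) -
     (\int[m]_z pker z) * \int[m]_eta h eta ^+ 2 |%:E <=
  C%:E * \int[m]_z ((pker z)%:E * \int[m]_eta `|h (eta + e *: z)%R - h eta|%:E))%E.
Proof.
move=> e0 Lh hC; have mh := L1_measurable Lh.
have C0 : 0 <= C by exact: le_trans (hC 0).
have en0 : e ^+ n != 0 by rewrite gt_eqF// exprn_gt0.
have mshift : measurable_fun [set: V * V] (fun p : V * V => p.1 + e *: p.2).
  apply: measurable_rV => // i; under eq_fun do rewrite !mxE.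
  apply: measurable_funD.
    exact: (measurableT_comp (measurable_coord i) measurable_fst).
  apply: measurable_funM => //.
  exact: (measurableT_comp (measurable_coord i) measurable_snd).
have msh eta : measurable_fun [set: V] (fun z => h (eta + e *: z)).
  exact: (measurableT_comp mh (measurableT_comp mshift (measurable_pair1 eta))).
have LP g : measurable_fun setT g -> (forall x, `|g x| <= C) ->
    L1 m (fun z => g z * pker z).
  move=> mg gC; under eq_fun do rewrite mulrC.
  by apply: (L1M (C := C)) => //; exact: L1_pker.
have B eta : \int[m]_xi (h xi * ((e ^+ n)^-1 * pker (e^-1 *: (xi - eta)))) =
    \int[m]_z (h (eta + e *: z) * pker z).
  have Lg : L1 m (fun xi => h xi * ((e ^+ n)^-1 * pker (e^-1 *: (xi - eta)))).
    apply: (L1M (C := (e ^+ n)^-1 * 2 ^+ n)) => //.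
      apply: measurable_funM => //; apply: (measurableT_comp measurable_pker).
      have := @measurable_affine R n e^-1 (- (e^-1 *: eta)).
      by under eq_fun do rewrite -scalerBr.
    move=> x; rewrite ger0_norm ?mulr_ge0 ?pker_ge0 ?invr_ge0 ?exprn_ge0 ?(ltW e0)//.
    by rewrite ler_wpM2l ?pker_le// invr_ge0 exprn_ge0 ?(ltW e0).
  rewrite -(@Rintegral_affine e eta) ?gt_eqF// -RintegralZl//; last first.
    by apply: (L1_affine eta _ Lg); rewrite gt_eqF.
  apply: eq_Rintegral => z _; rewrite addrK scalerA mulVf ?gt_eqF// scale1r.
  by rewrite (ger0_norm (ltW e0)) [e *: z + eta]addrC; field.
rewrite (@Rintegral_hartley_sqr _ (fun x => lap (e *: x))
  (fun xi => (e ^+ n)^-1 * pker (e^-1 *: xi)) ((e ^+ n)^-1 * 2 ^+ n))//; last 5 first.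
- have ne0 : e != 0 by rewrite gt_eqF.
  by have := L1_affine 0 ne0 L1_lap; under eq_fun do rewrite addr0.
- apply: measurable_funM => //; apply: (measurableT_comp measurable_pker).
  by have := @measurable_affine R n e^-1 0; under eq_fun do rewrite addr0.
- move=> x; rewrite ger0_norm ?mulr_ge0 ?pker_ge0 ?invr_ge0 ?exprn_ge0 ?(ltW e0)//.
  by rewrite ler_wpM2l ?pker_le// invr_ge0 exprn_ge0 ?(ltW e0).
- by move=> z; rewrite scalerN pkerN.
- by move=> xi; exact: Rintegral_lap_scaled_cas.
under eq_Rintegral do rewrite B.
have mP : measurable_fun [set: V * V]
    (fun p : V * V => (pker p.2 * `|h (p.1 + e *: p.2) - h p.1|)%:E).
  apply/measurable_EFinP; apply: measurable_funM.
    exact: (measurableT_comp measurable_pker measurable_snd).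
  apply: measurableT_comp => //; apply: measurable_funB.
    exact: (measurableT_comp mh mshift).
  exact: (measurableT_comp mh measurable_fst).
have mBint eta : measurable_fun [set: V] (fun z => h (eta + e *: z) * pker z).
  exact: L1_measurable (LP _ (msh eta) _).
pose D eta := \int[m]_z ((h (eta + e *: z) - h eta) * pker z).
have DE eta : \int[m]_z (h (eta + e *: z) * pker z) = D eta + (\int[m]_z pker z) * h eta.
  rewrite -RintegralZr//; last exact: L1_pker.
  rewrite -RintegralD//.
  - by apply: eq_Rintegral => z _; ring.
  - have := L1B (LP _ (msh eta) (fun z => hC _)) (LP (cst (h eta)) (measurable_cst _) (fun z => hC _)).
    by congr L1; apply/funext => z /=; ring.
  - by under eq_fun do rewrite mulrC; apply: L1Z; exact: L1_pker.
have D2 eta : `|D eta| <= 2 * C * \int[m]_z pker z.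
  apply: Rintegral_norm_le; last first.
    by apply: measurable_funM; [apply: measurable_funB|exact: measurable_pker].
  rewrite EFinM fineK; last exact: (integrable_fin_num measurableT L1_pker).
  rewrite -ge0_integralZl//; last 3 first.
  - by apply/measurable_EFinP; exact: measurable_pker.
  - by move=> z _; rewrite lee_fin pker_ge0.
  - by rewrite lee_fin mulr_ge0.
  apply: ge0_leint => //.
  - apply: measurable_absE.
    by apply: measurable_funM; [apply: measurable_funB|exact: measurable_pker].
  - by apply: emeasurable_funM => //; apply/measurable_EFinP; exact: measurable_pker.
  - move=> z; rewrite -EFinM lee_fin normrM [`|pker z|]ger0_norm ?pker_ge0//.
    rewrite ler_wpM2r ?pker_ge0// (le_trans (ler_normB _ _))//.
    by rewrite mulr_natl mulr2n lerD.
have mD : measurable_fun setT D.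
  apply: (@measurable_Rintegral_snd _ _ _ _ _ m
    (fun p : V * V => (h (p.2 + e *: p.1) - h p.2) * pker p.1)).
  apply: measurable_funM; last exact: (measurableT_comp measurable_pker measurable_fst).
  apply: measurable_funB; last exact: (measurableT_comp mh measurable_snd).
  apply: (measurableT_comp mh).
  apply: measurable_rV => // i; under eq_fun do rewrite !mxE.
  apply: measurable_funD.
    exact: (measurableT_comp (measurable_coord i) measurable_snd).
  apply: measurable_funM => //.
  exact: (measurableT_comp (measurable_coord i) measurable_fst).
have LD : L1 m (fun eta => h eta * D eta).
  exact: (L1M (C := 2 * C * \int[m]_z pker z)).
have -> : \int[m]_eta (h eta * \int[m]_z (h (eta + e *: z) * pker z)) -
    \int[m]_z pker z * \int[m]_eta h eta ^+ 2 = \int[m]_eta (h eta * D eta).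
  rewrite -RintegralZl//; last exact: L1_sqr hC.
  transitivity (\int[m]_eta (h eta * D eta + \int[m]_z pker z * h eta ^+ 2) -
    \int[m]_eta (\int[m]_z pker z * h eta ^+ 2)).
    congr (_ - _); apply: eq_Rintegral => eta _; rewrite DE; ring.
  rewrite RintegralD ?addrK//; apply: L1Z; exact: L1_sqr hC.
apply: (le_trans (Rintegral_norm_leE _ _)); first exact: L1_measurable LD.
have mPz z : measurable_fun [set: V] (fun eta => `|h (eta + e *: z) - h eta|%:E).
  apply: measurable_absE; apply: measurable_funB => //.
  exact: (measurableT_comp mh (measurable_shift _)).
have -> : (\int[m]_z ((pker z)%:E * \int[m]_eta `|h (eta + e *: z)%R - h eta|%:E) =
    \int[m]_eta \int[m]_z (pker z * `|h (eta + e *: z) - h eta|)%:E)%E.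
  rewrite (@fubini_tonelli _ _ _ _ _ m m
    (fun p : V * V => (pker p.2 * `|h (p.1 + e *: p.2) - h p.1|)%:E))//; last first.
    by move=> x; rewrite lee_fin mulr_ge0 ?pker_ge0.
  apply: eq_integral => z _; rewrite -ge0_integralZl//.
  by rewrite lee_fin pker_ge0.
have mF : measurable_fun setT (fun eta => \int[m]_z (pker z * `|h (eta + e *: z) - h eta|)%:E)%E.
  apply: (@measurable_fun_fubini_tonelli_F _ _ _ _ _ m
    (fun p : V * V => (pker p.2 * `|h (p.1 + e *: p.2) - h p.1|)%:E)) => //.
  by move=> x; rewrite lee_fin mulr_ge0 ?pker_ge0.
have F0 eta : (0 <= \int[m]_z (pker z * `|h (eta + e *: z) - h eta|)%:E)%E.
  by apply: integral_ge0 => z _; rewrite lee_fin mulr_ge0 ?pker_ge0.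
rewrite -ge0_integralZl//; apply: ge0_leint => //.
- by apply: measurable_absE; exact: L1_measurable LD.
- exact: emeasurable_funM.
move=> eta; rewrite normrM EFinM; apply: lee_pmul => //; first by rewrite lee_fin.
apply: (le_trans (Rintegral_norm_leE _ _)).
  by apply: measurable_funM; [apply: measurable_funB|exact: measurable_pker].
apply: ge0_leint => //.
- apply: measurable_absE.
  by apply: measurable_funM; [apply: measurable_funB|exact: measurable_pker].
- exact: (measurableT_comp mP (measurable_pair1 eta)).
- by move=> z; rewrite normrM [`|pker z|]ger0_norm ?pker_ge0// mulrC.
Qed.

(* Integrating the square against [lap (eps *: x)], whose transform is the
   approximate identity [pker], and letting [eps] tend to 0. *)
Lemma plancherel_cvg h (C : R) : L1 m h -> (forall x, `|h x| <= C) ->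
  \int[m]_x (hartley h x ^+ 2 * lap (eps_seq k *: x)) @[k --> \oo] -->
  \int[m]_z pker z * \int[m]_eta h eta ^+ 2.
Proof.
move=> Lh hC; have mh := L1_measurable Lh.
have C0 : 0 <= C by exact: le_trans (hC 0).
pose w k z := ((pker z)%:E * \int[m]_eta `|h (eta + eps_seq k *: z)%R - h eta|%:E)%E.
have mP k : measurable_fun [set: V * V]
    (fun p : V * V => `|h (p.1 + eps_seq k *: p.2) - h p.1|%:E).
  apply/measurable_EFinP; apply: measurableT_comp => //.
  apply: measurable_funB; last exact: (measurableT_comp mh measurable_fst).
  apply: (measurableT_comp mh); apply: measurable_rV => // i.
  under eq_fun do rewrite !mxE; apply: measurable_funD.
    exact: (measurableT_comp (measurable_coord i) measurable_fst).
  apply: measurable_funM => //.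
  exact: (measurableT_comp (measurable_coord i) measurable_snd).
have w0 : (\int[m]_z w k z @[k --> \oo] --> 0)%E.
  apply: (@dominated_cvge0 _ _ _ m _ (fun z => (pker z)%:E * (2%:E * \int[m]_eta `|h eta|%:E))%E).
  - move=> k; apply: emeasurable_funM; first by apply/measurable_EFinP; exact: measurable_pker.
    by apply: (@measurable_fun_fubini_tonelli_G _ _ _ _ _ m
      (fun p : V * V => `|h (p.1 + eps_seq k *: p.2) - h p.1|%:E)).
  - move=> k z; rewrite mule_ge0 ?lee_fin ?pker_ge0 ?integral_ge0//=.
    rewrite lee_wpmul2l ?lee_fin ?pker_ge0//.
    apply: (@le_integral_translation2 _ _ _ m (fun x => x + eps_seq k *: z)) => //.
      exact: measurable_shift.
    exact: integral_shift.
  (* For fixed [z] this is continuity of translations in [L^1]. *)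
  - apply: aeW => z; rewrite /w -(mule0 (pker z)%:E); apply: cvgeZl => //.
    apply: translation_cvg => // i; rewrite (_ : (fun k => _) = fun k => eps_seq k * z ord0 i).
      by rewrite -(mul0r (z ord0 i)); apply: cvgMl; exact: cvg_harmonic.
    by apply/funext => k; rewrite mxE.
  - have /L1P[_ ih] := Lh.
    have fin : (\int[m]_eta `|h eta|%:E)%E \is a fin_num.
      by rewrite ge0_fin_numE// integral_ge0.
    rewrite -(fineK fin) -EFinM.
    have := L1Z (2 * fine (\int[m]_eta `|h eta|%:E)%E) L1_pker.
    by rewrite /L1; congr integrable; apply/funext => z /=; rewrite mulrC EFinM.
apply/cvgrPdist_le => e e0.
have Cw : (C%:E * \int[m]_z w k z @[k --> \oo] --> 0)%E.
  by rewrite -(mule0 C%:E); apply: cvgeZl.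
have := cvge0_near_le e0 Cw; apply: filterS => k hk.
rewrite distrC -lee_fin (le_trans _ hk)//.
exact: plancherel_error (eps_gt0 k) Lh hC.
Qed.

Lemma hartley_bound h x : L1 m h -> `|hartley h x| <= 2 * fine (\int[m]_xi `|h xi|%:E)%E.
Proof.
move=> Lh; have mh := L1_measurable Lh.
apply: Rintegral_norm_le; last exact: L1_measurable (L1_cas x Lh).
rewrite EFinM fineK; last exact: (integrable_fin_num measurableT (L1_norm Lh)).
rewrite -ge0_integralZl//; last exact: measurable_absE.
apply: ge0_leint => //.
- by apply: measurable_absE; exact: L1_measurable (L1_cas x Lh).
- by apply: emeasurable_funM => //; exact: measurable_absE.
- by move=> xi; rewrite -EFinM lee_fin normrM mulrC ler_wpM2r// cas_le2.
Qed.

Lemma measurable_hartley h : L1 m h -> measurable_fun setT (hartley h).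
Proof.
move=> Lh; have mh := L1_measurable Lh.
apply: (@measurable_Rintegral_snd _ _ _ _ _ m (fun p : V * V => h p.1 * cas (dotRn p.2 p.1))).
apply: measurable_funM; first exact: (measurableT_comp mh measurable_fst).
apply: (measurableT_comp (continuous_measurable_fun continuous_cas)).
by under eq_fun do rewrite dotRnC; exact: measurable_dotRn2.
Qed.

Lemma lap_scaleE (e : R) x : 0 <= e -> lap (e *: x) = expR (- (e * \sum_i `|x ord0 i|)).
Proof.
move=> e0; rewrite mulr_sumr -sumrN expR_sum; apply: eq_bigr => i _.
by rewrite mxE normrM (ger0_norm e0).
Qed.

Let lapk h k x := hartley h x ^+ 2 * lap (eps_seq k *: x).

Let measurable_lapk h k : L1 m h -> measurable_fun setT (lapk h k).
Proof.
move=> Lh; apply: measurable_funM; first by apply: measurable_funX; exact: measurable_hartley.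
apply: (measurableT_comp measurable_lap).
by have := @measurable_affine R n (eps_seq k) 0; under eq_fun do rewrite addr0.
Qed.

Let lapk_ge0 h k x : 0 <= lapk h k x.
Proof. by rewrite mulr_ge0 ?sqr_ge0 ?lap_ge0. Qed.

Let L1_lapk h k : L1 m h -> L1 m (lapk h k).
Proof.
move=> Lh; rewrite /lapk; under eq_fun do rewrite mulrC.
apply: (L1M (C := (2 * fine (\int[m]_xi `|h xi|%:E)%E) ^+ 2)).
- have ne0 : eps_seq k != 0 by rewrite gt_eqF// eps_gt0.
  by have := L1_affine 0 ne0 L1_lap; under eq_fun do rewrite addr0.
- by apply: measurable_funX; exact: measurable_hartley.
- move=> x; rewrite normrX lerXn2r ?nnegrE ?hartley_bound//.
  by rewrite mulr_ge0// fine_ge0// integral_ge0.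
Qed.

(** From the function to its kernel: since [lap <= 1], a bound on the integral of the square passes
    to the limit. *)
Lemma plancherel_ge h (C S : R) : L1 m h -> (forall x, `|h x| <= C) ->
  (\int[m]_x (hartley h x ^+ 2)%:E <= S%:E)%E ->
  \int[m]_z pker z * \int[m]_eta h eta ^+ 2 <= S.
Proof.
move=> Lh hC hS; have mH := measurable_hartley Lh.
apply: (ler_cvg_to (plancherel_cvg Lh hC) (cvg_cst S)).
apply: nearW => k; rewrite -lee_fin -[leLHS]/(_%:E) /Rintegral fineK; last first.
  exact: (integrable_fin_num measurableT (L1_lapk k Lh)).
apply: (le_trans _ hS); apply: ge0_leint => //.
- by move=> x; rewrite lee_fin; exact: lapk_ge0.
- by apply/measurable_EFinP; exact: measurable_lapk.
- by apply/measurable_EFinP; exact: measurable_funX.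
- by move=> x; rewrite lee_fin ler_piMr ?sqr_ge0// lap_le1.
Qed.

(** From the kernel to the function: [lap (eps *: x)] increases to 1 as [eps] decreases, so monotone
    convergence yields square integrability rather than presupposing it. *)
Lemma plancherel_le h (C : R) : L1 m h -> (forall x, `|h x| <= C) ->
  (\int[m]_x (hartley h x ^+ 2)%:E <=
   (\int[m]_z pker z * \int[m]_eta h eta ^+ 2)%:E)%E.
Proof.
move=> Lh hC; have mH := measurable_hartley Lh.
have h1 : (\int[m]_x (lapk h k x)%:E @[k --> \oo] -->
    \int[m]_x limn (fun k => (lapk h k x)%:E))%E.
  apply: cvg_monotone_convergence => //.
  - by move=> k; apply/measurable_EFinP; exact: measurable_lapk.
  - by move=> k x _; rewrite lee_fin; exact: lapk_ge0.
  - move=> x _ a b ab; rewrite lee_fin ler_wpM2l ?sqr_ge0//.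
    rewrite !lap_scaleE ?(ltW (eps_gt0 _))// ler_expR lerN2.
    rewrite ler_wpM2r ?sumr_ge0// /eps_seq lef_pV2 ?posrE// ler_nat ltnS.
    exact: ab.
have h2 : (\int[m]_x (lapk h k x)%:E @[k --> \oo] -->
    (\int[m]_z pker z * \int[m]_eta h eta ^+ 2)%:E)%E.
  apply: cvg_EFin; last exact: (plancherel_cvg Lh hC).
  apply: nearW => k; exact: (integrable_fin_num measurableT (L1_lapk k Lh)).
rewrite -(cvg_unique _ h1 h2)//.
rewrite le_eqVlt; apply/orP; left; apply/eqP; apply: eq_integral => x _.
apply/esym/cvg_lim => //; apply: cvg_EFin; first exact: nearW.
rewrite -[X in _ --> X]mulr1; apply: cvgMr.
rewrite (_ : (fun k => lap _) = fun k => expR (- (eps_seq k * \sum_i `|x ord0 i|))); last first.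
  by apply/funext => k; rewrite lap_scaleE// ltW ?eps_gt0.
set S := \sum_i _; have e0 : - (eps_seq k * S) @[k --> \oo] --> 0.
  rewrite -oppr0 -(mul0r S); apply: cvgN.
  by apply: cvgMl; exact: cvg_harmonic.
rewrite -expR0; apply: continuous_cvg => //; exact: continuous_expR.
Qed.

End plancherel.

(** * Band-limited functions and truncation *)

Section band_limited.
Context {R : realType} {n : nat}.
Local Notation V := ('rV[R]_n).
Local Notation m := (@mu R n).
Implicit Types (u v g h : V -> R) (x xi eta : V).

(** Each factor [1 + |xi_i|] is at most [2 <xi>]; distributing the exponent equally over the [n]
    coordinates reduces integrability to dimension one, where [a / n > 1] is the condition. *)
Lemma jbracket_powR_le (a : R) xi : (0 < n)%N -> 0 <= a ->
  jbracket xi `^ (- a) <= 2 `^ a * tens (decay (a / n%:R)) xi.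
Proof.
move=> n0 a0; have nR : 0 < n%:R :> R by rewrite ltr0n.
have j0 := jbracket_gt0 xi; have b0 : 0 <= a / n%:R by rewrite divr_ge0// ltW.
have P0 : 0 < \prod_(i < n) (1 + `|xi ord0 i|) `^ (a / n%:R).
  by apply: prodr_gt0 => i _; rewrite powR_gt0// ltr_pwDl.
have -> : tens (decay (a / n%:R)) xi = (\prod_(i < n) (1 + `|xi ord0 i|) `^ (a / n%:R))^-1.
  by rewrite -prodfV; apply: eq_bigr => i _; rewrite /decay powRN.
rewrite powRN ler_pdivlMr// mulrC ler_pdivrMr ?powR_gt0// -powRM ?(ltW j0)//.
apply: (@le_trans _ _ (\prod_(i < n) (2 * jbracket xi) `^ (a / n%:R))).
  apply: ler_prod => i _; rewrite powR_ge0/=.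
  apply: ge0_ler_powR; rewrite ?nnegrE ?mulr_ge0 ?(ltW j0) ?addr_ge0//.
  by rewrite mulr_natl mulr2n lerD ?jbracket_ge1 ?coord_le_jbracket.
rewrite prodr_const card_ord -powR_mulrn ?powR_ge0// -powRrM divfK ?gt_eqF//.
Qed.

Lemma L1_jbracket_powR (a : R) : (0 < n)%N -> n%:R < a ->
  L1 m (fun xi => jbracket xi `^ (- a)).
Proof.
move=> n0 na; have nR : 0 < n%:R :> R by rewrite ltr0n.
have a0 : 0 <= a by rewrite (le_trans _ (ltW na)).
apply: (@le_L1 _ _ _ m _ (fun xi => 2 `^ a * tens (decay (a / n%:R)) xi)).
- exact: (measurable_wt (- a)).
- move=> xi; rewrite !ger0_norm ?powR_ge0//; first exact: jbracket_powR_le.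
  by rewrite mulr_ge0 ?powR_ge0// tens_ge0// => t; exact: decay_ge0.
apply: L1Z; apply: L1_tens; first by move=> t; exact: decay_ge0.
apply/L1P; split; first exact: measurable_decay.
under eq_integral do rewrite ger0_norm ?decay_ge0//.
by rewrite integral_decay ?ltry// ltr_pdivlMr// mul1r.
Qed.

(** The bound on the kernel is part of the notion because the Plancherel lemmas require it; it
    survives products because one factor of a convolution is integrable. *)
Definition band_limited (L : R) u := exists h (C : R),
  [/\ L1 m h, (forall xi, `|h xi| <= C), (forall xi, L < `|xi| -> h xi = 0) &
      (forall x, u x = hartley h x)].

Lemma eq_band_limited L u v : u =1 v -> band_limited L u -> band_limited L v.
Proof. by move=> /funext ->. Qed.

Lemma band_limited_le L L' u : L <= L' -> band_limited L u -> band_limited L' u.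
Proof.
move=> LL [h [C [Lh hC hL uh]]]; exists h, C; split=> // xi xiL.
by apply: hL; exact: le_lt_trans xiL.
Qed.

Lemma band_limitedZ L k u : band_limited L u -> band_limited L (fun x => k * u x).
Proof.
move=> [h [C [Lh hC hL uh]]]; exists (fun xi => k * h xi), (`|k| * C); split.
- exact: L1Z.
- by move=> xi; rewrite normrM ler_wpM2l.
- by move=> xi /hL ->; rewrite mulr0.
- by move=> x; rewrite hartleyZ// uh.
Qed.

Lemma band_limitedD L u v : band_limited L u -> band_limited L v ->
  band_limited L (fun x => u x + v x).
Proof.
move=> [g [C [Lg gC gL ug]]] [h [D [Lh hD hL vh]]].
exists (fun xi => g xi + h xi), (C + D); split.
- exact: L1D.
- by move=> xi; rewrite (le_trans (ler_normD _ _))// lerD.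
- by move=> xi xiL; rewrite gL// hL// addr0.
- by move=> x; rewrite hartleyD// ug vh.
Qed.

Lemma band_limited0 L : band_limited L (fun=> 0).
Proof.
exists (fun=> 0), 0; split=> //; first exact: integrable0.
  by move=> xi; rewrite normr0.
by move=> x; rewrite /hartley; under eq_Rintegral do rewrite mul0r; rewrite /Rintegral integral0.
Qed.

Lemma band_limited_sum L (I : Type) (r : seq I) (F : I -> V -> R) :
  (forall i, band_limited L (F i)) -> band_limited L (fun x => \sum_(i <- r) F i x).
Proof.
move=> FL; elim: r => [|i r ih].
  by apply: eq_band_limited (band_limited0 L) => x; rewrite big_nil.
apply: eq_band_limited (band_limitedD (FL i) ih) => x.
by rewrite big_cons.
Qed.

Let conv_support L L' g h xi : (forall xi, L < `|xi| -> g xi = 0) ->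
  (forall xi, L' < `|xi| -> h xi = 0) -> L + L' < `|xi| -> conv g h xi = 0.
Proof.
move=> gL hL xiL; rewrite /conv; transitivity (\int[m]_eta (0 : R)); last by rewrite /Rintegral integral0.
apply: eq_Rintegral => eta _; have [/hL ->|eL] := ltP L' `|eta|; first by rewrite mulr0.
rewrite gL ?mul0r//; have := ler_normD (xi - eta) eta; rewrite subrK; lra.
Qed.

Let conv_bound C g h xi : measurable_fun setT g -> (forall xi, `|g xi| <= C) -> L1 m h ->
  `|conv g h xi| <= C * fine (\int[m]_xi `|h xi|%:E)%E.
Proof.
move=> mg gC Lh; have mh := L1_measurable Lh.
have C0 : 0 <= C by exact: le_trans (gC 0).
have mc := measurable_conv_integrand xi mg mh.
apply: Rintegral_norm_le => //.
rewrite EFinM fineK; last exact: (integrable_fin_num measurableT (L1_norm Lh)).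
rewrite -ge0_integralZl//; last exact: measurable_absE.
apply: ge0_leint => //.
- exact: measurable_absE.
- by apply: emeasurable_funM => //; exact: measurable_absE.
- by move=> eta; rewrite -EFinM lee_fin normrM ler_wpM2r.
Qed.

Lemma band_limitedM L L' u v : band_limited L u -> band_limited L' v ->
  band_limited (L + L') (fun x => u x * v x).
Proof.
move=> [g [C [Lg gC gL ug]]] [h [D [Lh hD hL vh]]].
have Lr := L1_reflect Lg; have [Le Lo] := (L1_evenpart Lh, L1_oddpart Lh).
have [mg mr] := (L1_measurable Lg, L1_measurable Lr).
have rL xi : L < `|xi| -> reflect g xi = 0 by rewrite -normrN => /gL.
have eL xi : L' < `|xi| -> evenpart h xi = 0.
  by move=> xiL; rewrite /evenpart !hL ?normrN// addr0 mul0r.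
have oL xi : L' < `|xi| -> oddpart h xi = 0.
  by move=> xiL; rewrite /oddpart !hL ?normrN// subr0 mul0r.
exists (hprod g h), (C * fine (\int[m]_xi `|evenpart h xi|%:E)%E +
  C * fine (\int[m]_xi `|oddpart h xi|%:E)%E); split.
- exact: L1_hprod.
- move=> xi; rewrite (le_trans (ler_normD _ _))// lerD//.
    exact: conv_bound.
  by apply: conv_bound => // z; exact: gC.
- move=> xi xiL; rewrite /hprod (conv_support gL eL)// (conv_support rL oL)// addr0//.
- by move=> x; rewrite hartleyM// ug vh.
Qed.

(* By AM-GM, [<xi>^s |h| <= <xi>^-a + <xi>^(2 s + a) h^2]; the second term is
   controlled by Plancherel on the support of [h]. *)
Lemma band_limited_repW (s a L S : R) u : (0 < n)%N -> 0 <= s -> n%:R < a -> 0 <= L ->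
  band_limited L u -> (\int[m]_x (u x ^+ 2)%:E <= S%:E)%E ->
  repW s u (\int[m]_xi jbracket xi `^ (- a) +
    (n.+1%:R * (1 + L)) `^ (2 * s + a) * (S / \int[m]_z pker z)).
Proof.
move=> n0 s0 na L0 [h [C [Lh hC hL uh]]] uS; exists h; split=> //.
have mh := L1_measurable Lh.
have a0 : 0 <= a by rewrite (le_trans _ (ltW na)).
have LJ := L1_jbracket_powR n0 na.
set M := _ `^ (2 * s + a).
have hS : \int[m]_xi h xi ^+ 2 <= S / \int[m]_z pker z.
  rewrite ler_pdivlMr ?Rintegral_pker_gt0// mulrC.
  apply: (plancherel_ge Lh hC); apply: le_trans uS.
  by under eq_integral do rewrite -uh.
have L2 := L1_sqr Lh hC.
apply: (@le_trans _ _ (\int[m]_xi (jbracket xi `^ (- a) + M * h xi ^+ 2)%:E)%E).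
  apply: ge0_leint.
  - by move=> xi; rewrite lee_fin mulr_ge0// wt_ge0.
  - exact: measurable_wtabs.
  - by apply/measurable_EFinP; exact: L1_measurable (L1D LJ (L1Z M L2)).
  move=> xi; rewrite lee_fin; have j0 := jbracket_gt0 xi.
  have [xiL|xiL] := ltP L `|xi|.
    by rewrite hL// normr0 mulr0 expr0n mulr0 addr0 powR_ge0.
  have -> : wt s xi * `|h xi| = jbracket xi `^ (- (a / 2)) * (jbracket xi `^ (s + a / 2) * `|h xi|).
    rewrite mulrA -powRD; last by rewrite (gt_eqF j0) implybT.
    by rewrite addrC addrK.
  set X := _ `^ _; set Y := _ * `|h xi|.
  apply: (@le_trans _ _ (X ^+ 2 + Y ^+ 2)); first by have := sqr_ge0 (X - Y); nra.
  apply: lerD.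
    by rewrite /X -powR_mulrn ?powR_ge0// -powRrM mulNr divfK.
  rewrite /Y exprMn real_normK ?num_real// ler_wpM2r ?sqr_ge0//.
  rewrite -powR_mulrn ?powR_ge0// -powRrM mulrDl divfK// [s * 2]mulrC.
  apply: ge0_ler_powR; rewrite ?nnegrE ?(ltW j0) ?mulr_ge0 ?addr_ge0 ?mulr_ge0//.
  by rewrite (le_trans (jbracket_le xi))// ler_wpM2l// lerD2l.
have LM := L1Z M L2; have LJM := L1D LJ LM.
rewrite -(fineK (integrable_fin_num measurableT LJM)) lee_fin.
rewrite -/(Rintegral _ _ (fun xi => jbracket xi `^ (- a) + M * h xi ^+ 2)).
by rewrite RintegralD// lerD2l RintegralZl// ler_wpM2l ?powR_ge0.
Qed.

(** Compare [B] with [A ^ (q - 1)], the case of equality in the sharp inequality. *)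
Lemma young_conj (q A B : R) : 1 < q -> 0 <= A -> 0 <= B ->
  A * B <= A `^ q + B `^ (conj_exp q).
Proof.
move=> q1 A0 B0; have q1' : 0 < q - 1 by rewrite subr_gt0.
have q0 : 0 < q by lra.
have [BA|AB] := leP B (A `^ (q - 1)).
  apply: (@le_trans _ _ (A * A `^ (q - 1))); first exact: ler_wpM2l.
  by rewrite mulr_powRB1// lerDl powR_ge0.
apply: (@le_trans _ _ (B `^ ((q - 1)^-1) * B)).
  apply: ler_wpM2r => //.
  have -> : A = (A `^ (q - 1)) `^ ((q - 1)^-1).
    by rewrite -powRrM mulfV ?gt_eqF// powRr1.
  by apply: ge0_ler_powR; rewrite ?nnegrE ?powR_ge0 ?invr_ge0 ?(ltW AB) ?(ltW q1').
have Bp : 0 < B by exact: le_lt_trans (powR_ge0 _ _) AB.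
rewrite -{2}(powRr1 B0) -powRD ?(gt_eqF Bp) ?implybT//.
rewrite (_ : (q - 1)^-1 + 1 = conj_exp q) ?lerDr ?powR_ge0//.
by rewrite /conj_exp; field; lra.
Qed.

Lemma conj_exp_gt0 (q : R) : 1 < q -> 0 < conj_exp q.
Proof. by move=> q1; rewrite divr_gt0// ?subr_gt0// (lt_trans _ q1). Qed.

(* With [s - sg > n / q'], Young's inequality bounds [<xi>^sg |h|] by an
   integrable function, which gives the decay where [<xi> > N]. *)
Lemma truncation (q s : R) h : (0 < n)%N -> 1 < q -> n%:R / conj_exp q < s ->
  L1 m h -> (qnorm q s h < +oo)%E ->
  exists2 tau : R, 0 < tau & exists C : R, forall N : R, 1 <= N ->
  exists hN : V -> R, [/\ measurable_fun setT hN,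
    (forall xi, `|hN xi| <= N), (forall xi, N < `|xi| -> hN xi = 0),
    (forall xi, hN xi = h xi \/ hN xi = 0) &
    (\int[m]_xi `|(h xi - hN xi)%R|%:E <= (C * N `^ (- tau))%:E)%E].
Proof.
move=> n0 q1 hs Lh hq; have mh := L1_measurable Lh.
have q'0 := conj_exp_gt0 q1; have q1' : 0 < q - 1 by rewrite subr_gt0.
have s0 : 0 <= s by rewrite ltW// (le_lt_trans _ hs)// divr_ge0// ltW.
(* Half of the margin is spent on the decay in [N]; the other half keeps [b > n]. *)
pose sg := (s - n%:R / conj_exp q) / 2.
have sg0 : 0 < sg by rewrite divr_gt0// subr_gt0.
pose tau := Num.min sg (q - 1).
have tau0 : 0 < tau by rewrite lt_min sg0.
pose b := (s - sg) * conj_exp q.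
have nb : n%:R < b by rewrite /b /sg -ltr_pdivrMr//; lra.
pose G xi := (wt s xi * `|h xi|) `^ q + jbracket xi `^ (- b).
have LG : L1 m G.
  apply: L1D; last exact: L1_jbracket_powR.
  apply/L1P; split; first by apply/measurable_EFinP; exact: measurable_qnorm.
  by under eq_integral do rewrite ger0_norm ?powR_ge0//.
exists tau => //; exists (\int[m]_xi G xi) => N N1.
(* The cut is in height as well as in frequency, because Plancherel needs a bounded kernel. Where
   [|h| > N] the loss is controlled by [N ^ -(q - 1)], whence the second entry of [tau]. *)
pose D := [set xi : V | jbracket xi <= N /\ `|h xi| <= N].
have mD : measurable D.
  rewrite (_ : D = (@jbracket R n) @^-1` `]-oo, N] `&` (fun xi => `|h xi|) @^-1` `]-oo, N]); last first.
    by apply/seteqP; split=> xi; rewrite /D/= !in_itv/=.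
  apply: measurableI; rewrite -[X in measurable X]setTI.
    exact: measurable_jbracket.
  have mn : measurable_fun setT (fun xi => `|h xi|) by exact: measurableT_comp.
  exact: (mn measurableT _ (measurable_itv _)).
exists (fun xi => h xi * \1_D xi); split.
- by apply: measurable_funM => //; exact: measurable_indic.
- move=> xi; rewrite indicE; case: (boolP (xi \in D)) => [|_]; last first.
    by rewrite mulr0 normr0 (le_trans ler01).
  by rewrite inE mulr1 => -[].
- move=> xi xiN; rewrite indicE memNset ?mulr0// => -[jN _].
  by have := le_trans (norm_le_jbracket xi) jN; rewrite leNgt xiN.
- by move=> xi; rewrite indicE; case: (_ \in D); rewrite ?mulr1 ?mulr0; [left|right].
have N0 : 0 < N by exact: lt_le_trans N1.
rewrite mulrC EFinM [\int[m]_xi G xi](_ : _ = fine (\int[m]_xi (G xi)%:E)%E)//.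
rewrite fineK; last exact: (integrable_fin_num measurableT LG).
have G0 xi : 0 <= G xi by rewrite addr_ge0 ?powR_ge0.
rewrite -ge0_integralZl//; last 3 first.
- by apply/measurable_EFinP; exact: L1_measurable LG.
- by move=> xi _; rewrite lee_fin.
- by rewrite lee_fin powR_ge0.
apply: ge0_leint => //.
- apply: measurable_absE; apply: measurable_funB => //.
  by apply: measurable_funM => //; exact: measurable_indic.
- by apply: emeasurable_funM => //; apply/measurable_EFinP; exact: L1_measurable LG.
move=> xi; rewrite -EFinM lee_fin indicE.
case: (boolP (xi \in D)) => [_|]; first by rewrite mulr1 subrr normr0 mulr_ge0 ?powR_ge0.
rewrite notin_setE mulr0 subr0 => xiD; have j0 := jbracket_gt0 xi.
have Nt t : tau <= t -> N `^ (- t) <= N `^ (- tau) by move=> ?; rewrite ler_powR// lerN2.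
have [jN|jN] := ltP N (jbracket xi).
  apply: (@le_trans _ _ (N `^ (- sg) * G xi)); last first.
    by rewrite ler_wpM2r// Nt// ge_min lexx.
  rewrite powRN mulrC ler_pdivlMr ?powR_gt0//.
  apply: (@le_trans _ _ ((wt s xi * `|h xi|) * jbracket xi `^ (- (s - sg)))).
    rewrite /wt mulrAC -powRD ?(gt_eqF j0) ?implybT// opprB addrCA subrr addr0.
    rewrite mulrC ler_wpM2r//; apply: ge0_ler_powR; rewrite ?nnegrE ?(ltW sg0) ?(ltW j0) ?(ltW N0)//.
    exact: ltW.
  have w0 : 0 <= wt s xi * `|h xi| by rewrite mulr_ge0 ?wt_ge0.
  apply: le_trans (young_conj q1 w0 (powR_ge0 _ _)) _.
  by rewrite -powRrM mulNr.
have hN : N < `|h xi| by rewrite ltNge; apply/negP => hN; apply: xiD.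
apply: (@le_trans _ _ (N `^ (- (q - 1)) * G xi)); last first.
  by rewrite ler_wpM2r// Nt// ge_min lexx orbT.
rewrite powRN mulrC ler_pdivlMr ?powR_gt0//.
have h0 : 0 < `|h xi| by exact: lt_trans hN.
apply: (@le_trans _ _ (`|h xi| * `|h xi| `^ (q - 1))).
  rewrite ler_wpM2l//; apply: ge0_ler_powR; rewrite ?nnegrE ?(ltW q1') ?(ltW N0)//.
  exact: ltW.
rewrite mulr_powRB1//; last by lra.
apply: (@le_trans _ _ ((wt s xi * `|h xi|) `^ q)); last by rewrite lerDl powR_ge0.
apply: ge0_ler_powR; rewrite ?nnegrE ?mulr_ge0 ?wt_ge0//; first by lra.
by rewrite ler_peMl// wt_ge1.
Qed.

End band_limited.

(** * Range of a Hartley transform *)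

Section hartley_at_infinity.
Context {R : realType} {n : nat}.
Local Notation V := ('rV[R]_n).
Local Notation m := (@mu R n).
Implicit Types (h : V -> R) (x xi : V).

Lemma hartley_near h x (e : R) : L1 m h -> 0 < e ->
  exists2 d, 0 < d & forall x', `|x' - x| < d -> `|hartley h x' - hartley h x| <= e.
Proof.
move=> Lh e0; have mh := L1_measurable Lh.
apply: contrapT => /forall2NP H.
have /choice[y hy] : forall k : nat, exists y : V, `|y - x| < k.+1%:R^-1 /\
    ~ `|hartley h y - hartley h x| <= e.
  move=> k; have [|] := H k.+1%:R^-1; first by rewrite invr_gt0 ltr0Sn.
  by move=> /existsNP[y /not_implyP[y1 y2]]; exists y.
have yx i : y k ord0 i @[k --> \oo] --> x ord0 i.
  apply/cvgrPdist_le => d d0; have := @cvg_harmonic R.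
  move=> /cvgrPdist_le/(_ d d0); apply: filterS => k.
  rewrite sub0r normrN ger0_norm ?invr_ge0// => kd.
  rewrite distrC; have := rV_coord_le (y k - x) i; rewrite !mxE => /le_trans; apply.
  exact: le_trans (ltW (hy k).1) kd.
have dotc xi : dotRn (y k) xi @[k --> \oo] --> dotRn x xi.
  rewrite /dotRn; elim: (index_enum _) => [|i r ih].
    by rewrite big_nil; under eq_fun do rewrite big_nil; exact: cvg_cst.
  rewrite big_cons; under eq_fun do rewrite big_cons.
  by apply: cvgD ih; apply: cvgMl; exact: yx.
pose w k xi := (`|h xi| * `|cas (dotRn (y k) xi) - cas (dotRn x xi)|)%:E.
have mw k : measurable_fun [set: V] (fun xi => h xi * (cas (dotRn (y k) xi) - cas (dotRn x xi))).
  apply: measurable_funM => //; apply: measurable_funB;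
    by apply: measurable_comp_dotRn; exact: continuous_cas.
have w0 : (\int[m]_xi w k xi @[k --> \oo] --> 0)%E.
  apply: (@dominated_cvge0 _ _ _ m _ (fun xi => (4 * `|h xi|)%:E)).
  - move=> k; rewrite /w; under eq_fun do rewrite -normrM.
    exact: measurable_absE.
  - move=> k xi; rewrite !lee_fin mulr_ge0//= mulrC ler_wpM2r//.
    rewrite (le_trans (ler_normB _ _))// (_ : 4 = 2 + 2); last by ring.
    by rewrite lerD ?cas_le2.
  - apply: aeW => xi; apply: cvg_EFin; first exact: nearW.
    rewrite -(mulr0 `|h xi|); apply: cvgMr.
    rewrite -(normr0 R); apply: cvg_norm; rewrite -(subrr (cas (dotRn x xi))).
    apply: cvgB; last exact: cvg_cst.
    by apply: continuous_cvg; [exact: continuous_cas|exact: dotc].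
  - exact: L1Z (L1_norm Lh).
have := cvge0_near_le e0 w0 => -[k0 _ /(_ k0 (leqnn _))]; apply/negP.
rewrite -ltNge; apply: (@lt_le_trans _ _ `|hartley h (y k0) - hartley h x|%:E).
  by rewrite lte_fin ltNge; apply/negP; exact: (hy k0).2.
rewrite -RintegralB//; [|exact: L1_cas|exact: L1_cas].
apply: (le_trans (Rintegral_norm_leE _ _)).
  by apply: L1_measurable; apply: L1B; exact: L1_cas.
rewrite le_eqVlt; apply/orP; left; apply/eqP; apply: eq_integral => xi _.
by rewrite -mulrBr normrM.
Qed.

Lemma continuous_hartley h : L1 m h -> continuous (hartley h).
Proof.
move=> Lh x; apply/(@cvgrPdist_le _ _ _ (nbhs x) _ (hartley h) (hartley h x)) => e e0.
have [d d0 hd] := hartley_near x Lh e0.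
apply/nbhs_ballP; exists d => //= y; rewrite mx_norm_ball /ball_/= => xy.
by rewrite distrC; apply: hd; rewrite distrC.
Qed.

(* [cas] changes sign under the translation by [pi]. *)
Lemma hartley_half h x a : L1 m h -> dotRn x a = pi ->
  2 * hartley h x = \int[m]_xi ((h xi - h (xi + a)) * cas (dotRn x xi)).
Proof.
move=> Lh xa.
have Lha : L1 m (fun xi => h (xi + a)).
  by have := L1_affine a (oner_neq0 R) Lh; under eq_fun do rewrite scale1r.
have H : hartley h x = - \int[m]_xi (h (xi + a) * cas (dotRn x xi)).
  rewrite -mulN1r -RintegralZl//; last exact: L1_cas.
  rewrite -(Rintegral_reindex (measurable_shift (- a)) (integral_shift (- a))); last first.
    by apply: L1_measurable; apply: L1Z; exact: L1_cas.
  apply: eq_Rintegral => xi _; rewrite subrK dotRnDr dotRnNr xa.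
  by rewrite mulN1r -mulrN -cas_pi subrK.
transitivity (hartley h x + hartley h x); first by ring.
rewrite {2}H -RintegralB//; [|exact: L1_cas|exact: L1_cas].
by apply: eq_Rintegral => xi _; rewrite mulrBl.
Qed.

Lemma sum_sqr_ge (x : V) i : x ord0 i ^+ 2 <= \sum_j x ord0 j ^+ 2.
Proof. by rewrite (bigD1 i)//= lerDl sumr_ge0// => j _; exact: sqr_ge0. Qed.

(** Otherwise there are points [y k] tending to infinity with large transforms. The vector [a k],
    equal to [pi * y k] divided by the square of the Euclidean norm, has inner product [pi] with
    [y k] and tends to 0, so [hartley_half] contradicts continuity of translations. *)
Lemma riemann_lebesgue h (e : R) : L1 m h -> 0 < e ->
  exists M : R, forall x, M < `|x| -> `|hartley h x| <= e.
Proof.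
move=> Lh e0; apply: contrapT => /forallNP H.
have /choice[y hy] : forall k : nat, exists y : V, k.+1%:R < `|y| /\ ~ `|hartley h y| <= e.
  by move=> k; have /existsNP[y /not_implyP[y1 y2]] := H k.+1%:R; exists y.
pose S k := \sum_j y k ord0 j ^+ 2.
have Sk k : `|y k| ^+ 2 <= S k.
  have S0 : 0 <= S k by apply: sumr_ge0 => j _; exact: sqr_ge0.
  rewrite -[leRHS]sqr_sqrtr// lerXn2r ?nnegrE ?sqrtr_ge0//.
  rewrite [`|y k|]mx_normrE; apply: bigmax_le; first exact: sqrtr_ge0.
  move=> [i j] _ /=; rewrite ord1 -sqrtr_sqr ler_wsqrtr//.
  exact: sum_sqr_ge.
have y0 k : 0 < `|y k| by apply: le_lt_trans (hy k).1.
have S0 k : 0 < S k by apply: lt_le_trans (Sk k); rewrite exprn_gt0.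
pose a k := (pi / S k) *: y k.
have xa k : dotRn (y k) (a k) = pi.
  rewrite /a /dotRn; under eq_bigr do rewrite mxE mulrCA -expr2.
  by rewrite -mulr_sumr -/(S k) divfK// gt_eqF.
have a0 i : a k ord0 i @[k --> \oo] --> 0.
  apply/cvgrPdist_le => d d0; have dp : 0 < d / pi by rewrite divr_gt0// pi_gt0.
  have := @cvg_harmonic R => /cvgrPdist_le/(_ _ dp); apply: filterS => k.
  rewrite !sub0r !normrN ger0_norm ?invr_ge0// ler_pdivlMr ?pi_gt0// => kd.
  apply: le_trans kd; rewrite mxE normrM normrM (ger0_norm (pi_ge0 R)).
  rewrite [in leRHS]mulrC -mulrA ler_wpM2l ?pi_ge0//.
  rewrite gtr0_norm ?invr_gt0// mulrC ler_pdivrMr//.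
  rewrite mulrC ler_pdivlMr ?ltr0Sn//.
  apply: le_trans (Sk k); rewrite expr2; apply: ler_pM => //.
    exact: rV_coord_le.
  exact: ltW (hy k).1.
have := translation_cvg Lh a0 => /(cvge0_near_le e0)[k0 _ /(_ k0 (leqnn _))]; apply/negP.
rewrite -ltNge; apply: (@lt_le_trans _ _ `|hartley h (y k0)|%:E).
  by rewrite lte_fin ltNge; apply/negP; exact: (hy k0).2.
have Lha : L1 m (fun xi => h (xi + a k0)).
  by have := L1_affine (a k0) (oner_neq0 R) Lh; under eq_fun do rewrite scale1r.
have Ld := L1B Lh Lha.
have Lba := L1_norm (L1B Lha Lh); have [mba _] := integrableP _ _ _ Lba.
have fin := integrable_fin_num measurableT Lba.
rewrite -(fineK fin) lee_fin -(ler_pM2l (ltr0Sn R 1)).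
rewrite -[leLHS](_ : `|2 * hartley h (y k0)| = _); last by rewrite normrM ger0_norm.
rewrite (hartley_half Lh (xa k0)); apply: Rintegral_norm_le; last first.
  exact: L1_measurable (L1_cas _ Ld).
rewrite EFinM fineK// -ge0_integralZl//; last by move=> xi _; rewrite lee_fin.
apply: ge0_leint => //.
- by apply: measurable_absE; exact: L1_measurable (L1_cas _ Ld).
- by apply: emeasurable_funM.
- by move=> xi; rewrite -EFinM lee_fin normrM mulrC distrC ler_wpM2r// cas_le2.
Qed.

Lemma rV_far (M : R) : (0 < n)%N -> exists z : V, M < `|z|.
Proof.
case: n => // k _; exists (const_mx (`|M| + 1)).
apply: lt_le_trans (rV_coord_le _ ord0); rewrite mxE.
by rewrite [ltRHS]ger0_norm ?addr_ge0//; apply: le_lt_trans (ler_norm M) _; rewrite ltrDl.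
Qed.

(** Intermediate values on the segment from [x] to a point [z] so remote that the transform there is
    smaller than [|v|]. The value 0 is excluded because it may be only a limit at infinity. *)
Lemma hartley_between h x (v : R) : (0 < n)%N -> L1 m h -> v != 0 ->
  (0 <= v <= hartley h x) || (hartley h x <= v <= 0) -> exists y, hartley h y = v.
Proof.
move=> n0 Lh v0 hv.
have v2 : 0 < `|v| / 2 by rewrite divr_gt0// normr_gt0.
have [M hM] := riemann_lebesgue Lh v2.
have [z /hM hz] := rV_far M n0.
have hz' : `|hartley h z| < `|v| by rewrite (le_lt_trans hz)// ltr_pdivrMr// ltr_pMr ?normr_gt0// ltr1n.
pose g (t : R) := hartley h (x + t *: (z - x)).
have cg : continuous g.
  move=> t; apply: (@continuous_comp R V R (fun t => x + t *: (z - x)) (hartley h) t);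
    last exact: (continuous_hartley Lh).
  apply: cvgD; first exact: cvg_cst.
  by apply: cvgZr_tmp; exact: cvg_id.
have g0 : g 0 = hartley h x by rewrite /g scale0r addr0.
have g1 : g 1 = hartley h z by rewrite /g scale1r addrC subrK.
have [t _ gt] : exists2 t, t \in `[0, 1] & g t = v.
  apply: (@IVT _ _ _ _ _ ler01); first exact: continuous_subspaceT.
  rewrite g0 g1; move: hz' hv; have [vp|vn] := leP 0 v.
    rewrite (ger0_norm vp) ltr_norml => /andP[z1 z2] /orP[|] /andP[h1 h2].
      by rewrite ge_min (ltW z2) orbT/= le_max h2.
    by move: v0; rewrite eq_le h2 vp.
  rewrite (ltr0_norm vn) ltr_norml opprK => /andP[z1 z2] /orP[|] /andP[h1 h2].
    by [].
  by rewrite ge_min h1/= le_max (ltW z1) orbT.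
by exists (x + t *: (z - x)).
Qed.

Lemma hartley_max h : L1 m h -> (exists x, 0 < hartley h x) ->
  exists x, forall y, hartley h y <= hartley h x.
Proof.
move=> Lh [x0 hx0].
have h2 : 0 < hartley h x0 / 2 by rewrite divr_gt0.
have [M hM] := riemann_lebesgue Lh h2.
pose A := [set x : V | `|x| <= Num.max M `|x0|].
have cA : compact A.
  apply: bounded_closed_compact.
    exists (Num.max M `|x0|); split; first exact: num_real.
    by move=> N MN x /le_trans; apply; exact: ltW.
  by apply: (closed_comp (f := fun x : V => `|x|)) (@closed_le _ _); move=> x _; exact: norm_continuous.
have A0 : A !=set0 by exists x0; rewrite /A/= le_max lexx orbT.
have [c Ac hc] := EVT_max_rV A0 cA (continuous_subspaceT (continuous_hartley Lh)).
exists c => y; have [yA|yA] := leP `|y| (Num.max M `|x0|); first by apply: hc; rewrite inE.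
have My : M < `|y| by apply: le_lt_trans yA; rewrite le_max lexx.
have x0c : hartley h x0 <= hartley h c by apply: hc; rewrite inE /A/= le_max lexx orbT.
have := le_trans (ler_norm _) (hM y My); lra.
Qed.

(** The maximum of the range together with 0: a positive supremum is attained because the transform
    vanishes at infinity. *)
Lemma hartley_top h : L1 m h -> exists b : R,
  [/\ 0 <= b, forall x, hartley h x <= b & b = 0 \/ exists x, hartley h x = b].
Proof.
move=> Lh; have [hp|hn] := pselect (exists x, 0 < hartley h x).
  have [x0 x0p] := hp; have [x hx] := hartley_max Lh hp.
  exists (hartley h x); split=> //; last by right; exists x.
  exact: ltW (lt_le_trans x0p (hx x0)).
exists 0; split=> // [x|]; last by left.
by rewrite leNgt; apply/negP => xp; apply: hn; exists x.
Qed.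

Lemma hartley_bottom h : L1 m h -> exists a : R,
  [/\ a <= 0, forall x, a <= hartley h x & a = 0 \/ exists x, hartley h x = a].
Proof.
move=> Lh; have [b [b0 hb bE]] := hartley_top (L1Z (-1) Lh).
exists (- b); split; first by rewrite oppr_le0.
  by move=> x; have := hb x; rewrite hartleyZ// mulN1r lerNl.
case: bE => [->|[x xb]]; [left; exact: oppr0|right; exists x].
by rewrite -xb hartleyZ// mulN1r opprK.
Qed.

(** Every point of the convex hull [[a, b]] of the range and 0 is either 0 or a value, so it lies in
    [U]. Openness at the two ends gives the margin [e]; [c] is the midpoint and [d] the half-length
    plus [e]. The margin keeps [d] positive even for the zero function and leaves room for the
    truncation. *)
Lemma hartley_range h (U : set R[i]) : (0 < n)%N -> L1 m h -> open_in_C U ->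
  U 0 -> (forall x, U (hartley h x)%:C%C) ->
  exists c d : R, exists2 e : R, 0 < e <= d & [/\ forall t, `|t - c| <= d -> U t%:C%C,
    `|c| <= d & forall x, `|hartley h x - c| <= d - e].
Proof.
move=> n0 Lh oU U0 hU; have U0' : U (0 : R)%:C%C by [].
have [a [a0 ha aE]] := hartley_bottom Lh; have [b [b0 hb bE]] := hartley_top Lh.
have Uv v : a <= v <= b -> U v%:C%C.
  move=> /andP[av vb]; have [->//|v0] := eqVneq v 0.
  suff [y <-] : exists y, hartley h y = v by exact: hU.
  have [vp|vn] := leP 0 v.
    case: bE => [bE|[x xb]].
      by move: v0; rewrite eq_le vp andbT -bE vb.
    by apply: (hartley_between (x := x)) => //; rewrite vp xb vb.
  case: aE => [aE|[x xa]]; first by move: vn; rewrite ltNge -aE av.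
  by apply: (hartley_between (x := x)) => //; rewrite (ltW vn) xa av orbT.
have ab : a <= b by exact: le_trans b0.
have [ra ra0 hra] := oU _ (Uv a (introT andP (conj (lexx a) ab))).
have [rb rb0 hrb] := oU _ (Uv b (introT andP (conj ab (lexx b)))).
have rU t z0 : cmod (t%:C%C - z0%:C%C) = `|t - z0|.
  by rewrite /cmod -raddfB/= expr0n addr0 sqrtr_sqr.
pose e := Num.min ra rb / 2.
have e0 : 0 < e by rewrite divr_gt0// lt_min ra0.
have [ea eb] : e < ra /\ e < rb.
  by split; rewrite ltr_pdivrMr// gt_min ltr_pMr ?ltr1n ?ra0 ?rb0 ?orbT.
exists ((a + b) / 2), ((b - a) / 2 + e), e; first by rewrite e0 lerDr divr_ge0 ?subr_ge0 ?(le_trans a0 b0).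
split=> [t||x].
- rewrite ler_norml => /andP[t1 t2].
  have [ta|at_] := ltP t a; first by apply: hra; rewrite rU ltr_norml; apply/andP; split; lra.
  have [tb|bt] := ltP b t; first by apply: hrb; rewrite rU ltr_norml; apply/andP; split; lra.
  by apply: Uv; rewrite at_ bt.
- by rewrite ler_norml; apply/andP; split; lra.
- by rewrite addrK ler_norml; have := ha x; have := hb x; move=> ? ?; apply/andP; split; lra.
Qed.
End hartley_at_infinity.

(** * Real analytic functions and cosine coefficients *)

Section real_analytic.
Context {R : realType}.
Implicit Types (f : nat -> R) (phi : R -> R) (I : set R).

Lemma bernoulli_le (u : R) i : 0 <= u -> 1 + i%:R * u <= (1 + u) ^+ i.
Proof.
move=> u0; elim: i => [|i ih]; first by rewrite mul0r addr0 expr0.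
rewrite exprS -natr1; have : (1 + u) * (1 + i%:R * u) <= (1 + u) * (1 + u) ^+ i.
  by rewrite ler_wpM2l// addr_ge0.
by apply: le_trans; have := ler0n R i; have := sqr_ge0 u; nra.
Qed.

(** Comparison with the absolutely convergent series at a radius [y] strictly between [|z|] and
    [|x|]: writing [y = |z| (1 + u)], Bernoulli's inequality bounds [(i + 1) |z| ^ i] by a constant
    times [y ^ (i + 1)]. *)
Lemma cvg_pseries_diffs f (x z : R) : cvgn (pseries f x) -> `|z| < `|x| ->
  cvgn (pseries (pseries_diffs f) z).
Proof.
move=> fx zx; pose y := (`|z| + `|x|) / 2.
have [zy yx] : `|z| < y /\ y < `|x| by rewrite /y; split; lra.
have y0 : 0 < y by apply: le_lt_trans zy.
have fy : cvgn (pseries (fun i => `|f i|) y).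
  by apply: is_cvg_pseries_inside_norm fx _; rewrite gtr0_norm.
have yn0 : y != 0 by rewrite gt_eqF.
apply: normed_cvg.
have [z0|z0] := eqVneq `|z| 0.
  have -> : z = 0 by apply/eqP; rewrite -normr_eq0 z0.
  apply: (@cvgP _ _ `|pseries_diffs f 0%N|); apply: (@cvg_near_cst _ _ _ _ _).
  exists 1%N => // -[//|k] _ /=; rewrite /series/= big_nat_recl//= expr0 mulr1.
  rewrite big1 ?addr0// => i _; by rewrite expr0n mulr0 normr0.
have zp : 0 < `|z| by rewrite lt_def z0 normr_ge0.
pose u := y / `|z| - 1.
have u0 : 0 < u by rewrite subr_gt0 ltr_pdivlMr// mul1r.
have yE : y = `|z| * (1 + u) by rewrite /u; field.
pose C := (1 + u^-1) / y.
have C0 : 0 <= C by rewrite divr_ge0 ?addr_ge0 ?invr_ge0 ?(ltW u0) ?(ltW y0).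
apply: (@series_le_cvg _ _ (fun i => C * (`|f i.+1| * y ^+ i.+1))) => //.
- by move=> i /=; exact: normr_ge0.
- by move=> i; rewrite mulr_ge0// mulr_ge0// exprn_ge0// ltW.
- move=> i /=; rewrite /pseries_diffs !normrM normrX ger0_norm//.
  rewrite mulrAC [leRHS]mulrCA mulrC ler_wpM2l//.
  rewrite exprS /C mulrA divfK// {1}yE exprMn.
  rewrite [leRHS]mulrCA mulrC ler_wpM2l ?exprn_ge0//.
  apply: (@le_trans _ _ ((1 + u^-1) * (1 + i%:R * u))); last first.
    by apply: ler_wpM2l; [rewrite addr_ge0 ?invr_ge0 ?(ltW u0)|exact: bernoulli_le (ltW u0)].
  have [w [wp wu]] : exists w, 0 < w /\ (w = u^-1 /\ w * u = 1).
    by exists u^-1; rewrite invr_gt0 u0 mulVf// gt_eqF.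
  have [<- {}wu] := wu; rewrite -natr1.
  rewrite (_ : (1 + w) * (1 + i%:R * u) = 1 + i%:R * u + w + i%:R * (w * u)); last by ring.
  have := mulr_ge0 (ler0n R i) (ltW u0); rewrite wu; lra.
rewrite (_ : series _ = C \*o (fun k => series (fun i => `|f i| * y ^+ i) k.+1 - `|f 0%N|)).
  apply: is_cvgMr; apply: is_cvgB; last exact: is_cvg_cst.
  have [l hl] := (cvg_ex _).1 fy; apply/cvg_ex; exists l.
  exact: (cvg_comp _ _ (cvg_addnl 1) hl).
apply/funext => k /=; rewrite /series/= -mulr_sumr big_nat_recl//= expr0 mulr1.
by rewrite addrC addKr.
Qed.

Lemma is_derive_subr (x0 x : R) : is_derive x 1 (fun x => x - x0) 1.
Proof.
have := is_deriveB (is_derive_id x 1) (is_derive_cst x0 x 1).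
by rewrite subr0.
Qed.

(** Membership in [I] is part of the conclusion, which makes [I] open and two-sided derivatives
    meaningful at all its points. *)
Definition real_analytic I phi := forall x0, I x0 -> exists2 r, 0 < r &
  exists a, forall x, `|x - x0| < r -> I x /\ pseries a (x - x0) @ \oo --> phi x.

Lemma real_analytic_derive I phi : real_analytic I phi ->
  (forall x, I x -> is_derive x 1 phi (derive1 phi x)) /\ real_analytic I (derive1 phi).
Proof.
move=> Hphi.
have key x0 r a : 0 < r ->
    (forall x, `|x - x0| < r -> I x /\ pseries a (x - x0) @ \oo --> phi x) ->
    forall x, `|x - x0| < r -> is_derive x 1 phi (limn (pseries (pseries_diffs a) (x - x0))) /\
      cvgn (pseries (pseries_diffs a) (x - x0)).
  move=> r0 ha x xr.
  have [v [vE v0]] : exists v, v = `|x - x0| /\ 0 <= v by exists `|x - x0|; rewrite normr_ge0.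
  (* A quarter of the room left in the disc. The radii [v + 3 d], [v + 2 d] and [v + d] carry the
     series and its two formal derivatives, each differentiation costing one step. *)
  pose d := (r - v) / 4.
  have d0 : 0 < d by rewrite divr_gt0// subr_gt0 vE.
  have cp t : 0 <= t -> t < r -> cvgn (pseries a t).
    move=> t0 tr; have [_] : I (x0 + t) /\ pseries a (x0 + t - x0) @ \oo --> phi (x0 + t).
      by apply: ha; rewrite addrC addKr ger0_norm.
    by rewrite addrC addKr => /cvgP.
  have rE : r = v + 4 * d by rewrite /d; lra.
  have [w0 [w1 [w2 w3]]] : `|v + d| = v + d /\ `|v + 2 * d| = v + 2 * d /\
      `|v + 3 * d| = v + 3 * d /\ v + d < r by rewrite !ger0_norm; lra.
  have c1 := cp (v + 3 * d) ltac:(lra) ltac:(lra).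
  have c2 : cvgn (pseries (pseries_diffs a) (v + 2 * d)).
    by apply: cvg_pseries_diffs c1 _; rewrite w1 w2; lra.
  have c3 : cvgn (pseries (pseries_diffs (pseries_diffs a)) (v + d)).
    by apply: cvg_pseries_diffs c2 _; rewrite w0 w1; lra.
  have xK : `|x - x0| < `| v + d | by rewrite w0 -vE; lra.
  have c2' : cvgn (pseries (pseries_diffs a) (v + d)).
    by apply: (is_cvg_pseries_inside c2); rewrite w0 w1; lra.
  split; last exact: is_cvg_pseries_inside c2' xK.
  have ds := pseries_snd_diffs (cp (v + d) ltac:(lra) ltac:(lra)) c2' c3 xK.
  have dsh : is_derive x 1 (fun x => x - x0) 1.
    exact: is_derive_subr.
  have := @is_derive1_comp _ _ (fun x => x - x0) x _ _ ds dsh.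
  rewrite mulr1; apply: near_eq_is_derive; near=> y => /=.
  have [|_ hy] := ha y; last by apply/cvg_lim.
  have : `|x - y| < d by near: y; exact: nbhsx_ballx.
  have := ler_distD x y x0; rewrite [`|y - x|]distrC -vE; lra.
split=> x Ix; have [r r0 [a ha]] := Hphi x Ix.
  have xx : `|x - x| < r by rewrite subrr normr0.
  have [[dp dE] _] := key x r a r0 ha x xx.
  by split=> //; rewrite derive1E.
exists r => //; exists (pseries_diffs a) => y yr; split; first by have [] := ha y yr.
have [[dp dE] cv] := key x r a r0 ha y yr.
by rewrite derive1E dE.
Unshelve. all: by end_near. Qed.

(* No continuity of the last derivative is required. *)
Fixpoint differentiable_times k I phi : Prop :=
  if k is k'.+1 then exists phi', (forall x, I x -> is_derive x 1 phi (phi' x)) /\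
    differentiable_times k' I phi' else True.

Lemma real_analytic_differentiable_times k I phi :
  real_analytic I phi -> differentiable_times k I phi.
Proof.
elim: k phi => [//|k ih] phi /real_analytic_derive[h1 h2].
by exists (derive1 phi); split => //; exact: ih.
Qed.

Lemma differentiable_times_pred k I phi :
  differentiable_times k.+1 I phi -> differentiable_times k I phi.
Proof.
elim: k phi => [//|k ih] phi [phi' [h1 h2]]; exists phi'; split=> //; exact: ih.
Qed.

Lemma differentiable_timesD k I phi psi : differentiable_times k I phi ->
  differentiable_times k I psi -> differentiable_times k I (fun x => phi x + psi x).
Proof.
elim: k phi psi => [//|k ih] phi psi [p [hp cp]] [q [hq cq]].
exists (fun x => p x + q x); split; last exact: ih.
by move=> x Ix; have := hp x Ix; have := hq x Ix => *; exact: is_deriveD.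
Qed.

Lemma differentiable_timesM k I phi psi : differentiable_times k I phi ->
  differentiable_times k I psi -> differentiable_times k I (fun x => phi x * psi x).
Proof.
elim: k phi psi => [//|k ih] phi psi hphi hpsi.
have [cphi cpsi] := (differentiable_times_pred hphi, differentiable_times_pred hpsi).
have [p [hp cp]] := hphi; have [q [hq cq]] := hpsi.
exists (fun x => phi x * q x + psi x * p x); split; last first.
  by apply: differentiable_timesD; exact: ih.
by move=> x Ix; have := hp x Ix; have := hq x Ix => *; exact: is_deriveM.
Qed.

Lemma differentiable_times_cst k I c : differentiable_times k I (fun=> c).
Proof.
elim: k c => [//|k ih] c; exists (fun=> 0); split=> // x _; exact: is_derive_cst.
Qed.

Lemma differentiable_times_id k I : differentiable_times k I id.
Proof.
case: k => [//|k]; exists (fun=> 1); split=> [x _|]; first exact: is_derive_id.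
exact: differentiable_times_cst.
Qed.

End real_analytic.

(** * Decay of cosine coefficients *)

Section cosine_coefficients.
Context {R : realType}.
Local Notation leb := (@lebesgue_measure R).

Lemma Rintegral_mu1 (f : 'rV[R]_1 -> R) : L1 (mu 1) f ->
  \int[mu 1]_x f x = \int[leb]_t f (consv t 0).
Proof.
move=> Lf; rewrite Rintegral_muS//; apply: eq_Rintegral => t _.
rewrite /Rintegral /= integral_dirac//= ?diracT ?indicE ?in_setT ?mul1r ?mul1e//.
apply/measurable_EFinP; apply: (measurableT_comp (L1_measurable Lf)).
exact: measurable_consvr.
Qed.

(** The case of dimension one, since [cos] is the average of [cas] and its reflection. *)
Lemma riemann_lebesgue_cos (g : R -> R) : L1 leb g ->
  \int[leb]_t (g t * cos (k%:R * t)) @[k --> \oo] --> 0.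
Proof.
move=> Lg; pose h (x : 'rV[R]_1) := g (x ord0 ord0).
have hE t (v : 'rV[R]_0) : h (consv t v) = g t by rewrite /h consv0.
have mh : measurable_fun setT h.
  exact: (measurableT_comp (L1_measurable Lg) (measurable_coord ord0)).
have Lh : L1 (mu 1) h.
  apply/L1P; split=> //; rewrite integral_muS//; last exact: measurable_absE.
  have /L1P[_] := Lg; congr (_ < _)%E; apply: eq_integral => t _.
  rewrite integral_mu0//; first by rewrite hE.
  apply: measurable_absE; apply: (measurableT_comp mh); exact: measurable_consvr.
have dotE k t : dotRn (const_mx k : 'rV[R]_1) (consv t 0) = k * t.
  by rewrite /dotRn big_ord1 mxE consv0.
have Lcas k : L1 leb (fun t => g t * cas (k * t)).
  apply: (L1M (C := 2)) => //; last by move=> t; exact: cas_le2.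
  apply: (measurableT_comp (continuous_measurable_fun continuous_cas)).
  exact: measurable_funM.
have HE k : hartley h (const_mx k) = \int[leb]_t (g t * cas (k * t)).
  rewrite /hartley Rintegral_mu1; last exact: L1_cas.
  by apply: eq_Rintegral => t _; rewrite hE dotE.
have cosE k : \int[leb]_t (g t * cos (k * t)) =
    2^-1 * (hartley h (const_mx k) + hartley h (const_mx (- k))).
  rewrite !HE; have <- := RintegralD measurableT (Lcas k) (Lcas (- k)).
  have <- := RintegralZl 2^-1 measurableT (L1D (Lcas k) (Lcas (- k))).
  apply: eq_Rintegral => t _; rewrite /cas mulNr cosN sinN; by field.
apply/cvgrPdist_le => e e0; have [M hM] := riemann_lebesgue Lh e0.
near=> k; have kM : M < k%:R by near: k; exact: nbhs_infty_gtr.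
have nk (x : R) : M < `|x| -> M < `|(const_mx x : 'rV[R]_1)|.
  by move=> /lt_le_trans; apply; have := rV_coord_le (const_mx x : 'rV[R]_1) ord0; rewrite mxE.
have k1 := hM _ (nk k%:R ltac:(by rewrite ger0_norm)).
have k2 := hM _ (nk (- k%:R) ltac:(by rewrite normrN ger0_norm)).
rewrite sub0r normrN cosE normrM gtr0_norm ?invr_gt0//.
by have := ler_normD (hartley h (const_mx k%:R)) (hartley h (const_mx (- k%:R))); lra.
Unshelve. all: by end_near. Qed.

(** For [g t = phi (c + d * cos t)] and [k > 0] this is, up to the factor [2 / pi], the Chebyshev
    coefficient of [phi] on [[c - d, c + d]]. *)
Definition cosI (g : R -> R) k := \int[leb]_(t in `[0, pi]) (g t * cos (k%:R * t)).

Lemma FTC_pi (f F : R -> R) : continuous f -> (forall t : R, is_derive t 1 F (f t)) ->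
  \int[leb]_(t in `[0, pi]) f t = F pi - F 0.
Proof.
move=> cf dF; have cF : continuous F.
  move=> t; apply: differentiable_continuous; apply/derivable1_diffP.
  by have [] := dF t.
rewrite /Rintegral (continuous_FTC2 (F := F))//; first exact: pi_gt0.
- exact: continuous_subspaceT.
- split; first by move=> t _; have [] := dF t.
    by apply: cvg_at_right_filter; exact: cF.
  by apply: cvg_at_left_filter; exact: cF.
- by move=> t _; rewrite derive1E; have [_ ->] := dF t.
Qed.

Lemma is_derive_mulr (k t : R) : is_derive t 1 ( *%R k) k.
Proof.
rewrite (_ : *%R k = cst k * (id : R -> R))//.
by apply: is_derive_eq; rewrite scaler0 addr0 /GRing.scale/= mulr1.
Qed.

Lemma is_derive_sin_mul (k t : R) : is_derive t 1 (fun t => sin (k * t)) (cos (k * t) * k).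
Proof. exact: (is_derive1_comp (is_derive_sin _) (is_derive_mulr k t)). Qed.

Lemma is_derive_cos_mul (k t : R) : is_derive t 1 (fun t => cos (k * t)) (- sin (k * t) * k).
Proof. exact: (is_derive1_comp (is_derive_cos _) (is_derive_mulr k t)). Qed.

Lemma sin_natpi k : sin (k%:R * pi) = 0 :> R.
Proof.
elim: k => [|k ih]; first by rewrite mul0r sin0.
by rewrite -natr1 mulrDl mul1r sinDpi ih oppr0.
Qed.

Lemma continuous_cos_mul (k : R) : continuous (fun t : R => cos (k * t)).
Proof.
move=> t; apply: continuous_comp; last exact: continuous_cos.
exact: mulrl_continuous.
Qed.

Lemma cosI1 k : cosI (cst 1) k = if k == 0%N then pi else 0.
Proof.
rewrite /cosI; under eq_Rintegral do rewrite /= mul1r.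
have [->|k0] := eqVneq k 0%N.
  under eq_Rintegral do rewrite mul0r cos0.
  rewrite (@FTC_pi (cst 1) id) ?subr0//; first exact: cst_continuous.
have kn : (k%:R : R) != 0 by rewrite pnatr_eq0.
apply: etrans; first apply: (@FTC_pi _ (fun t => k%:R^-1 * sin (k%:R * t))).
- exact: continuous_cos_mul.
- move=> t; have := is_derive_sin_mul k%:R t => ds.
  have := is_derive_mulr k%:R^-1 (sin (k%:R * t)) => dm.
  have := is_derive1_comp dm ds; rewrite mulrCA mulVf// mulr1.
  exact.
- by rewrite /= sin_natpi !mulr0 sin0 mulr0 subrr.
Qed.

Section smooth.
Variables (c d : R) (I : set R).
Hypothesis HI : forall t, `|t - c| <= `|d| -> I t.

Let xt (t : R) := c + d * cos t.

Let Ixt t : I (xt t).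
Proof.
apply: HI; rewrite /xt addrC addKr normrM ler_piMr//.
by rewrite ler_norml cos_geN1 cos_le1.
Qed.

Let dxt (t : R) : is_derive t 1 xt (- d * sin t).
Proof.
rewrite (_ : xt = (fun u => c + u) \o ( *%R d \o cos))//.
have d1 := is_derive1_comp (is_derive_mulr d (cos t)) (is_derive_cos t).
have d2 : is_derive (d * cos t) 1 (fun u => c + u) 1.
  by rewrite (_ : (fun u => _) = cst c + id)//; apply: is_derive_eq; rewrite add0r.
by have := @is_derive1_comp _ (fun u => c + u) ( *%R d \o cos) t _ _ d2 d1; rewrite mul1r mulrN mulNr.
Qed.

Let dphi (phi phi' : R -> R) (t : R) : (forall x : R, I x -> is_derive x 1 phi (phi' x)) ->
  is_derive t 1 (fun t => phi (xt t)) (phi' (xt t) * (- d * sin t)).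
Proof. by move=> h; have := is_derive1_comp (h _ (Ixt t)) (dxt t). Qed.

Let cphi (phi : R -> R) : differentiable_times 1 I phi -> continuous (fun t => phi (xt t)).
Proof.
move=> [phi' [h _]] t; apply: differentiable_continuous; apply/derivable1_diffP.
by have [] := dphi t h.
Qed.

Let bphi phi : differentiable_times 1 I phi ->
  exists C, forall t, t \in `[0, pi] -> `|phi (xt t)| <= C.
Proof.
move=> h; have cn : continuous (fun t => `|phi (xt t)|).
  move=> t; apply: continuous_comp; [exact: cphi|exact: norm_continuous].
have [t0 _ ht] := EVT_max (pi_ge0 R) (continuous_subspaceT cn).
by exists `|phi (xt t0)|.
Qed.

(* The function
   [phi x * sin (k t) / k - d * sin t * phi' x * cos (k t) / k ^ 2], with
   [x = c + d * cos t], vanishes at 0 and [pi], and has derivative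
   [phi x * cos (k t) + psi x * cos (k t) / k ^ 2] where
   [psi x = (d ^ 2 - (x - c) ^ 2) * phi'' x - (x - c) * phi' x]. *)
Lemma cosI_decay m phi : differentiable_times m.*2.+1 I phi ->
  exists2 C, 0 <= C & forall k, `|cosI (fun t => phi (c + d * cos t)) k.+1| <= C * (k.+1%:R ^- m.*2).
Proof.
elim: m phi => [|m ih] phi h.
  have [C hC] := bphi h; exists (Num.max C 0 * pi); first by rewrite mulr_ge0 ?pi_ge0 ?le_max ?lexx ?orbT.
  move=> k; rewrite expr0 invr1 mulr1 /cosI Rintegral_mkcond.
  have mf : measurable_fun setT (fun t => phi (xt t) * cos (k.+1%:R * t)).
    apply: continuous_measurable_fun => t; apply: cvgM; first exact: cphi.
    exact: continuous_cos_mul.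
  have mi : measurable `[(0:R), pi] by exact: measurable_itv.
  apply: Rintegral_norm_le; last first.
    by apply/(measurable_restrictT _ mi); exact: measurable_funTS.
  apply: (@le_trans _ _ (\int[leb]_(t in `[0%R, pi]) (cst (Num.max C 0)%:E) t)%E); last first.
    by rewrite integral_cst//= lebesgue_measure_itv/= lte_fin pi_gt0 oppr0 adde0 EFinM.
  rewrite [leRHS]integral_mkcond; apply: ge0_le_integral => //.
  - apply/measurable_EFinP; apply: measurableT_comp => //.
    by apply/(measurable_restrictT _ mi); exact: measurable_funTS.
  - by apply/(measurable_restrictT _ mi); exact: measurable_cst.
  - move=> t _; rewrite !patchE; case: ifPn => [|_]; last by rewrite normr0.
    rewrite inE/= => ht; rewrite lee_fin normrM; apply: (@le_trans _ _ (C * 1)); last first.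
      by rewrite mulr1 le_max lexx.
    by apply: ler_pM => //; [exact: hC|rewrite ler_norml cos_geN1 cos_le1].
have [phi1 [h1 [phi2 [h2 h3]]]] := h.
pose psi x := (d ^+ 2 + - 1 * ((x + - c) * (x + - c))) * phi2 x + - 1 * ((x + - c) * phi1 x).
(* Passing to [psi] costs two derivatives and gains [k ^ -2]. The last one, left over at the end,
   provides continuity and hence boundedness. *)
have hpsi : differentiable_times m.*2.+1 I psi.
  have hid : differentiable_times m.*2.+1 I (fun x => x + - c).
    by apply: differentiable_timesD; [exact: differentiable_times_id|exact: differentiable_times_cst].
  have hphi1 : differentiable_times m.*2.+1 I phi1.
    by apply: differentiable_times_pred; exists phi2.
  apply: differentiable_timesD; last first.
    by apply: differentiable_timesM; [exact: differentiable_times_cst|exact: differentiable_timesM].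
  apply: differentiable_timesM => //; apply: differentiable_timesD; first exact: differentiable_times_cst.
  by apply: differentiable_timesM; [exact: differentiable_times_cst|exact: differentiable_timesM].
have [C C0 hC] := ih _ hpsi; exists C => // k.
have [K Kn] : exists K : R, K = k.+1%:R by exists k.+1%:R.
have K0 : K != 0 by rewrite Kn pnatr_eq0.
have E : cosI (fun t => phi (c + d * cos t)) k.+1 + K ^- 2 * cosI (fun t => psi (c + d * cos t)) k.+1 = 0.
  have cont f : differentiable_times 1 I f -> continuous (fun t => f (xt t) * cos (k.+1%:R * t)).
    by move=> hf t; apply: cvgM; [exact: cphi|exact: continuous_cos_mul].
  have d1 f l : differentiable_times l.+1 I f -> differentiable_times 1 I f.
    by move=> [f' [hf' _]]; exists f'.
  have int f : differentiable_times 1 I f ->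
      leb.-integrable `[0, pi] (EFin \o (fun t => f (xt t) * cos (k.+1%:R * t))).
    move=> hf; apply: continuous_compact_integrable; first exact: segment_compact.
    exact/continuous_subspaceT/cont.
  rewrite /cosI -RintegralZl//; last exact/int/(d1 _ _ hpsi).
  rewrite -RintegralD//; last 2 first.
  - exact/int/(d1 _ _ h).
  - rewrite (_ : _ \o _ = (fun x => (K ^- 2)%:E * (psi (xt x) * cos (k.+1%:R * x))%:E)%E)//.
    by apply: integrableZl => //; exact/int/(d1 _ _ hpsi).
  apply: etrans; first apply: (@FTC_pi _ (fun t => phi (xt t) * (K^-1 * sin (K * t)) +
    (phi1 (xt t) * (- d * sin t)) * (K ^- 2 * cos (K * t)))).
  - move=> t; apply: cvgD; first exact/cont/(d1 _ _ h).
    by apply: cvgMr; exact/cont/(d1 _ _ hpsi).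
  - move=> t; have e1 := dphi t h1; have e2 := dphi t h2.
    have e3 := is_derive_sin_mul K t; have e4 := is_derive_cos_mul K t.
    apply: is_derive_eq; rewrite /GRing.scale/= -Kn /psi /xt.
    have := cos2Dsin2 t; set S := sin t; set Co := cos t.
    (* In these terms [d ^ 2 - (x - c) ^ 2] is [d ^ 2 * sin t ^ 2]. *)
    move=> SC; have -> : d ^+ 2 = d ^+ 2 * (Co ^+ 2 + S ^+ 2) by rewrite SC mulr1.
    by field.
  - by rewrite /= Kn sin_natpi sinpi !mulr0 sin0 !(mulr0, mul0r) addr0 subrr.
have -> : cosI (fun t => phi (c + d * cos t)) k.+1 = - (K ^- 2 * cosI (fun t => psi (c + d * cos t)) k.+1).
  by apply/eqP; rewrite -addr_eq0 E.
rewrite normrN normrM ger0_norm ?invr_ge0 ?sqr_ge0// -Kn.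
have -> : C / K ^+ m.+1.*2 = K ^- 2 * (C / K ^+ m.*2).
  by rewrite doubleS -addn2 exprD invfM; ring.
by rewrite ler_wpM2l ?invr_ge0 ?sqr_ge0// Kn hC.
Qed.

End smooth.
End cosine_coefficients.

(** * Chebyshev expansions *)

Lemma lipschitz_of_derive {R : realType} (f f' : R -> R) (a b C : R) :
  (forall x : R, a <= x <= b -> is_derive x 1 f (f' x)) ->
  (forall x, a <= x <= b -> `|f' x| <= C) ->
  forall x y, a <= x <= b -> a <= y <= b -> `|f x - f y| <= C * `|x - y|.
Proof.
move=> df fC x y.
wlog xy : x y / x <= y.
  move=> h; case: (leP x y) => [|/ltW] xy hx hy; first exact: h.
  by rewrite distrC [`|x - y|]distrC; exact: h.
move=> /andP[ax xb] /andP[ay yb].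
have inab t : x <= t <= y -> a <= t <= b.
  by move=> /andP[xt ty]; rewrite (le_trans ax xt) (le_trans ty yb).
have [||t] := @MVT_segment _ f f' x y xy.
- by move=> t; rewrite in_itv/= => /andP[xt ty]; apply/df/inab; rewrite !ltW.
- apply: derivable_within_continuous => t; rewrite in_itv/= => /inab/df[].
  by [].
rewrite in_itv/= => /inab tab E; rewrite distrC E normrM [`|x - y|]distrC.
by rewrite ler_wpM2r// fC.
Qed.

Lemma measurable_invR {R : realType} : measurable_fun [set: R] (fun x : R => x^-1).
Proof.
rewrite (_ : (fun x => _) = fun x : R => x * (x ^+ 2) `^ (-1)).
  apply: measurable_funM => //; apply: (measurableT_comp (measurable_powR _)).
  exact: measurable_funX.
apply/funext => x; rewrite powR_inv1 ?sqr_ge0//.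
by have [->|x0] := eqVneq x 0; [rewrite invr0 mul0r|field].
Qed.

Section cosine_expansion.
Context {R : realType}.
Local Notation leb := (@lebesgue_measure R).
Variables (c d : R) (I : set R) (phi : R -> R).
Hypothesis d0 : 0 < d.
Hypothesis HI : forall t, `|t - c| <= d -> I t.
Hypothesis Hphi : differentiable_times 2 I phi.

Let g (t : R) := phi (c + d * cos t).

(** This bounds the difference quotient [w] in [cosine_expansion]. The second derivative of [phi]
    only ensures that the first is continuous, hence bounded on the interval. *)
Lemma cos_lipschitz_comp : exists2 C, 0 <= C &
  forall s t, `|g s - g t| <= C * `|cos s - cos t|.
Proof.
have [phi1 [h1 [phi2 [h2 _]]]] := Hphi.
have ball_itv x : c - d <= x <= c + d -> I x.
  by move=> /andP[? ?]; apply: HI; rewrite ler_norml; apply/andP; split; lra.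
have cn : {within `[c - d, c + d], continuous (fun x => `|phi1 x|)}.
  have h : {within `[c - d, c + d], continuous phi1}.
    apply: derivable_within_continuous => x; rewrite in_itv/= => /ball_itv/h2[].
    by [].
  move=> x; apply: continuous_comp; [exact: h|exact: norm_continuous].
have cd : c - d <= c + d by have := d0; lra.
have [x0 _ hx0] := EVT_max cd cn.
exists (`|phi1 x0| * d); first by rewrite mulr_ge0// ltW.
have inJ t : c - d <= c + d * cos t <= c + d.
  by have := cos_geN1 t; have := cos_le1 t; have := d0; move=> ? ? ?; apply/andP; split; nra.
move=> s t.
have := lipschitz_of_derive (fun x hx => h1 x (ball_itv x hx))
  (fun x hx => hx0 x ltac:(by rewrite in_itv)) (inJ s) (inJ t).
move=> /le_trans; apply; rewrite -mulrA ler_wpM2l//.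
by rewrite opprD addrACA subrr add0r -mulrBr normrM gtr0_norm.
Qed.

Let mcos : measurable_fun [set: R] (@cos R).
Proof. by apply: continuous_measurable_fun; exact: continuous_cos. Qed.

Let mcosk k : measurable_fun [set: R] (fun t : R => cos (k%:R * t)).
Proof. by apply: continuous_measurable_fun; exact: continuous_cos_mul. Qed.

Let mg : measurable_fun [set: R] g.
Proof.
have [C C0 hC] := cos_lipschitz_comp.
apply: continuous_measurable_fun => t; apply/cvgrPdist_le => e e0.
have C1 : 0 < C + 1 by rewrite ltr_wpDl.
have := @continuous_cos R t => /cvgrPdist_le/(_ (e / (C + 1))).
rewrite divr_gt0// => /(_ isT); apply: filterS => s hs.
rewrite (le_trans (hC t s))// (@le_trans _ _ ((C + 1) * `|cos t - cos s|))//.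
  by rewrite ler_wpM2r// lerDl.
by rewrite mulrC -ler_pdivlMr.
Qed.

Let mD : measurable `[(0:R), pi]. Proof. exact: measurable_itv. Qed.

Let bounded_int (f : R -> R) (C : R) : measurable_fun [set: R] f ->
  (forall t, `|f t| <= C) -> leb.-integrable `[0, pi] (EFin \o f).
Proof.
move=> mf fC; apply: measurable_bounded_integrable => //.
- by rewrite /= lebesgue_measure_itv/= lte_fin pi_gt0 oppr0 adde0 ltry.
- exact: measurable_funTS.
- by exists C; split; [exact: num_real|move=> M CM t _ /=; exact: le_trans (fC t) (ltW CM)].
Qed.

Let cosk_le (f : R -> R) (C : R) k t : `|f t| <= C -> `|f t * cos (k%:R * t)| <= C.
Proof.
move=> fC; rewrite normrM -[leRHS]mulr1; apply: ler_pM => //.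
by rewrite ler_norml cos_geN1 cos_le1.
Qed.

Lemma cosI_cvg0 (w : R -> R) (C : R) : measurable_fun [set: R] w -> (forall t, `|w t| <= C) ->
  cosI w k @[k --> \oo] --> 0.
Proof.
move=> mw wC; have Lw : L1 leb (w \_ `[0, pi]).
  have := bounded_int mw wC; rewrite integrable_mkcond// /L1.
  by congr integrable; apply/funext => t; rewrite /= !patchE; case: ifP.
rewrite (_ : cosI w = fun k => \int[leb]_t ((w \_ `[0, pi]) t * cos (k%:R * t))).
  exact: riemann_lebesgue_cos.
apply/funext => k; rewrite /cosI Rintegral_mkcond.
by apply: eq_Rintegral => t _; rewrite !patchE; case: ifP => // _; rewrite mul0r.
Qed.

Let int_lin (f1 f2 : R -> R) (C1 C2 a b : R) : measurable_fun [set: R] f1 ->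
  measurable_fun [set: R] f2 -> (forall t, `|f1 t| <= C1) -> (forall t, `|f2 t| <= C2) ->
  \int[leb]_(t in `[0, pi]) (a * f1 t + b * f2 t) =
  a * \int[leb]_(t in `[0, pi]) f1 t + b * \int[leb]_(t in `[0, pi]) f2 t.
Proof.
move=> m1 m2 f1C f2C.
have i1 := bounded_int m1 f1C; have i2 := bounded_int m2 f2C.
rewrite RintegralD//.
- by rewrite !RintegralZl.
- apply: (bounded_int (C := `|a| * C1)); first exact: measurable_funM.
  by move=> t; rewrite normrM ler_wpM2l.
- apply: (bounded_int (C := `|b| * C2)); first exact: measurable_funM.
  by move=> t; rewrite normrM ler_wpM2l.
Qed.

Let cosI_lin (f1 f2 : R -> R) (C1 C2 a b : R) i j : measurable_fun [set: R] f1 ->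
  measurable_fun [set: R] f2 -> (forall t, `|f1 t| <= C1) -> (forall t, `|f2 t| <= C2) ->
  \int[leb]_(t in `[0, pi]) (a * (f1 t * cos (i%:R * t)) + b * (f2 t * cos (j%:R * t))) =
  a * cosI f1 i + b * cosI f2 j.
Proof.
move=> m1 m2 f1C f2C; apply: (int_lin (C1 := C1) (C2 := C2)).
- exact: measurable_funM.
- exact: measurable_funM.
- by move=> t; exact: cosk_le.
- by move=> t; exact: cosk_le.
Qed.

Lemma cosI_shift (w : R -> R) (C eta : R) k : measurable_fun [set: R] w ->
  (forall t, `|w t| <= C) ->
  cosI (fun t => (cos t - eta) * w t) k.+1 =
  2^-1 * (cosI w k.+2 + cosI w k) - eta * cosI w k.+1.
Proof.
move=> mw wC.
have mcw : measurable_fun [set: R] (fun t => cos t * w t) by exact: measurable_funM.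
have cwC t : `|cos t * w t| <= C.
  rewrite normrM; apply: le_trans (wC t); rewrite ler_piMl//.
  by rewrite ler_norml cos_geN1 cos_le1.
transitivity (1 * cosI (fun t => cos t * w t) k.+1 + (- eta) * cosI w k.+1).
  by rewrite -(cosI_lin _ _ _ _ mcw mw cwC wC); apply: eq_Rintegral => t _; ring.
rewrite mul1r mulNr; congr (_ - _); rewrite mulrDr -(cosI_lin _ _ _ _ mw mw wC wC).
apply: eq_Rintegral => t _.
rewrite -(natr1 k.+1).
have -> : (k%:R : R) = k.+1%:R - 1 by rewrite -natr1 addrK.
set K := k.+1%:R; rewrite mulrDl mulrBl mul1r cosD cosB; by field.
Qed.

Lemma cosI_shift0 (w : R -> R) (C eta : R) : measurable_fun [set: R] w ->
  (forall t, `|w t| <= C) ->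
  cosI (fun t => (cos t - eta) * w t) 0 = cosI w 1 - eta * cosI w 0.
Proof.
move=> mw wC; rewrite -[cosI w 1]mul1r -mulNr -(cosI_lin _ _ _ _ mw mw wC wC).
by apply: eq_Rintegral => t _; rewrite !mul0r !mul1r cos0; ring.
Qed.

(* The Christoffel-Darboux formula: with
   [g t - g t0 = (cos t - cos t0) * w t], the partial sums telescope, up to the
   cosine coefficients of the bounded function [w]. *)
Lemma cosine_expansion t0 :
  cosI g 0 + 2 * \sum_(0 <= k < N) cosI g k.+1 * cos (k.+1%:R * t0) @[N --> \oo]
  --> pi * g t0.
Proof.
have [C C0 hC] := cos_lipschitz_comp.
(* Where [cos t = eta] the quotient is 0, as the inverse of 0 is 0. The identity [gE] persists there
   because [g] is a Lipschitz function of the cosine. *)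
pose eta := cos t0; pose w t := (g t - g t0) / (cos t - eta).
have mw : measurable_fun [set: R] w.
  apply: measurable_funM; first exact: measurable_funB.
  by apply: (measurableT_comp measurable_invR); exact: measurable_funB.
have wC t : `|w t| <= C.
  have [E|E] := eqVneq (cos t - eta) 0; first by rewrite /w E invr0 mulr0 normr0.
  rewrite /w normrM normfV ler_pdivrMr ?normr_gt0//; exact: hC.
have gE t : g t = g t0 + (cos t - eta) * w t.
  have [E|E] := eqVneq (cos t - eta) 0; last by rewrite /w; field.
  have := hC t t0; rewrite E normr0 mulr0 normr_le0 subr_eq0 => /eqP->.
  by rewrite mul0r addr0.
have mcw : measurable_fun [set: R] (fun t => (cos t - eta) * w t).
  by apply: measurable_funM => //; exact: measurable_funB.
have cwC t : `|(cos t - eta) * w t| <= 2 * C.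
  rewrite normrM; apply: ler_pM => //; rewrite (le_trans (ler_normB _ _))//.
  by rewrite (_ : 2 = 1 + 1)// lerD// ler_norml cos_geN1 cos_le1.
have gk k : cosI g k = g t0 * cosI (cst 1) k + cosI (fun t => (cos t - eta) * w t) k.
  have m1 : measurable_fun [set: R] (cst (1 : R)) by exact: measurable_cst.
  have c1 (t : R) : `|(cst 1 t : R)| <= 1 by rewrite normr1.
  rewrite -[cosI (fun t => _ * _) k]mul1r.
  rewrite -(cosI_lin _ _ _ _ m1 mcw c1 cwC).
  by apply: eq_Rintegral => t _; rewrite gE /=; ring.
have part N : cosI g 0 + 2 * \sum_(0 <= k < N) cosI g k.+1 * cos (k.+1%:R * t0) =
    pi * g t0 + (cosI w N.+1 * cos (N%:R * t0) - cosI w N * cos (N.+1%:R * t0)).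
  elim: N => [|N ih].
    rewrite big_nil mulr0 addr0 gk cosI1 (cosI_shift0 _ mw wC) mul0r cos0 mul1r /eta; ring.
  rewrite big_nat_recr//= mulrDr addrA ih gk cosI1 (cosI_shift _ _ mw wC) mulr0 add0r.
  rewrite -(natr1 N.+1); set K := N.+1%:R.
  have -> : (N%:R : R) = K - 1 by rewrite /K -natr1 addrK.
  by rewrite !mulrDl !mulN1r !mul1r cosB cosD /eta; field.
under eq_fun do rewrite part.
have w0 := cosI_cvg0 mw wC.
have w0S : cosI w k.+1 @[k --> \oo] --> 0 by apply: (cvg_comp _ _ (cvg_addnl 1) w0).
have small (u : nat -> R) (v : nat -> R) : u k @[k --> \oo] --> 0 -> (forall k, `|v k| <= 1) ->
    u k * v k @[k --> \oo] --> 0.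
  move=> u0 v1; apply/cvgr0Pnorm_le => e e0; move/cvgr0Pnorm_le: u0 => /(_ e e0).
  by apply: filterS => k hk; rewrite normrM (le_trans _ hk)// ler_piMr.
have cos1 k t : `|cos (k%:R * t)| <= 1 :> R by rewrite ler_norml cos_geN1 cos_le1.
have h1 := small _ (fun k => cos (k%:R * t0)) w0S (fun k => cos1 k t0).
have h2 := small _ (fun k => cos (k.+1%:R * t0)) w0 (fun k => cos1 k.+1 t0).
have := cvgD (@cvg_cst _ (pi * g t0) _ \oo _) (cvgB h1 h2).
by rewrite subrr addr0 => h; exact: h.
Qed.

End cosine_expansion.

(** * Chebyshev polynomials and the size of their derivatives *)

Section chebyshev.
Context {R : realType}.
Implicit Types p q : {poly R}.

(** One recurrence for both kinds of Chebyshev polynomials. Shifting the initial pair makes the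
    recursion structural; the familiar three-term form is [recpolySS]. *)
Fixpoint recpoly (p0 p1 : {poly R}) k : {poly R} :=
  if k is k'.+1 then recpoly p1 (2%:P * 'X * p1 - p0) k' else p0.

Lemma recpolySS p0 p1 k :
  recpoly p0 p1 k.+2 = 2%:P * 'X * recpoly p0 p1 k.+1 - recpoly p0 p1 k.
Proof. by elim: k p0 p1 => [//|k ih] p0 p1; exact: (ih p1 (2%:P * 'X * p1 - p0)). Qed.

Definition chebT := recpoly 1 'X.
Definition chebU := recpoly 1 (2%:P * 'X).

Lemma nat_ind2 (P : nat -> Prop) : P 0%N -> P 1%N -> (forall k, P k -> P k.+1 -> P k.+2) ->
  forall k, P k.
Proof.
move=> P0 P1 PS k; suff: P k /\ P k.+1 by case.
by elim: k => [|k [h1 h2]]; split=> //; exact: PS.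
Qed.

Lemma chebT_cos k (t : R) : (chebT k).[cos t] = cos (k%:R * t).
Proof.
move: k; apply: nat_ind2 => [||k h1 h2].
- by rewrite /chebT/= hornerC mul0r cos0.
- by rewrite /chebT/= hornerX mul1r.
rewrite /chebT recpolySS -/chebT !hornerE h1 h2 -(natr1 k.+1).
have -> : (k%:R : R) = k.+1%:R - 1 by rewrite -natr1 addrK.
by set K := k.+1%:R; rewrite !mulrDl !mulN1r !mul1r cosB cosD; ring.
Qed.

Lemma chebT_le1 k y : -1 <= y <= 1 -> `|(chebT k).[y]| <= 1.
Proof.
move=> y1; rewrite -(acosK (x := y)) ?in_itv//= chebT_cos.
by rewrite ler_norml cos_geN1 cos_le1.
Qed.

Lemma chebTU k : chebT k.+2 = 'X * chebU k.+1 - chebU k.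
Proof.
move: k; apply: nat_ind2 => [||k h1 h2].
- by rewrite /chebT /chebU/=; ring.
- by rewrite /chebT /chebU/=; ring.
by rewrite /chebT recpolySS -/chebT h1 h2 /chebU !recpolySS; ring.
Qed.

Lemma chebU_step k : chebU k.+2 = chebU k + 2%:P * chebT k.+2.
Proof. by rewrite chebTU /chebU recpolySS; ring. Qed.

Lemma deriv_chebT k : (chebT k.+1)^`() = k.+1%:R *: chebU k.
Proof.
move: k; apply: nat_ind2 => [||k h1 h2].
- by rewrite /chebT /chebU/= derivX scale1r.
- rewrite /chebT /chebU/= derivB !derivM !derivC derivX -mul_polyC.
  by rewrite !polyC_natr; ring.
have -> : chebT k.+3 = 2%:P * 'X * chebT k.+2 - chebT k.+1 by rewrite /chebT recpolySS.
rewrite derivB !derivM !derivC derivX h1 h2 chebTU /chebU recpolySS -/chebU -!mul_polyC.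
by rewrite !polyC_natr; ring.
Qed.

(** A substitute for the inequality of the Markov brothers: the sum of the absolute Chebyshev
    coefficients dominates the maximum on [[-1, 1]], and a derivative multiplies it by at most
    [k ^ 2]. Unlike a bound on the maximum, it can be iterated at once. *)
Definition comb k (M : R) p := exists a : nat -> R,
  p = \sum_(i < k.+1) a i *: chebT i /\ \sum_(i < k.+1) `|a i| <= M.

Lemma comb_le k M p y : comb k M p -> -1 <= y <= 1 -> `|p.[y]| <= M.
Proof.
move=> [a [-> aM]] y1; rewrite horner_sum (le_trans (ler_norm_sum _ _ _))//.
apply: le_trans aM; apply: ler_sum => i _; rewrite hornerZ normrM.
by rewrite ler_piMr// chebT_le1.
Qed.

Lemma combD k M M' p q : comb k M p -> comb k M' q -> comb k (M + M') (p + q).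
Proof.
move=> [a [-> aM]] [b [-> bM]]; exists (fun i => a i + b i); split.
  by rewrite -big_split/=; apply: eq_bigr => i _; rewrite scalerDl.
apply: le_trans (lerD aM bM); rewrite -big_split/=.
by apply: ler_sum => i _; exact: ler_normD.
Qed.

Lemma combZ k M x p : comb k M p -> comb k (`|x| * M) (x *: p).
Proof.
move=> [a [-> aM]]; exists (fun i => x * a i); split.
  by rewrite scaler_sumr; apply: eq_bigr => i _; rewrite scalerA.
by under eq_bigr do rewrite normrM; rewrite -mulr_sumr ler_wpM2l.
Qed.

Lemma comb_weaken k M M' p : M <= M' -> comb k M p -> comb k M' p.
Proof. by move=> MM [a [h aM]]; exists a; split=> //; exact: le_trans MM. Qed.

Lemma comb_chebT k i : (i <= k)%N -> comb k 1 (chebT i).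
Proof.
move=> ik; have ik' : (i < k.+1)%N by [].
exists (fun j => (j == i)%:R); split.
  rewrite (bigD1 (Ordinal ik'))//= eqxx scale1r big1 ?addr0// => j ji.
  by rewrite -[j == i :> nat]/(j == Ordinal ik') (negbTE ji) scale0r.
rewrite (bigD1 (Ordinal ik'))//= eqxx normr1 big1 ?addr0// => j ji.
by rewrite -[j == i :> nat]/(j == Ordinal ik') (negbTE ji) normr0.
Qed.

(** By [chebU_step], [U_i] is a sum of Chebyshev polynomials with nonnegative coefficients of total
    [i + 1]; as the derivative of [T_(i+1)] is [(i + 1) U_i], this is the source of the square in
    [comb_deriv]. *)
Lemma comb_chebU k i : (i <= k)%N -> comb k i.+1%:R (chebU i).
Proof.
move: i; apply: nat_ind2 => [||i h1 h2] ik.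
- by have := comb_chebT ik.
- have := combZ 2 (comb_chebT ik); rewrite mulr1 normr_nat /chebU/= -mul_polyC.
  exact.
rewrite chebU_step mul_polyC.
have := combD (h1 (leq_trans (leqW (leqnSn i)) ik)) (combZ 2 (comb_chebT ik)).
by rewrite normr_nat mulr1 -natrD addn2.
Qed.

Lemma comb_deriv k M p : comb k M p -> comb k (k%:R ^+ 2 * M) p^`().
Proof.
move=> [a [-> aM]].
apply: (@comb_weaken _ (\sum_(i < k.+1) k%:R ^+ 2 * `|a i|)).
  by rewrite -mulr_sumr ler_wpM2l// sqr_ge0.
rewrite raddf_sum/=.
suff h (r : seq 'I_k.+1) : comb k (\sum_(i <- r) k%:R ^+ 2 * `|a i|) (\sum_(i <- r) (a i *: chebT i)^`()).
  exact: h.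
elim: r => [|i r ih].
  by exists (fun=> 0); rewrite !big_nil !big1 ?normr0// => i _; rewrite ?scale0r ?normr0.
rewrite !big_cons; apply: combD ih; rewrite derivZ mulrC; apply: combZ.
case: i => -[|i] /= ik.
  rewrite /chebT/= derivC; exists (fun=> 0); split; first by rewrite big1// => i _; rewrite scale0r.
  by rewrite big1 ?sqr_ge0// => i _; rewrite normr0.
rewrite deriv_chebT; apply: (@comb_weaken _ (`|i.+1%:R| * i.+1%:R)); last first.
  by apply: combZ; apply: comb_chebU; exact: ltnW.
by rewrite normr_nat -expr2 lerXn2r ?nnegrE// ler_nat.
Qed.

Lemma chebT_derivn_le k j y : -1 <= y <= 1 -> `|((chebT k)^`(j)).[y]| <= k%:R ^+ (2 * j).
Proof.
suff: comb k (k%:R ^+ (2 * j)) (chebT k)^`(j) by move=> h y1; exact: comb_le h y1.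
elim: j => [|j ih]; first by rewrite muln0 expr0 derivn0; exact: comb_chebT.
by rewrite derivnS mulnS exprD; exact: comb_deriv.
Qed.

Let fact_ge1 j : (1 : R) <= (j`!)%:R.
Proof. by rewrite ler1n fact_gt0. Qed.

Lemma chebT_nderivn_le k j y : -1 <= y <= 1 -> `|((chebT k)^`N(j)).[y]| <= k%:R ^+ (2 * j).
Proof.
move=> y1; apply: le_trans (chebT_derivn_le k j y1).
by rewrite nderivn_def hornerMn -mulr_natr normrM normr_nat ler_peMr.
Qed.

Lemma chebT_nderivn_lipschitz k j x y : -1 <= x <= 1 -> -1 <= y <= 1 ->
  `|((chebT k)^`N(j)).[x] - ((chebT k)^`N(j)).[y]| <= k%:R ^+ (2 * j.+1) * `|x - y|.
Proof.
have h := @lipschitz_of_derive _ _ _ (-1) 1 (k%:R ^+ (2 * j.+1))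
  (fun z _ => is_derive_poly ((chebT k)^`N(j)) z).
apply: h => z z1; apply: le_trans (chebT_derivn_le k j.+1 z1).
by rewrite derivnS nderivn_def derivMn hornerMn -mulr_natr normrM normr_nat ler_peMr.
Qed.

(** A remainder of second order is needed in [rep_head], where one factor [x - y] is divided out and
    the quotient must still be bounded by a multiple of [|x - y|]. The derivative of [T_k] minus its
    linear part at [y] is small on the segment between [x] and [y]. *)
Lemma chebT_taylor2 k x y : -1 <= x <= 1 -> -1 <= y <= 1 ->
  `|(chebT k).[x] - (chebT k).[y] - (chebT k)^`().[y] * (x - y)| <= k%:R ^+ 4 * `|x - y| ^+ 2.
Proof.
move=> x1 y1.
pose a := Num.min x y; pose b := Num.max x y.
have ab t : a <= t <= b -> -1 <= t <= 1.
  by rewrite /a /b ge_min le_max; case/andP: x1 => ? ?; case/andP: y1 => ? ?; lra.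
pose p := chebT k - ((chebT k)^`().[y])%:P * 'X.
have := @lipschitz_of_derive _ (horner p) (horner p^`()) a b (k%:R ^+ 4 * `|x - y|).
move=> /(_ (fun z _ => is_derive_poly p z)) h.
have {}h := h _ x y _ _.
rewrite (_ : (chebT k).[x] - _ - _ = p.[x] - p.[y]); last by rewrite /p !hornerE; ring.
rewrite expr2 mulrA; apply: h.
- move=> z zab; rewrite /p derivB derivM derivC mul0r add0r derivX mulr1 hornerD hornerN hornerC.
  apply: (@le_trans _ _ (k%:R ^+ 4 * `|z - y|)).
    have := chebT_nderivn_lipschitz k 1 (ab _ zab) y1.
    by rewrite nderivn1.
  rewrite ler_wpM2l ?exprn_ge0//.
  move: zab; rewrite /a /b ge_min le_max => zab.
  by have := ler_norm (x - y); have := ler_norm (y - x); rewrite distrC => ? ?;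
    rewrite ler_norml; apply/andP; split; case/andP: zab => /orP[] ? /orP[] ?; lra.
- by rewrite /a /b ge_min le_max !lexx.
- by rewrite /a /b ge_min le_max !lexx !orbT.
Qed.

End chebyshev.

(** * Growth of Chebyshev polynomials *)

Section polynomial_growth.
Context {R : realType}.
Implicit Types (u v : nat -> R).

Definition poly_bounded u := exists (C : R) m, 0 <= C /\ forall k, 0 <= u k <= C * k.+1%:R ^+ m.

Lemma poly_bounded_cst (c : R) : 0 <= c -> poly_bounded (fun=> c).
Proof. by move=> c0; exists c, 0%N; split=> // k; rewrite expr0 mulr1 c0 lexx. Qed.

Lemma poly_bounded_succ : poly_bounded (fun k => k.+1%:R).
Proof. by exists 1, 1%N; split=> // k; rewrite mul1r expr1 lexx andbT. Qed.

Lemma poly_boundedM u v : poly_bounded u -> poly_bounded v -> poly_bounded (fun k => u k * v k).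
Proof.
move=> [C [m [C0 hu]]] [D [l [D0 hv]]]; exists (C * D), (m + l)%N; split; first exact: mulr_ge0.
move=> k; have /andP[u0 u1] := hu k; have /andP[v0 v1] := hv k.
by rewrite mulr_ge0//= exprD mulrACA ler_pM.
Qed.

Lemma poly_boundedX u i : poly_bounded u -> poly_bounded (fun k => u k ^+ i).
Proof.
move=> hu; elim: i => [|i ih]; first exact: (poly_bounded_cst ler01).
under eq_fun do rewrite exprS; exact: poly_boundedM.
Qed.

Lemma poly_boundedD u v : poly_bounded u -> poly_bounded v -> poly_bounded (fun k => u k + v k).
Proof.
move=> [C [m [C0 hu]]] [D [l [D0 hv]]]; exists (C + D), (m + l)%N; split; first exact: addr_ge0.
move=> k; have /andP[u0 u1] := hu k; have /andP[v0 v1] := hv k.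
have k1 : (1 : R) <= k.+1%:R by rewrite ler1n.
rewrite addr_ge0//= mulrDl exprD; apply: lerD.
  by apply: (le_trans u1); rewrite ler_wpM2l// ler_peMr ?exprn_ge0// exprn_ege1.
by apply: (le_trans v1); rewrite ler_wpM2l// ler_peMl ?exprn_ge0// exprn_ege1.
Qed.

Lemma poly_bounded_powR u (r : R) : 0 <= r -> poly_bounded u -> poly_bounded (fun k => u k `^ r).
Proof.
move=> r0 [C [m [C0 hu]]]; pose M := (Num.truncn (m%:R * r)).+1.
exists (C `^ r), M; split; first exact: powR_ge0.
move=> k; have /andP[u0 u1] := hu k; rewrite powR_ge0/=.
have k1 : (1 : R) <= k.+1%:R by rewrite ler1n.
apply: (@le_trans _ _ ((C * k.+1%:R ^+ m) `^ r)).
  by apply: ge0_ler_powR; rewrite ?nnegrE ?mulr_ge0 ?exprn_ge0.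
rewrite powRM ?exprn_ge0// ler_wpM2l ?powR_ge0// -!powR_mulrn// -powRrM.
by apply: ler_powR => //; rewrite ltW// truncnS_gt.
Qed.

End polynomial_growth.

Lemma powR_ge1 {R : realType} (a r : R) : 1 <= a -> 0 <= r -> 1 <= a `^ r.
Proof. by move=> a1 r0; rewrite -[leLHS](powRr0 a) ler_powR. Qed.

Lemma powR_exprn {R : realType} (a r : R) j : 0 <= a -> (a ^+ j) `^ r = (a `^ r) ^+ j.
Proof.
by move=> a0; rewrite -powR_mulrn// -powRrM mulrC powRrM powR_mulrn ?powR_ge0.
Qed.

(** * Powers and polynomials of functions in the algebra *)

Section chebyshev_powers.
Context {R : realType} {n : nat}.
Local Notation V := ('rV[R]_n).
Local Notation m := (@mu R n).
Variables (q s : R).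
Hypotheses (q1 : 1 < q) (s0 : 0 <= s).
Implicit Types (u v : V -> R) (x xi : V).

Let q0 : 0 <= q. Proof. by rewrite ltW// (lt_trans _ q1). Qed.
Local Notation mu_c := (mul_cst q s).

Lemma mul_cst_ge1 : 1 <= mu_c.
Proof.
rewrite /mul_cst; have : 1 <= (8 * wt_cst s) `^ q.
  have h : 1 <= 8 * wt_cst s.
    have : 1 <= wt_cst s by apply: powR_ge1; rewrite ?ler1n.
    by lra.
  exact: powR_ge1.
by lra.
Qed.

(** Large enough that each of the two terms produced by [repA_mul] in the induction of [repA_exp]
    takes at most half of the next power. *)
Definition pow_cst := 2 * mu_c * 2 `^ q.

Let two_q : 1 <= 2 `^ q :> R.
Proof. by apply: powR_ge1; rewrite ?ler1n. Qed.

Lemma pow_cst_gt0 : 0 < pow_cst.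
Proof. by rewrite /pow_cst; have := mul_cst_ge1; have := two_q; nra. Qed.

(** In [repA_mul] each term has one weighted factor, so the weighted bound [be] occurs once and all
    other factors contribute the [L^1]-bound [al]. Smallness of [al] alone therefore beats the
    constants. *)
Lemma repA_exp u (al be : R) j : 0 < al -> 0 <= be -> repA q s u al be ->
  repA q s (fun x => u x ^+ j.+1) ((2 * al) ^+ j.+1) (be * (pow_cst * al `^ q) ^+ j).
Proof.
move=> al0 be0 ru; elim: j => [|j ih].
  rewrite expr0 mulr1; under [X in repA _ _ X]eq_fun do rewrite expr1.
  by apply: repA_le ru => //; rewrite expr1; lra.
have p0 : 0 < (2 * al) ^+ j.+1 by rewrite exprn_gt0// mulr_gt0.
have := repA_mul q1 s0 p0 al0 ih ru.
under [X in repA _ _ X]eq_fun do rewrite -exprSr.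
apply: repA_le; first by rewrite [leRHS]exprSr; lra.
have -> : ((2 * al) ^+ j.+1) `^ q = (2 `^ q * al `^ q) ^+ j.+1.
  have al0' := ltW al0; have al2 : 0 <= 2 * al by rewrite mulr_ge0.
  by rewrite -powRM// powR_exprn.
set A := al `^ q; set W := 2 `^ q; set D := pow_cst.
have A0 : 0 <= A by exact: powR_ge0.
have -> : mu_c * (A * (be * (D * A) ^+ j) + (W * A) ^+ j.+1 * be) =
    (be * A ^+ j.+1) * (mu_c * D ^+ j + mu_c * W ^+ j.+1).
  by rewrite !exprMn !exprS; ring.
have -> : be * (D * A) ^+ j.+1 = (be * A ^+ j.+1) * D ^+ j.+1 by rewrite exprMn; ring.
apply: ler_wpM2l; first by rewrite mulr_ge0// exprn_ge0.
have M1 := mul_cst_ge1; have W1 : 1 <= W := two_q.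
have D0 := pow_cst_gt0.
have h1 : mu_c * D ^+ j <= D ^+ j.+1 / 2.
  have -> : D ^+ j.+1 / 2 = (D / 2) * D ^+ j by rewrite exprS; ring.
  apply: ler_wpM2r; first by rewrite exprn_ge0 ?(ltW D0).
  rewrite /D /pow_cst -/W; nra.
have h2 : mu_c * W ^+ j.+1 <= D ^+ j.+1 / 2.
  have -> : D ^+ j.+1 / 2 = ((2 * mu_c) ^+ j.+1 / 2) * W ^+ j.+1.
    by rewrite /D /pow_cst -/W exprMn; ring.
  apply: ler_wpM2r; first by rewrite exprn_ge0// (le_trans ler01 W1).
  rewrite exprS; have : 1 <= (2 * mu_c) ^+ j by rewrite exprn_ege1//; lra.
  nra.
lra.
Qed.

Lemma repA_hartley_restrict (h hN : V -> R) a b : L1 m h -> measurable_fun setT hN ->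
  (forall xi, hN xi = h xi \/ hN xi = 0) ->
  (\int[m]_xi `|hN xi|%:E <= a%:E)%E -> (qnorm q s h <= b%:E)%E -> repA q s (hartley hN) a b.
Proof.
move=> Lh mN hN0 ha hb; have mh := L1_measurable Lh.
have hNh xi : `|hN xi| <= `|h xi| by case: (hN0 xi) => ->; rewrite ?normr0.
exists hN; split; [exact: le_L1 Lh|by []|exact: ha|].
apply: (le_trans _ hb); rewrite /qnorm; apply: ge0_leint.
- by move=> xi; rewrite lee_fin powR_ge0.
- exact: measurable_qnorm.
- exact: measurable_qnorm.
move=> xi; rewrite lee_fin; apply: ge0_ler_powR => //.
  + by rewrite nnegrE mulr_ge0// wt_ge0.
  + by rewrite nnegrE mulr_ge0// wt_ge0.
  + by apply: ler_wpM2l => //; exact: wt_ge0.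
Qed.

Lemma band_limited_exp L u i : 0 <= L -> band_limited L u ->
  band_limited (i.+1%:R * L) (fun x => u x ^+ i.+1).
Proof.
move=> L0 Lu; elim: i => [|i ih]; first by rewrite mul1r; under eq_fun do rewrite expr1.
under eq_fun do rewrite exprSr; rewrite -natr1 mulrDl mul1r.
exact: band_limitedM.
Qed.

Lemma band_limited_poly L u k (a : nat -> R) : 0 <= L -> band_limited L u ->
  band_limited (k%:R * L) (fun x => \sum_(i < k) a i * u x ^+ i.+1).
Proof.
move=> L0 Lu; apply: (band_limited_sum _ (F := fun (i : 'I_k) x => a i * u x ^+ i.+1)) => i.
apply: band_limitedZ; apply: band_limited_le (band_limited_exp i L0 Lu).
by rewrite ler_wpM2r// ler_nat.
Qed.

Lemma size_chebT k : (size (chebT k : {poly R}) <= k.+1)%N.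
Proof.
move: k; apply: nat_ind2 => [||k h1 h2].
- by rewrite /chebT/= size_poly1.
- by rewrite /chebT/= size_polyX.
rewrite /chebT recpolySS -/chebT (leq_trans (size_polyD _ _))// geq_max size_polyN.
rewrite (leq_trans h1) ?andbT; last by rewrite !ltnS leqW.
rewrite -mulrA mul_polyC (leq_trans (size_scale_leq _ _))// (leq_trans (size_polyMleq _ _))//.
by rewrite size_polyX.
Qed.

Lemma size_nderivn_le (p : {poly R}) j k : (size p <= k)%N -> (size p^`N(j) <= k)%N.
Proof.
move=> pk; apply/leq_sizeP => i ki; rewrite coef_nderivn nth_default ?mul0rn//.
by rewrite (leq_trans pk)// (leq_trans ki)// leq_addl.
Qed.

End chebyshev_powers.

(** * A single Chebyshev polynomial, expanded around the truncation *)

Section chebyshev_truncated.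
Context {R : realType} {n : nat}.
Local Notation V := ('rV[R]_n).
Local Notation m := (@mu R n).
Variables (q s : R) (h hN : V -> R) (c d a0 b0 N ka K1 : R) (k : nat).
Hypotheses (n0 : (0 < n)%N) (q1 : 1 < q) (s0 : 0 <= s) (Lh : L1 m h).
Hypotheses (mN : measurable_fun setT hN) (hNN : forall xi, `|hN xi| <= N).
Hypotheses (hNs : forall xi, N < `|xi| -> hN xi = 0) (N1 : 1 <= N).
Hypothesis hN0 : forall xi, hN xi = h xi \/ hN xi = 0.
Hypotheses (ha : (\int[m]_xi `|h xi|%:E <= a0%:E)%E) (hb : (qnorm q s h <= b0%:E)%E).
Hypotheses (a00 : 0 <= a0) (b00 : 0 <= b0) (d0 : 0 < d) (cd : `|c| <= d).
Hypothesis ka0 : 0 < ka.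
Let al := ka / k.+1%:R ^+ 4.
Hypothesis hr : (\int[m]_xi `|(h xi - hN xi)%R|%:E <= (al * d)%:E)%E.
Hypothesis hY : forall x, `|hartley hN x - c| <= d.

Let q0 : 0 <= q. Proof. by rewrite ltW// (lt_trans _ q1). Qed.
Let k1 : (1 : R) <= k.+1%:R. Proof. by rewrite ler1n. Qed.
Let kp : (0 : R) < k.+1%:R. Proof. by []. Qed.
Let mh := L1_measurable Lh.
Let al0 : 0 < al. Proof. by rewrite divr_gt0// exprn_gt0. Qed.

Let LN : L1 m hN.
Proof. by apply: (le_L1 mN _ Lh) => xi; case: (hN0 xi) => ->; rewrite ?normr0. Qed.

Let hNh xi : `|hN xi| <= `|h xi|.
Proof. by case: (hN0 xi) => ->; rewrite ?normr0. Qed.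

(** [Y + rho] is the rescaled function, [Y] its truncation and [y0] the point that corresponds to
    the value 0. The difference [u] of [Y] and [y0] is a Hartley transform, whereas [Y] contains a
    constant. *)
Let u x := hartley hN x / d.
Let Y x := (hartley hN x - c) / d.
Let y0 := - c / d.
Let rho x := (hartley h x - hartley hN x) / d.

Let YE x : Y x = y0 + u x. Proof. by rewrite /Y /y0 /u -mulrDl addrC. Qed.

Let YBy0 x : Y x - y0 = u x. Proof. by rewrite YE addrC addKr. Qed.

Let Y1 x : -1 <= Y x <= 1.
Proof.
by rewrite -ler_norml normrM normfV (gtr0_norm d0) ler_pdivrMr// mul1r.
Qed.

Let y01 : -1 <= y0 <= 1.
Proof. by rewrite -ler_norml normrM normfV (gtr0_norm d0) ler_pdivrMr// mul1r normrN. Qed.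

Definition be_cst := d^-1 `^ q * b0.
Local Notation be := be_cst.

Let be0 : 0 <= be. Proof. by rewrite mulr_ge0// powR_ge0. Qed.

Let rep_rho : repA q s rho al be.
Proof.
have Lr := L1B Lh LN.
have hr0 xi : h xi - hN xi = h xi \/ h xi - hN xi = 0.
  by case: (hN0 xi) => ->; [right; rewrite subrr|left; rewrite subr0].
have := repA_scale s0 d^-1 (repA_hartley_restrict q1 s0 Lh (L1_measurable Lr) hr0 hr hb).
have -> : (fun x => d^-1 * hartley (fun xi => h xi - hN xi) x) = rho.
  apply/funext => x; rewrite /rho mulrC; congr (_ / _).
  rewrite -RintegralB//; [|exact: L1_cas|exact: L1_cas].
  by apply: eq_Rintegral => xi _; rewrite mulrBl.
by rewrite gtr0_norm ?invr_gt0// mulrC mulfK ?gt_eqF.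
Qed.

Let n1N : (\int[m]_xi `|hN xi|%:E <= a0%:E)%E.
Proof.
by apply: (le_trans _ ha); apply: ge0_leint => //; exact: measurable_absE.
Qed.

Let rep_u : repA q s u (a0 / d) be.
Proof.
have := repA_scale s0 d^-1 (repA_hartley_restrict q1 s0 Lh mN hN0 n1N hb).
have -> : (fun x => d^-1 * hartley hN x) = u by apply/funext => x; rewrite mulrC.
by rewrite gtr0_norm ?invr_gt0// [_ * a0]mulrC.
Qed.

(** The shape of the bound in [band_limited_repW] for [a = n + 1] and band limit [(k + 1) N], the
    degree in [u] being at most [k + 1]. The last factor comes from [sqr_hartleyN], with the
    Plancherel constant cancelled; the summand 1 makes the whole at least 1. *)
Definition wt_bound := 1 + \int[m]_xi jbracket xi `^ (- n.+1%:R) +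
  (n.+1%:R * (1 + k.+1%:R * N)) `^ (2 * s + n.+1%:R) * (N * a0 / d ^+ 2).
Local Notation Z := wt_bound.

Let Z1 : 1 <= Z.
Proof.
rewrite /wt_bound -addrA lerDl addr_ge0//.
  by apply: Rintegral_ge0 => xi _; exact: powR_ge0.
by rewrite mulr_ge0 ?powR_ge0// !mulr_ge0 ?invr_ge0 ?exprn_ge0 ?(ltW d0)// (le_trans ler01).
Qed.

(** Plancherel and [hN ^ 2 <= N |hN|]: this is where the truncation in height is used. *)
Let sqr_hartleyN : (\int[m]_x (hartley hN x ^+ 2)%:E <=
  (\int[m]_z pker z * (N * a0))%:E)%E.
Proof.
apply: (le_trans (plancherel_le LN hNN)); rewrite lee_fin ler_wpM2l ?(ltW Rintegral_pker_gt0)//.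
have L2 := L1_sqr LN hNN; have N0 : 0 <= N by rewrite (le_trans ler01).
rewrite -lee_fin /Rintegral fineK; last exact: (integrable_fin_num measurableT L2).
apply: (@le_trans _ _ (\int[m]_xi (N%:E * `|hN xi|%:E))%E).
  apply: ge0_leint.
  - by move=> xi; rewrite lee_fin sqr_ge0.
  - by apply/measurable_EFinP; exact: L1_measurable L2.
  - by apply: emeasurable_funM => //; exact: measurable_absE.
  - by move=> xi; rewrite -EFinM lee_fin -real_normK ?num_real// expr2 ler_wpM2r.
rewrite ge0_integralZl//; last exact: measurable_absE.
by rewrite EFinM lee_wpmul2l.
Qed.

(* [u] is the truncation of the function, rescaled, and the sum is a polynomial in
   [u] without constant term: it is band-limited and dominated by [u], hence
   square-integrable. *)
Lemma repW_poly (a : nat -> R) (K : R) j :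
  (forall x, `|\sum_(i < k.+1) a i * u x ^+ i.+1| <= K * `|u x|) ->
  0 <= K <= k.+1%:R ^+ (2 * j.+2) ->
  repW s (fun x => \sum_(i < k.+1) a i * u x ^+ i.+1) (k.+1%:R ^+ (4 * j.+2) * Z).
Proof.
move=> hK /andP[K0 Kk].
have N0 : 0 <= N by rewrite (le_trans ler01).
have bu : band_limited N u.
  have : band_limited N (hartley hN) by exists hN, N.
  by move=> /(band_limitedZ d^-1); apply: eq_band_limited => x; rewrite mulrC.
have bl := band_limited_poly k.+1 a N0 bu.
have L0 : 0 <= k.+1%:R * N by rewrite mulr_ge0.
pose S := K ^+ 2 / d ^+ 2 * (\int[m]_z pker z * (N * a0)).
have c0 := @Rintegral_pker_gt0 R n.
have hS : (\int[m]_x ((\sum_(i < k.+1) a i * u x ^+ i.+1) ^+ 2)%:E <= S%:E)%E.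
  have mH := measurable_hartley LN.
  have mu' : measurable_fun setT u by apply: measurable_funM.
  have Kd0 : 0 <= K ^+ 2 / d ^+ 2 by rewrite divr_ge0// exprn_ge0// ltW.
  apply: (@le_trans _ _ (\int[m]_x ((K ^+ 2 / d ^+ 2)%:E * (hartley hN x ^+ 2)%:E))%E).
    apply: ge0_leint.
    - by move=> x; rewrite lee_fin sqr_ge0.
    - apply/measurable_EFinP; apply: measurable_funX; apply: measurable_sum => i.
      by apply: measurable_funM => //; exact: measurable_funX.
    - by apply: emeasurable_funM => //; apply/measurable_EFinP; exact: measurable_funX.
    - move=> x; rewrite -EFinM lee_fin; have := hK x; set A := \sum_(_ < _) _ => hA.
      rewrite -[A ^+ 2]real_normK ?num_real//.
      apply: (@le_trans _ _ ((K * `|u x|) ^+ 2)); first by rewrite lerXn2r ?nnegrE ?mulr_ge0.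
      have -> : (K * `|u x|) ^+ 2 = K ^+ 2 / d ^+ 2 * hartley hN x ^+ 2; last by [].
      by rewrite exprMn real_normK ?num_real// /u; field; rewrite gt_eqF.
  rewrite ge0_integralZl//.
  - rewrite /S [in leRHS]EFinM; apply: lee_wpmul2l => //.
  - by apply/measurable_EFinP; exact: measurable_funX.
  - by move=> x _; rewrite lee_fin sqr_ge0.
have nlt : n%:R < n.+1%:R :> R by rewrite ltr_nat.
have [g [Lg ug gc]] := band_limited_repW n0 s0 nlt L0 bl hS.
exists g; split; [by []|by []|apply: (le_trans gc); rewrite lee_fin].
have X0 := powR_ge0 (n.+1%:R * (1 + k.+1%:R * N)) (2 * s + n.+1%:R).
rewrite /wt_bound; move: X0; set X := _ `^ (2 * s + _) => X0.
set J := \int[m]_xi _; have J0 : 0 <= J by apply: Rintegral_ge0 => xi _; exact: powR_ge0.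
set M := k.+1%:R ^+ (4 * j.+2).
have M1 : 1 <= M by rewrite exprn_ege1.
have KM : K ^+ 2 <= M.
  have := @lerXn2r R 2 K (k.+1%:R ^+ (2 * j.+2)); rewrite !nnegrE exprn_ge0// => /(_ K0 isT Kk).
  by rewrite -exprM mulnAC.
have T0 : 0 <= N * a0 / d ^+ 2 by rewrite !mulr_ge0 ?invr_ge0 ?exprn_ge0 ?(ltW d0).
have -> : S / \int[m]_z pker z = K ^+ 2 * (N * a0 / d ^+ 2).
  by rewrite /S; field; rewrite !gt_eqF.
move: T0; set T := N * a0 / d ^+ 2 => T0.
have : X * (K ^+ 2 * T) <= X * (M * T) by rewrite ler_wpM2l// ler_wpM2r.
have : J <= M * J by rewrite ler_peMl.
have -> : M * (1 + J + X * T) = M + M * J + X * (M * T) by ring.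
lra.
Qed.

Let T : {poly R} := chebT k.

Let kX i j : (i <= j)%N -> k%:R ^+ i <= k.+1%:R ^+ j :> R.
Proof.
move=> ij; apply: (@le_trans _ _ (k.+1%:R ^+ i)).
  by rewrite lerXn2r ?nnegrE// ler_nat.
exact: ler_weXn2l.
Qed.

(** The bound of [repW_poly] for [j = 0], shared by the head and the first term of the tail. *)
Definition W_bound := k.+1%:R ^+ 8 * Z.
(** In [combine], [2 ^ q] comes from the sum, [mul_cst] from the multiplier and 1 from the
    scalar. *)
Definition Q_cst := 2 `^ q * (mul_cst q s + 1).

Let Zp : 0 < Z. Proof. exact: lt_le_trans ltr01 Z1. Qed.

Let combine (v w : V -> R) (cj aj bj t : R) : 0 < cj -> 0 <= aj -> 0 <= bj ->
  repW s v cj -> repA q s w aj bj -> `|t| <= cj ->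
  repA q s (fun x => v x * w x + t * w x) (3 * (cj * aj)) (Q_cst * (cj `^ q * bj)).
Proof.
move=> c0 a0' b0' hv hw ht.
have h1 := repW_mul q1 s0 c0 hv hw; have h2 := repA_scale s0 t hw.
apply: repA_le (repA_add q1 s0 h1 h2).
  have hta : `|t| * aj <= cj * aj by exact: ler_wpM2r.
  by lra.
rewrite /Q_cst -mulrA ler_wpM2l ?powR_ge0// mulrDl mul1r lerD2l ler_wpM2r//.
by apply: ge0_ler_powR; rewrite ?nnegrE ?(ltW c0).
Qed.

Let sizeT : (size T <= k.+1)%N. Proof. exact: size_chebT. Qed.

Let taylor (p : {poly R}) x : (size p <= k.+1)%N ->
  p.[Y x] - p.[y0] = \sum_(i < k.+1) (p^`N(i.+1)).[y0] * u x ^+ i.+1.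
Proof.
move=> sp; have sp2 : (size p <= k.+2)%N by rewrite (leq_trans sp).
rewrite YE (nderiv_taylor_wide (mulrC y0 (u x)) sp2) big_ord_recl nderivn0 expr0 mulr1 addrC addKr.
by apply: eq_bigr.
Qed.

(* The value at [Y x] is the value at [y0] plus a band-limited square-integrable
   function: constants act on the algebra but are not in it. *)
Let rep_term j : repA q s (fun x => (T^`N(j.+1)).[Y x] * rho x ^+ j.+1)
  (3 * ((k.+1%:R ^+ (4 * j.+2) * Z) * (2 * al) ^+ j.+1))
  (Q_cst * ((k.+1%:R ^+ (4 * j.+2) * Z) `^ q * (be * (pow_cst q s * al `^ q) ^+ j))).
Proof.
set p := T^`N(j.+1); have sp : (size p <= k.+1)%N by exact: size_nderivn_le.
pose a i := (p^`N(i.+1)).[y0].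
have hW : repW s (fun x => \sum_(i < k.+1) a i * u x ^+ i.+1) (k.+1%:R ^+ (4 * j.+2) * Z).
  apply: (@repW_poly a (k%:R ^+ (2 * j.+2))); last by rewrite exprn_ge0//= kX.
  move=> x; rewrite -taylor//; have := chebT_nderivn_lipschitz k j.+1 (Y1 x) y01.
  by rewrite YBy0.
have pc := pow_cst_gt0 q1 s0.
have := @combine _ _ _ _ _ p.[y0] _ _ _ hW (repA_exp q1 s0 j al0 be0 rep_rho) _.
have -> : (fun x => (\sum_(i < k.+1) a i * u x ^+ i.+1) * rho x ^+ j.+1 + p.[y0] * rho x ^+ j.+1) =
    (fun x => p.[Y x] * rho x ^+ j.+1).
  by apply/funext => x; rewrite -mulrDl -taylor// subrK.
apply.
- by rewrite mulr_gt0// exprn_gt0.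
- by rewrite exprn_ge0// mulr_ge0// ltW.
- by rewrite mulr_ge0// exprn_ge0// mulr_ge0 ?powR_ge0// ltW.
- apply: (le_trans (chebT_nderivn_le k j.+1 y01)).
  apply: (@le_trans _ _ (k.+1%:R ^+ (4 * j.+2))); last by rewrite ler_peMr ?exprn_ge0.
  by apply: kX; rewrite leq_mul.
Qed.

(** A multiplier alone does not belong to the algebra, so one factor [u] is split off from the
    Taylor polynomial at [y0]: what is left is a constant, the first derivative, plus a polynomial
    in [u] without constant term, which [chebT_taylor2] bounds by a multiple of [|u|]. *)
Let rep_head : repA q s (fun x => T.[Y x] - T.[y0])
  (3 * (W_bound * (a0 / d))) (Q_cst * (W_bound `^ q * be)).
Proof.
pose a i := (T^`N(i.+2)).[y0].
have TE x : T.[Y x] - T.[y0] = (\sum_(i < k.+1) a i * u x ^+ i.+1) * u x + T^`().[y0] * u x.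
  have sp2 : (size T <= k.+3)%N by rewrite (leq_trans sizeT)// ltnW.
  rewrite YE (nderiv_taylor_wide (mulrC y0 (u x)) sp2) big_ord_recl nderivn0 expr0 mulr1 addrC addKr.
  rewrite big_ord_recl /= nderivn1 expr1 addrC; congr (_ + _).
  by rewrite mulr_suml; apply: eq_bigr => i _; rewrite -mulrA -exprSr.
have hW : repW s (fun x => \sum_(i < k.+1) a i * u x ^+ i.+1) W_bound.
  apply: (@repW_poly a (k%:R ^+ 4) 0); last by rewrite exprn_ge0//= kX.
  move=> x; have [u0|u0] := eqVneq (u x) 0.
    by rewrite u0 normr0 mulr0 big1 ?normr0// => i _; rewrite expr0n mulr0.
  rewrite -(ler_pM2r (x := `|u x|)) ?normr_gt0// -normrM -mulrA -expr2.
  have := chebT_taylor2 k (Y1 x) y01; rewrite -/T TE.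
  by rewrite YBy0 addrK.
have := @combine _ _ _ _ _ T^`().[y0] _ _ _ hW rep_u _.
under eq_fun do rewrite -TE; apply.
- by rewrite mulr_gt0// exprn_gt0.
- by rewrite divr_ge0// ltW.
- by [].
- have := chebT_derivn_le k 1 y01; rewrite derivn1 => /le_trans; apply.
  apply: (@le_trans _ _ (k.+1%:R ^+ 8)); last by rewrite ler_peMr ?exprn_ge0.
  exact: kX.
Qed.

(** These make the two series of [rep_tail] geometric with ratio at most one half. The factor
    [4 ^ q] absorbs the weight [(j + 1) ^ 2] of [repA_series], which is at most [4 ^ j]. *)
Hypotheses (ka4 : 2 * ka <= 2^-1) (kaq : 4 `^ q * (pow_cst q s * ka `^ q) <= 2^-1).

Let geom (z : R) M : 0 <= z <= 2^-1 -> \sum_(0 <= j < M) z ^+ j <= 2.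
Proof.
move=> /andP[z0 z1]; apply: (@le_trans _ _ (2 - 2 * z ^+ M)); last first.
  by rewrite lerBlDr lerDl mulr_ge0 ?exprn_ge0.
elim: M => [|M ih]; first by rewrite big_nil expr0 mulr1 subrr.
rewrite big_nat_recr//= exprS; have := exprn_ge0 M z0; nra.
Qed.

Let alk : k.+1%:R ^+ 4 * al = ka.
Proof. by rewrite /al mulrC divfK// expf_neq0. Qed.

(** Taylor expansion in [rho], in effect a finite sum. As [al = ka / (k + 1) ^ 4], the factor
    [(k + 1) ^ (4 (j + 2))] of the [j]-th term leaves only a fixed power of [k + 1] times a
    geometric term in [ka]. *)
Let rep_tail : repA q s (fun x => T.[Y x + rho x] - T.[Y x])
  (3 * (k.+1%:R ^+ 4 * Z)) (2 `^ q * (Q_cst * (W_bound `^ q * be) * 2)).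
Proof.
have P0 := pow_cst_gt0 q1 s0.
apply: (repA_series q1 s0 rep_term).
- move=> M; have -> : \sum_(0 <= j < M) 3 * (k.+1%:R ^+ (4 * j.+2) * Z * (2 * al) ^+ j.+1) =
      3 * (k.+1%:R ^+ 4 * Z) * ((2 * ka) * \sum_(0 <= j < M) (2 * ka) ^+ j).
    rewrite !mulr_sumr; apply: eq_bigr => j _; rewrite -exprS -alk.
    rewrite mulnS exprD exprM !exprMn; ring.
  rewrite -[leRHS]mulr1 ler_wpM2l ?mulr_ge0 ?exprn_ge0 ?(ltW Zp)//.
  have ka2 : 0 <= 2 * ka <= 2^-1 by rewrite mulr_ge0 ?(ltW ka0).
  by have := geom M ka2; have := ltW ka0; nra.
- move=> M; set th := pow_cst q s * ka `^ q.
  have th0 : 0 <= th by rewrite mulr_ge0 ?powR_ge0 ?(ltW P0).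
  have E j : Q_cst * ((k.+1%:R ^+ (4 * j.+2) * Z) `^ q * (be * (pow_cst q s * al `^ q) ^+ j)) =
      Q_cst * (W_bound `^ q * be) * th ^+ j.
    have -> : k.+1%:R ^+ (4 * j.+2) * Z = W_bound * (k.+1%:R ^+ 4) ^+ j.
      by rewrite /W_bound -exprM !mulnS addnA exprD mulrAC.
    rewrite powRM ?mulr_ge0 ?exprn_ge0 ?(ltW Zp)// powR_exprn ?exprn_ge0//.
    rewrite /th -alk powRM ?exprn_ge0 ?(ltW al0)// !exprMn; ring.
  set B := Q_cst * (W_bound `^ q * be).
  have B0 : 0 <= B.
    by rewrite !mulr_ge0 ?powR_ge0 ?addr_ge0 ?mul_cst_ge0.
  apply: (@le_trans _ _ (\sum_(0 <= j < M) B * (4 `^ q * th) ^+ j)); last first.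
    by rewrite -mulr_sumr ler_wpM2l// geom// mulr_ge0 ?powR_ge0.
  apply: ler_sum => j _; rewrite E -/B mulrCA; apply: ler_wpM2l => //.
  rewrite [(4 `^ q * th) ^+ j]exprMn; apply: ler_wpM2r; first exact: exprn_ge0.
  rewrite -powR_exprn//; apply: ge0_ler_powR; rewrite ?nnegrE ?exprn_ge0//.
  rewrite (_ : 4 = 2 ^+ 2); last by ring.
  by rewrite -exprM mulnC exprM lerXn2r ?nnegrE ?exprn_ge0// -natrX ler_nat ltn_expl.
- move=> x; apply: cvg_near_cst; exists k.+1 => // M /= kM.
  have sp : (size T <= M.+1)%N by rewrite (leq_trans sizeT)// ltnW.
  rewrite (nderiv_taylor_wide (mulrC (Y x) (rho x)) sp) big_ord_recl nderivn0 expr0 mulr1.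
  by rewrite addrC addKr big_mkord; apply: eq_bigr.
Qed.

Lemma repA_chebT_truncated :
  repA q s (fun x => T.[(hartley h x - c) / d] - T.[y0])
    (3 * (k.+1%:R ^+ 4 * Z) + 3 * (W_bound * (a0 / d)))
    (2 `^ q * (2 `^ q * (Q_cst * (W_bound `^ q * be) * 2) + Q_cst * (W_bound `^ q * be))).
Proof.
have := repA_add q1 s0 rep_tail rep_head.
have -> : (fun x => T.[Y x + rho x] - T.[Y x] + (T.[Y x] - T.[y0])) =
    (fun x => T.[(hartley h x - c) / d] - T.[y0]); last by [].
apply/funext => x; rewrite addrA subrK; congr (T.[_] - _).
by rewrite /Y /rho -mulrDl; congr (_ / _); ring.
Qed.

End chebyshev_truncated.

(** * Polynomial growth in the degree and summation of the expansion *)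

Section functional_calculus.
Context {R : realType} {n : nat}.
Local Notation V := ('rV[R]_n).
Local Notation m := (@mu R n).
Variables (q s : R) (h : V -> R) (c d e : R).
Hypotheses (n0 : (0 < n)%N) (q1 : 1 < q) (hs : n%:R / conj_exp q < s).
Hypotheses (Lh : L1 m h) (hq : (qnorm q s h < +oo)%E).
Hypotheses (e0 : 0 < e <= d) (cd : `|c| <= d).
Hypothesis hY : forall x, `|hartley h x - c| <= d - e.

Let s0 : 0 <= s.
Proof. by rewrite ltW// (le_lt_trans _ hs)// divr_ge0// ltW// conj_exp_gt0. Qed.

Let q0 : 0 <= q. Proof. by rewrite ltW// (lt_trans _ q1). Qed.
Let d0 : 0 < d. Proof. by case/andP: e0 => /lt_le_trans; apply. Qed.

Lemma repA_chebT : exists a b : nat -> R, [/\ poly_bounded a, poly_bounded b &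
  forall k, repA q s (fun x => (chebT k).[(hartley h x - c) / d] - (chebT k).[- c / d])
    (a k) (b k)].
Proof.
have [tau tau0 [C hC]] := truncation n0 q1 hs Lh hq.
have /andP[ep ed] := e0.
pose a0 := fine (\int[m]_xi `|h xi|%:E)%E; pose b0 := fine (qnorm q s h).
have ha : (\int[m]_xi `|h xi|%:E <= a0%:E)%E.
  by rewrite fineK//; exact: (integrable_fin_num measurableT (L1_norm Lh)).
have hb : (qnorm q s h <= b0%:E)%E by rewrite fineK// ge0_fin_numE ?qnorm_ge0.
have a00 : 0 <= a0 by rewrite fine_ge0// integral_ge0.
have b00 : 0 <= b0 by rewrite fine_ge0// qnorm_ge0.
have P0 := pow_cst_gt0 q1 s0.
(* The value of [ka] for which the condition [kaq] becomes an equality. *)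
pose r := (2 * 4 `^ q * pow_cst q s)^-1 `^ q^-1.
have q4 : 0 < 4 `^ q :> R by rewrite powR_gt0.
have X0 : 0 < 2 * 4 `^ q * pow_cst q s by apply: mulr_gt0 => //; exact: mulr_gt0.
have r0 : 0 < r by apply: powR_gt0; rewrite invr_gt0.
(* The three entries serve [ka4], [kad] and [kaq]; the middle one keeps the truncation within the
   margin [e], the factor 2 being the bound of [cas]. *)
pose ka := Num.min 4^-1 (Num.min (e / (2 * d)) r).
have ka0 : 0 < ka by rewrite !lt_min invr_gt0 divr_gt0 ?mulr_gt0//= r0 ltr0n.
have ka4 : 2 * ka <= 2^-1.
  have : ka <= 4^-1 by rewrite ge_min lexx.
  by lra.
have kad : 2 * (ka * d) <= e.
  have : ka <= e / (2 * d) by rewrite !ge_min lexx orbT.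
  by rewrite ler_pdivlMr ?mulr_gt0//; nra.
have kaq : 4 `^ q * (pow_cst q s * ka `^ q) <= 2^-1.
  have : ka `^ q <= r `^ q.
    by apply: ge0_ler_powR; rewrite ?nnegrE ?(ltW ka0) ?(ltW r0)// !ge_min lexx !orbT.
  have qn : q != 0 by rewrite gt_eqF// (lt_trans _ q1).
  rewrite /r -powRrM mulVf// powRr1 ?invr_ge0 ?(ltW X0)// => h1.
  have -> : 2^-1 = 4 `^ q * (pow_cst q s * (2 * 4 `^ q * pow_cst q s)^-1).
    by field; rewrite !gt_eqF.
  by rewrite !ler_wpM2l ?(ltW q4) ?(ltW P0).
(* [N k] solves [C' N ^ -tau = ka d / (k + 1) ^ 4]. Using [|C|] makes the sign of [C] irrelevant,
   and the added [ka * d] ensures [N k >= 1]. *)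
pose C' := `|C| + ka * d.
have kd0 : 0 < ka * d by rewrite mulr_gt0.
pose base k : R := C' / (ka * d) * k.+1%:R ^+ 4.
have C'1 : 1 <= C' / (ka * d) by rewrite ler_pdivlMr// mul1r lerDr.
have base1 k : 1 <= base k by rewrite /base mulr_ege1// exprn_ege1// ler1n.
pose N k := base k `^ tau^-1.
have N1 k : 1 <= N k by rewrite powR_ge1// invr_ge0 ltW.
have hN k : C * N k `^ (- tau) <= ka / k.+1%:R ^+ 4 * d.
  have K0 : 0 < k.+1%:R ^+ 4 :> R by rewrite exprn_gt0.
  rewrite /N -powRrM mulrN mulVf ?gt_eqF// powR_inv1 ?(le_trans ler01)//.
  rewrite ler_pdivrMr ?(lt_le_trans ltr01)// /base.
  have -> : ka / k.+1%:R ^+ 4 * d * (C' / (ka * d) * k.+1%:R ^+ 4) = C'.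
    by field; rewrite !gt_eqF.
  by rewrite (le_trans (ler_norm C))// lerDl ltW.
have pN : poly_bounded N.
  apply: poly_bounded_powR; first by rewrite invr_ge0 ltW.
  apply: poly_boundedM; first by apply: poly_bounded_cst; rewrite (le_trans ler01).
  exact/poly_boundedX/poly_bounded_succ.
pose Z k := @wt_bound R n s d a0 (N k) k.
pose W k := @W_bound R n s d a0 (N k) k.
have pZ : poly_bounded Z.
  rewrite /Z /wt_bound; apply: poly_boundedD.
    apply: poly_bounded_cst; rewrite addr_ge0//.
    by apply: Rintegral_ge0 => xi _; exact: powR_ge0.
  apply: poly_boundedM.
    apply: poly_bounded_powR; first by rewrite addr_ge0// mulr_ge0.
    apply: poly_boundedM; first exact: poly_bounded_cst.
    apply: poly_boundedD; first exact: poly_bounded_cst.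
    by apply: poly_boundedM => //; exact: poly_bounded_succ.
  under eq_fun do rewrite -mulrA; apply: poly_boundedM => //.
  by apply: poly_bounded_cst; rewrite divr_ge0// exprn_ge0// ltW.
have pW : poly_bounded W.
  by apply: poly_boundedM => //; exact/poly_boundedX/poly_bounded_succ.
exists (fun k => 3 * (k.+1%:R ^+ 4 * Z k) + 3 * (W k * (a0 / d))),
  (fun k => 2 `^ q * (2 `^ q * (Q_cst q s * (W k `^ q * be_cst q d b0) * 2) +
     Q_cst q s * (W k `^ q * be_cst q d b0))).
have p3 : poly_bounded (fun=> 3 : R) by exact: poly_bounded_cst.
have p2q : poly_bounded (fun=> 2 `^ q : R) by apply: poly_bounded_cst; exact: powR_ge0.
have pQ : poly_bounded (fun k => Q_cst q s * (W k `^ q * be_cst q d b0)).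
  apply: poly_boundedM.
    by apply: poly_bounded_cst; rewrite mulr_ge0 ?powR_ge0 ?addr_ge0 ?mul_cst_ge0.
  apply: poly_boundedM; first exact: poly_bounded_powR.
  by apply: poly_bounded_cst; rewrite mulr_ge0 ?powR_ge0.
split.
- apply: poly_boundedD; apply: poly_boundedM => //.
    by apply: poly_boundedM => //; exact/poly_boundedX/poly_bounded_succ.
  by apply: poly_boundedM => //; apply: poly_bounded_cst; rewrite divr_ge0// ltW.
- apply: poly_boundedM => //; apply: poly_boundedD => //.
  apply: poly_boundedM => //; apply: poly_boundedM => //; exact: poly_bounded_cst.
move=> k; have [hn [mn hnN hns hn0 hnr]] := hC (N k) (N1 k).
have hr : (\int[m]_xi `|(h xi - hn xi)%R|%:E <= (ka / k.+1%:R ^+ 4 * d)%:E)%E.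
  by apply: (le_trans hnr); rewrite lee_fin.
have Ln : L1 m hn by apply: (le_L1 mn _ Lh) => xi; case: (hn0 xi) => ->; rewrite ?normr0.
have hnY x : `|hartley hn x - c| <= d.
  have Lr := L1B Lh Ln.
  have hd : `|hartley h x - hartley hn x| <= e.
    rewrite -RintegralB//; [|exact: L1_cas|exact: L1_cas].
    have -> : \int[m]_xi (h xi * cas (dotRn x xi) - hn xi * cas (dotRn x xi)) =
        hartley (fun xi => h xi - hn xi) x.
      by apply: eq_Rintegral => xi _; rewrite mulrBl.
    apply: (le_trans (hartley_bound x Lr)); apply: le_trans kad; rewrite ler_wpM2l//.
    apply: (@le_trans _ _ (ka / k.+1%:R ^+ 4 * d)).
      rewrite -lee_fin fineK//; exact: (integrable_fin_num measurableT (L1_norm Lr)).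
    by rewrite ler_wpM2r ?(ltW d0)// ler_piMr ?(ltW ka0)// invf_le1 ?exprn_gt0// exprn_ege1// ler1n.
  have := hY x; rewrite [`|hartley h x - hartley hn x|]distrC in hd => hY'.
  by have := ler_distD (hartley h x) (hartley hn x) c; lra.
exact: (repA_chebT_truncated n0 q1 s0 Lh mn hnN hns (N1 k) hn0 ha hb a00 b00 d0 cd ka0 hr hnY ka4 kaq).
Qed.

Lemma poly_bounded_shift (u : nat -> R) : poly_bounded u -> poly_bounded (fun k => u k.+1).
Proof.
move=> [C [l [C0 hu]]]; exists (C * 2 ^+ l), l; split; first by rewrite mulr_ge0 ?exprn_ge0.
move=> k; have /andP[u0 u1] := hu k.+1; rewrite u0/= (le_trans u1)// -mulrA ler_wpM2l//.
rewrite -exprMn lerXn2r ?nnegrE ?mulr_ge0//.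
by have := ler0n R k; rewrite -(natr1 k.+1) -(natr1 k); lra.
Qed.

(** Subtracting the expansions at [y] and at [y0] removes the coefficient of index 0, and
    [phi 0 = 0] removes the value at [y0]. Polynomial growth of the norms is then compensated by the
    decay of the coefficients. *)
Lemma repA_real_analytic (I : set R) (phi : R -> R) : real_analytic I phi ->
  (forall t, `|t - c| <= d -> I t) -> phi 0 = 0 ->
  exists A B, repA q s (fun x => phi (hartley h x)) A B.
Proof.
move=> Hphi HI phi0; have [a [b [pa pb hab]]] := repA_chebT.
have [Ca [la [Ca0 ha]]] := poly_bounded_shift pa.
have [Cb [lb [Cb0 hb]]] := poly_bounded_shift pb.
have /andP[ep ed] := e0.
pose g t := phi (c + d * cos t).
(* The coefficients decrease like [k ^ -2M]. The [L^1]-sum needs an exponent of at least [la + 2];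
   the weighted sum needs [lb + 4], two of which pay for the weight in [repA_series]. *)
pose M := (la + lb + 2)%N.
have HI' t : `|t - c| <= `|d| -> I t by rewrite (gtr0_norm d0); exact: HI.
have [C C0 hC] := cosI_decay HI' (real_analytic_differentiable_times M.*2.+1 Hphi).
pose ga k := 2 / pi * cosI g k.+1.
have pi0 := pi_gt0 R.
pose G := 2 / pi * C.
have G0 : 0 <= G by rewrite mulr_ge0 ?divr_ge0 ?(ltW pi0).
have gaC k : `|ga k| <= G * k.+1%:R ^- M.*2.
  have tp : 0 <= 2 / pi :> R by rewrite divr_ge0// ltW.
  by rewrite /G -[leRHS]mulrA /ga normrM (ger0_norm tp); apply: ler_wpM2l => //; exact: hC.
have kpow i j k : (i + 2 <= j)%N -> k.+1%:R ^- j * k.+1%:R ^+ i <= (k.+1%:R ^+ 2)^-1 :> R.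
  move=> ij; have K0 : (0 : R) < k.+1%:R by [].
  rewrite -(subnKC ij) !exprD !invfM mulrAC [_ * k.+1%:R ^+ i]mulrAC mulVf ?mul1r ?expf_neq0 ?gt_eqF//.
  by rewrite ler_piMr ?invr_ge0 ?exprn_ge0// invf_le1 ?exprn_gt0// exprn_ege1// ler1n.
pose v k x := ga k * ((chebT k.+1).[(hartley h x - c) / d] - (chebT k.+1).[- c / d]).
have rv k : repA q s (v k) (`|ga k| * a k.+1) (`|ga k| `^ q * b k.+1).
  have := repA_scale s0 (ga k) (hab k.+1); exact.
exists (G * Ca * 2), (2 `^ q * (G `^ q * Cb * 2)).
apply: (repA_series q1 s0 rv).
- move=> L; apply: (@le_trans _ _ (\sum_(0 <= k < L) G * Ca * (k.+1%:R ^+ 2)^-1)).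
    apply: ler_sum => k _; have /andP[a0 a1] := ha k.
    apply: (@le_trans _ _ (G * k.+1%:R ^- M.*2 * (Ca * k.+1%:R ^+ la))).
      by apply: ler_pM.
    rewrite mulrACA; apply: ler_wpM2l; first exact: mulr_ge0.
    apply: kpow; rewrite /M -addnn (leq_trans _ (leq_addr _ _))// leq_add2r leq_addr//.
  rewrite -mulr_sumr; apply: ler_wpM2l; [exact: mulr_ge0|exact: sum_inv_sqr_le2].
- move=> L; apply: (@le_trans _ _ (\sum_(0 <= k < L) G `^ q * Cb * (k.+1%:R ^+ 2)^-1)).
    apply: ler_sum => k _; have /andP[b0 b1] := hb k.
    have K0 : (0 : R) < k.+1%:R by [].
    rewrite mulrA -powRM ?exprn_ge0//.
    have h1 : k.+1%:R ^+ 2 * `|ga k| <= G * k.+1%:R ^- (lb + 2).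
      apply: (@le_trans _ _ (k.+1%:R ^+ 2 * (G * k.+1%:R ^- M.*2))).
        by rewrite ler_wpM2l ?exprn_ge0.
      rewrite mulrCA ler_wpM2l//.
      have h4 : (lb + 4 <= M.*2)%N.
        rewrite -addnn (_ : lb + 4 = lb + 2 + 2)%N; last by rewrite -addnA.
        by apply: leq_add; rewrite /M ?leq_addl// leq_add2r leq_addl.
      have -> : M.*2 = (2 + ((lb + 2) + (M.*2 - (lb + 4))))%N.
        by rewrite -{1}(subnKC h4) addnA; congr (_ + _)%N; rewrite addnCA.
      rewrite exprD invfM mulrA divff ?mul1r ?expf_neq0 ?gt_eqF//.
      rewrite exprD invfM ler_piMr ?invr_ge0 ?exprn_ge0//.
      by rewrite invf_le1 ?exprn_gt0// exprn_ege1// ler1n.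
    apply: (@le_trans _ _ ((G `^ q * k.+1%:R ^- (lb + 2)) * (Cb * k.+1%:R ^+ lb))).
      apply: ler_pM; [exact: powR_ge0|exact: b0| |exact: b1].
      apply: (@le_trans _ _ ((G * k.+1%:R ^- (lb + 2)) `^ q)).
        apply: ge0_ler_powR => //; rewrite nnegrE.
          by rewrite mulr_ge0// exprn_ge0.
        by rewrite divr_ge0// exprn_ge0.
      rewrite powRM ?invr_ge0 ?exprn_ge0// ler_wpM2l ?powR_ge0//.
      apply: ge1r_powR; rewrite ?(ltW q1)// invr_gt0 exprn_gt0//=.
      by rewrite invf_le1 ?exprn_gt0// exprn_ege1// ler1n.
    rewrite mulrACA; apply: ler_wpM2l; first by rewrite mulr_ge0 ?powR_ge0.
    exact: kpow.
  rewrite -mulr_sumr; apply: ler_wpM2l; last exact: sum_inv_sqr_le2.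
  by rewrite mulr_ge0 ?powR_ge0.
move=> x; pose y := (hartley h x - c) / d; pose y0 := - c / d.
have yI : y \in `[-1, 1].
  rewrite in_itv/= -ler_norml normrM normfV (gtr0_norm d0) ler_pdivrMr// mul1r.
  by have := hY x; lra.
have y0I : y0 \in `[-1, 1].
  by rewrite in_itv/= -ler_norml normrM normfV (gtr0_norm d0) ler_pdivrMr// mul1r normrN.
have H2 := real_analytic_differentiable_times 2 Hphi.
(* At [acos y] the variable [c + d * cos t] is the value of the function, and at [acos y0] it is
   0. *)
have E1 := @cosine_expansion _ c d I phi d0 HI H2 (acos y).
have E2 := @cosine_expansion _ c d I phi d0 HI H2 (acos y0).
have dn : d != 0 by rewrite gt_eqF.
rewrite acosK// in E1; rewrite acosK// in E2.
have y0E : c + d * y0 = 0 by rewrite /y0; field.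
have yE : c + d * y = hartley h x by rewrite /y; field.
rewrite yE in E1; rewrite y0E phi0 mulr0 in E2.
have -> : phi (hartley h x) = pi^-1 * (pi * phi (hartley h x) - 0).
  by rewrite subr0 mulKf ?gt_eqF.
rewrite (_ : (fun L => \sum_(0 <= k < L) v k x) = fun L => pi^-1 *
  (cosI g 0 + 2 * \sum_(0 <= k < L) cosI g k.+1 * cos (k.+1%:R * acos y) -
   (cosI g 0 + 2 * \sum_(0 <= k < L) cosI g k.+1 * cos (k.+1%:R * acos y0)))).
  by apply: cvgMr; exact: cvgB E1 E2.
apply/funext => L; rewrite opprD addrACA subrr add0r -mulrBr -sumrB mulrA mulr_sumr.
apply: eq_bigr => k _; rewrite -!chebT_cos !acosK// -/y -/y0 /v /ga -/y -/y0.
by rewrite -mulrBr mulrA [2 / pi]mulrC.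
Qed.

End functional_calculus.

(** * Complex Fourier transforms *)

Section complex_fourier.
Context {R : realType} {n : nat}.
Local Notation V := ('rV[R]_n).
Local Notation m := (@mu R n).
Implicit Types (u v h : V -> R) (H : V -> R[i]) (x xi : V) (q s : R).

Lemma measurableRnE u : measurableRn u <-> measurable_fun [set: V] u.
Proof.
split=> [h _ B mB|h B mB]; first by rewrite setTI; exact: h.
by have := h measurableT B mB; rewrite setTI.
Qed.

Lemma cmod_ge0 (z : R[i]) : 0 <= cmod z. Proof. exact: sqrtr_ge0. Qed.

Lemma Re_le_cmod (z : R[i]) : `|complex.Re z| <= cmod z.
Proof. by rewrite -sqrtr_sqr ler_wsqrtr// lerDl sqr_ge0. Qed.

Lemma Im_le_cmod (z : R[i]) : `|complex.Im z| <= cmod z.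
Proof. by rewrite -sqrtr_sqr ler_wsqrtr// lerDr sqr_ge0. Qed.

Lemma cmod_le (z : R[i]) : cmod z <= `|complex.Re z| + `|complex.Im z|.
Proof.
rewrite -[leRHS]ger0_norm ?addr_ge0// -sqrtr_sqr ler_wsqrtr// sqrrD !real_normK ?num_real//.
by rewrite -addrAC lerDl mulrn_wge0// mulr_ge0.
Qed.

Lemma measurable_cmod H : measurable_fun [set: V] (fun xi => complex.Re (H xi)) ->
  measurable_fun [set: V] (fun xi => complex.Im (H xi)) ->
  measurable_fun [set: V] (fun xi => cmod (H xi)).
Proof.
move=> mR mI; rewrite (_ : (fun xi => _) = fun xi =>
    (complex.Re (H xi) ^+ 2 + complex.Im (H xi) ^+ 2) `^ 2^-1).
  apply: (measurableT_comp (measurable_powR _)).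
  by apply: measurable_funD; exact: measurable_funX.
by apply/funext => xi; rewrite powR12_sqrt// addr_ge0// sqr_ge0.
Qed.

Lemma Rintegral_pos_neg u : L1 m u ->
  fine (iintRn (fun x => (pospart (u x))%:E)) - fine (iintRn (fun x => (negpart (u x))%:E)) =
  \int[m]_x u x.
Proof.
move=> Lu; have mu' := L1_measurable Lu.
have mp : measurable_fun [set: V] (fun x => pospart (u x)) by exact: measurable_maxr.
have mn : measurable_fun [set: V] (fun x => negpart (u x)).
  by apply: measurable_maxr => //; exact: measurableT_comp.
have Lp : L1 m (fun x => pospart (u x)).
  apply: (le_L1 mp _ Lu) => x; rewrite ger0_norm ?le_max ?lexx ?orbT//.
  by rewrite ge_max ler_norm normr_ge0.
have Ln : L1 m (fun x => negpart (u x)).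
  apply: (le_L1 mn _ Lu) => x; rewrite ger0_norm ?le_max ?lexx ?orbT//.
  by rewrite ge_max normr_ge0 -normrN ler_norm.
rewrite !iintRnE; last 4 first.
- exact/measurable_EFinP.
- by move=> x; rewrite lee_fin le_max lexx orbT.
- exact/measurable_EFinP.
- by move=> x; rewrite lee_fin le_max lexx orbT.
rewrite -[LHS](RintegralB measurableT Lp Ln); apply: eq_Rintegral => x _.
rewrite /pospart /negpart; case: (leP 0 (u x)) => ux.
  by rewrite [Num.max (- u x) 0]max_r ?subr0// oppr_le0.
by rewrite [Num.max (- u x) 0]max_l ?oppr_ge0 ?(ltW ux)// sub0r opprK.
Qed.

Lemma invFourierE H x : L1 m (fun xi => complex.Re (H xi)) -> L1 m (fun xi => complex.Im (H xi)) ->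
  invFourier H x = ((2 * pi) ^- n)%:C%C *
    complex.Complex (cosT (fun xi => complex.Re (H xi)) x - sinT (fun xi => complex.Im (H xi)) x)
      (sinT (fun xi => complex.Re (H xi)) x + cosT (fun xi => complex.Im (H xi)) x).
Proof.
move=> LR LI; rewrite /invFourier; congr (_ * _); rewrite /cintRn.
have RE xi : complex.Re (H xi * expi (dotRn x xi)) =
    complex.Re (H xi) * cos (dotRn x xi) - complex.Im (H xi) * sin (dotRn x xi).
  by case: (H xi).
have IE xi : complex.Im (H xi * expi (dotRn x xi)) =
    complex.Re (H xi) * sin (dotRn x xi) + complex.Im (H xi) * cos (dotRn x xi).
  by case: (H xi).
congr (complex.Complex _ _).
  rewrite /cosT /sinT -RintegralB//; [|exact: L1_cos|exact: L1_sin].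
  under [RHS]eq_Rintegral do rewrite -RE.
  apply: Rintegral_pos_neg; under eq_fun do rewrite RE.
  by apply: L1B; [exact: L1_cos|exact: L1_sin].
rewrite /cosT /sinT -RintegralD//; [|exact: L1_sin|exact: L1_cos].
under [RHS]eq_Rintegral do rewrite -IE.
apply: Rintegral_pos_neg; under eq_fun do rewrite IE.
by apply: L1D; [exact: L1_sin|exact: L1_cos].
Qed.

Lemma L1_of_integrableRnC H : integrableRnC H ->
  L1 m (fun xi => complex.Re (H xi)) /\ L1 m (fun xi => complex.Im (H xi)).
Proof.
move=> [[/measurableRnE mR /measurableRnE mI]].
have mc := measurable_cmod mR mI.
rewrite iintRnE; last 2 first.
- exact/measurable_EFinP.
- by move=> x; rewrite lee_fin cmod_ge0.
move=> hi; have Lc : L1 m (fun xi => cmod (H xi)).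
  by apply/L1P; split=> //; under eq_integral do rewrite ger0_norm ?cmod_ge0//.
by split; [apply: (le_L1 mR _ Lc)|apply: (le_L1 mI _ Lc)] => xi;
  rewrite [leRHS]ger0_norm ?cmod_ge0 ?Re_le_cmod ?Im_le_cmod.
Qed.

Let measurable_wcmod q s H : measurable_fun [set: V] (fun xi => cmod (H xi)) ->
  measurable_fun [set: V] (fun xi => ((jbracket xi `^ s * cmod (H xi)) `^ q)%:E).
Proof.
move=> mc; apply/measurable_EFinP; apply: (measurableT_comp (measurable_powR q)).
by apply: measurable_funM => //; exact: measurable_wt.
Qed.

Lemma qnorm_lin_lty q s g h k l : 1 < q -> 0 <= s ->
  measurable_fun [set: V] g -> measurable_fun [set: V] h ->
  (qnorm q s g < +oo)%E -> (qnorm q s h < +oo)%E ->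
  (qnorm q s (fun xi => k * (g xi + l * h xi))%R < +oo)%E.
Proof.
move=> q1 s0 mg mh gq hq.
have mlh : measurable_fun [set: V] (fun xi => l * h xi) by exact: measurable_funM.
have ms : measurable_fun [set: V] (fun xi => g xi + l * h xi) by exact: measurable_funD.
have fin (r : R) (y : \bar R) : 0 <= r -> (y < +oo)%E -> (r%:E * y < +oo)%E.
  by move=> r0 y1; apply: lte_mul_pinfty; rewrite ?lee_fin.
rewrite (qnormZ q s0 k ms); apply: (fin _ _); first exact: powR_ge0.
apply: le_lt_trans (qnormD q1 s0 mg mlh) _; apply: (fin _ _); first exact: powR_ge0.
apply: lte_add_pinfty; first exact: gq.
by rewrite (qnormZ q s0 l mh); apply: (fin _ _); [exact: powR_ge0|exact: hq].
Qed.

(** For a kernel [a + i b] the real part of the inverse Fourier integral is [cosT a - sinT b], which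
    is the Hartley transform of the even part of [a] minus the odd part of [b]. Only these parts are
    kept, as [f] is real. *)
Lemma FLqs_hartley q s (f : V -> R) : 1 < q -> 0 <= s -> FLqs q s (fun x => (f x)%:C%C) ->
  exists h, [/\ L1 m h, (qnorm q s h < +oo)%E & forall x, f x = hartley h x].
Proof.
move=> q1 s0 [H [[/measurableRnE mR /measurableRnE mI] hq hi fH]].
have q0 : 0 <= q by rewrite ltW// (lt_trans _ q1).
have [LR LI] := L1_of_integrableRnC hi.
have mc := measurable_cmod mR mI.
move: hq; rewrite iintRnE; last 2 first.
- exact: measurable_wcmod.
- by move=> x; rewrite lee_fin powR_ge0.
move=> hq.
have qfin u : measurable_fun setT u -> (forall xi, `|u xi| <= cmod (H xi)) ->
    (qnorm q s u <= (fine (\int[m]_xi ((jbracket xi `^ s * cmod (H xi)) `^ q)%:E))%:E)%E.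
  move=> mu' uc; rewrite fineK; last first.
    by rewrite ge0_fin_numE// integral_ge0// => xi _; rewrite lee_fin powR_ge0.
  rewrite /qnorm; apply: ge0_leint.
  - by move=> xi; rewrite lee_fin powR_ge0.
  - exact: measurable_qnorm.
  - exact: measurable_wcmod.
  move=> xi; rewrite lee_fin; apply: ge0_ler_powR => //.
  - by rewrite nnegrE mulr_ge0// wt_ge0.
  - by rewrite nnegrE mulr_ge0 ?cmod_ge0 ?powR_ge0.
  - by apply: ler_wpM2l; [exact: powR_ge0|exact: uc].
have qR := qfin _ mR (fun xi => Re_le_cmod (H xi)).
have qI := qfin _ mI (fun xi => Im_le_cmod (H xi)).
have n1 u : L1 m u -> (\int[m]_x `|u x|%:E <= (fine (\int[m]_x `|u x|%:E))%:E)%E.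
  by move=> Lu; rewrite fineK//; exact: (integrable_fin_num measurableT (L1_norm Lu)).
have [_ eR _ _] := parts_bounds q1 s0 LR (n1 _ LR) qR.
have [_ _ _ oI] := parts_bounds q1 s0 LI (n1 _ LI) qI.
set a := fun xi => complex.Re (H xi); set b := fun xi => complex.Im (H xi).
have Le : L1 m (evenpart a) by exact: L1_evenpart.
have Lo : L1 m (oddpart b) by exact: L1_oddpart.
have Lo' := L1Z (-1) Lo; have Ls := L1D Le Lo'.
exists (fun xi => (2 * pi) ^- n * (evenpart a xi + -1 * oddpart b xi)); split.
- exact: L1Z.
- apply: (qnorm_lin_lty _ _ q1 s0 (L1_measurable Le) (L1_measurable Lo)).
    exact: le_lt_trans eR (ltry _).
  exact: le_lt_trans oI (ltry _).
move=> x; rewrite hartleyZ// hartleyD// hartleyZ//.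
rewrite (hartleyE x Le) (hartleyE x Lo) cosT_evenpart// sinT_evenpart//.
rewrite cosT_oddpart// sinT_oddpart// addr0 add0r mulN1r.
have := fH x; rewrite invFourierE// => /(congr1 (@complex.Re R)).
by rewrite /= mul0r subr0.
Qed.

(** A Hartley kernel [g] corresponds to the Fourier kernel [even g - i odd g]. Adding [i] times the
    same expression for [h] and separating real and imaginary parts gives [P] and [Q]; [kp]
    compensates the factor of the inverse transform. *)
Lemma hartley_FLqs q s (A B : R) u v a b : 1 < q -> 0 <= s ->
  repA q s u A a -> repA q s v B b ->
  FLqs q s (fun x => complex.Complex (u x) (v x)).
Proof.
move=> q1 s0 [g [Lg ug ga gb]] [h [Lh vh ha hb]].
have q0 : 0 <= q by rewrite ltW// (lt_trans _ q1).
have [_ eg _ og] := parts_bounds q1 s0 Lg ga gb.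
have [_ eh _ oh] := parts_bounds q1 s0 Lh ha hb.
have [Leg Log] := (L1_evenpart Lg, L1_oddpart Lg).
have [Leh Loh] := (L1_evenpart Lh, L1_oddpart Lh).
have Log' := L1Z (-1) Log.
pose kp : R := (2 * pi) ^+ n.
have kp0 : kp != 0 by rewrite expf_neq0// mulf_neq0// gt_eqF// pi_gt0.
pose P xi := kp * (evenpart g xi + 1 * oddpart h xi).
pose Q xi := kp * (evenpart h xi + -1 * oddpart g xi).
have Lp := L1D Leg (L1Z 1 Loh); have Lq := L1D Leh Log'.
have LP : L1 m P := L1Z kp Lp; have LQ : L1 m Q := L1Z kp Lq.
pose H xi := complex.Complex (P xi) (Q xi).
have [mP mQ] := (L1_measurable LP, L1_measurable LQ).
have mc : measurable_fun [set: V] (fun xi => cmod (H xi)) by exact: measurable_cmod.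
have qP : (qnorm q s P < +oo)%E.
  apply: (qnorm_lin_lty _ _ q1 s0 (L1_measurable Leg) (L1_measurable Loh)).
    exact: le_lt_trans eg (ltry _).
  exact: le_lt_trans oh (ltry _).
have qQ : (qnorm q s Q < +oo)%E.
  apply: (qnorm_lin_lty _ _ q1 s0 (L1_measurable Leh) (L1_measurable Log)).
    exact: le_lt_trans eh (ltry _).
  exact: le_lt_trans og (ltry _).
have mH : measurableRnC H by split; exact/measurableRnE.
exists H; split; [exact: mH| | |].
- rewrite iintRnE; last 2 first.
  + exact: measurable_wcmod.
  + by move=> x; rewrite lee_fin powR_ge0.
  have mnP : measurable_fun setT (fun xi => `|P xi|) by exact: measurableT_comp.
  have mnQ : measurable_fun setT (fun xi => `|Q xi|) by exact: measurableT_comp.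
  have qn w : qnorm q s (fun xi => `|w xi|) = qnorm q s w.
    by apply: eq_integral => xi _; rewrite normr_id.
  apply: (@le_lt_trans _ _ (qnorm q s (fun xi => `|P xi| + `|Q xi|))).
    rewrite /qnorm; apply: ge0_leint.
    + by move=> xi; rewrite lee_fin powR_ge0.
    + exact: measurable_wcmod.
    + by apply: measurable_qnorm; exact: measurable_funD.
    move=> xi; rewrite lee_fin; apply: ge0_ler_powR => //.
    + by rewrite nnegrE mulr_ge0 ?cmod_ge0 ?powR_ge0.
    + by rewrite nnegrE mulr_ge0// wt_ge0.
    apply: ler_wpM2l; first exact: powR_ge0.
    by rewrite [leRHS]ger0_norm ?addr_ge0//; exact: cmod_le.
  have -> : (fun xi => `|P xi| + `|Q xi|) = fun xi => 1 * (`|P xi| + 1 * `|Q xi|).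
    by apply/funext => xi; rewrite !mul1r.
  by apply: (qnorm_lin_lty _ _ q1 s0 mnP mnQ); rewrite qn; [exact: qP|exact: qQ].
- split; [exact: mH|]; rewrite iintRnE; last 2 first.
  + exact/measurable_EFinP.
  + by move=> x; rewrite lee_fin cmod_ge0.
  have /L1P[_] : L1 m (fun xi => cmod (H xi)).
    apply: (le_L1 mc _ (L1D (L1_norm LP) (L1_norm LQ))) => xi.
    rewrite [leLHS]ger0_norm ?cmod_ge0// [leRHS]ger0_norm ?addr_ge0//; exact: (cmod_le (H xi)).
  by under eq_integral do rewrite ger0_norm ?cmod_ge0//.
move=> x; rewrite invFourierE//= -/P -/Q.
have TE T (w w' : V -> R) (k : R) : L1 m w -> L1 m w' -> continuous T -> (forall t, `|T t| <= 1) ->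
    \int[m]_xi (kp * (w xi + k * w' xi) * T (dotRn x xi)) =
    kp * (\int[m]_xi (w xi * T (dotRn x xi)) + k * \int[m]_xi (w' xi * T (dotRn x xi))).
  move=> Lw Lw' cT T1.
  have L w'' : L1 m w'' -> L1 m (fun xi => w'' xi * T (dotRn x xi)).
    by move=> Lw''; apply: (L1M (C := 1)) => //; exact: measurable_comp_dotRn.
  rewrite -(RintegralZl k measurableT (L _ Lw')) -(RintegralD measurableT (L _ Lw) (L1Z k (L _ Lw'))).
  rewrite -(RintegralZl kp measurableT (L1D (L _ Lw) (L1Z k (L _ Lw')))).
  by apply: eq_Rintegral => xi _; ring.
have c1 t : `|cos t| <= 1 :> R by rewrite ler_norml cos_geN1 cos_le1.
have s1 t : `|sin t| <= 1 :> R by rewrite ler_norml sin_geN1 sin_le1.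
have cP : cosT P x = kp * cosT g x.
  by rewrite /P /cosT TE// -?/(cosT _ _) ?cosT_evenpart ?cosT_oddpart ?mulr0 ?addr0//; exact: continuous_cos.
have sP : sinT P x = kp * sinT h x.
  by rewrite /P /sinT TE// -?/(sinT _ _) ?sinT_evenpart ?sinT_oddpart ?mul1r ?add0r//; exact: continuous_sin.
have cQ : cosT Q x = kp * cosT h x.
  by rewrite /Q /cosT TE// -?/(cosT _ _) ?cosT_evenpart ?cosT_oddpart ?mulr0 ?addr0//; exact: continuous_cos.
have sQ : sinT Q x = - (kp * sinT g x).
  by rewrite /Q /sinT TE// -?/(sinT _ _) ?sinT_evenpart ?sinT_oddpart ?mulN1r ?add0r ?mulrN//; exact: continuous_sin.
rewrite cP sP cQ sQ ug vh !hartleyE// opprK -!mulrDr.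
apply/eqP; rewrite eq_complex /= !mul0r subr0 addr0 !mulKf//.
by rewrite [sinT h x + _]addrC !eqxx.
Qed.

End complex_fourier.

(** Here [p] is the real or the imaginary part. At real points the powers of [z - z0] are real, so
    [p] passes through the partial sums and acts on the coefficients alone. *)
Lemma real_analytic_of_complex {R : realType} (U : set R[i]) (F : R[i] -> R[i])
    (p : R[i] -> R) : open_in_C U -> analytic_onC U F ->
  (forall z, `|p z| <= cmod z) -> {morph p : z w / z + w} -> {morph p : z / - z} -> p 0 = 0 ->
  (forall z (t : R), p (z * t%:C%C) = p z * t) ->
  real_analytic [set t : R | U t%:C%C] (fun t => p (F t%:C%C)).
Proof.
move=> oU aF pc pD pN p0 pM x0 Ux0; have [r1 r10 hr1] := oU _ Ux0.
have [r2 r20 [a ha]] := aF _ Ux0.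
exists (Num.min r1 r2); first by rewrite lt_min r10.
exists (fun k => p (a k)) => x; rewrite lt_min => /andP[x1 x2].
have cE : cmod (x%:C%C - x0%:C%C) = `|x - x0|.
  by rewrite /cmod -raddfB/= expr0n addr0 sqrtr_sqr.
have Ux : U x%:C%C by apply: hr1; rewrite cE.
split=> //; have := ha _ Ux; rewrite cE => /(_ x2) h.
apply/cvgrPdist_le => e e0; move/cvgrPdist_le: h => /(_ e e0); apply: filterS => N.
rewrite sub0r normrN ger0_norm ?cmod_ge0// => hN; apply: le_trans hN.
apply: le_trans (pc _); rewrite distrC pD pN.
rewrite le_eqVlt; apply/orP; left; apply/eqP; congr `|_ - _|.
rewrite /pseries /series/= big_mkord (big_morph p pD p0); apply: eq_bigr => i _.
by rewrite -raddfB -rmorphXn pM.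
Qed.

Theorem theorem1p2 (R : realType) (n : nat) (q s : R)
  (hn : (0 < n)%N) (hq : 1 < q) (hs : n%:R / conj_exp q < s)
  (f : 'rV[R]_n -> R) (hf : FLqs q s (fun x => (f x)%:C%C))
  (U : set R[i]) (F : R[i] -> R[i])
  (hU : open_in_C U) (hfU : forall x, U (f x)%:C%C) (h0U : U 0)
  (hF : analytic_onC U F) (hF0 : F 0 = 0) :
  exists g : 'rV[R]_n -> R[i], FLqs q s g /\ forall x, g x = F (f x)%:C%C.
Proof.
have s0 : 0 <= s by rewrite ltW// (le_lt_trans _ hs)// divr_ge0// ltW// conj_exp_gt0.
have [h [Lh hqh fh]] := FLqs_hartley hq s0 hf.
have hU' x : U (hartley h x)%:C%C by rewrite -fh.
have [c [d [e ed [HJ cd hY]]]] := hartley_range hn Lh hU h0U hU'.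
have aR : real_analytic [set t : R | U t%:C%C] (fun t => complex.Re (F t%:C%C)).
  apply: real_analytic_of_complex => //.
  - exact: Re_le_cmod.
  - by move=> [? ?] [? ?].
  - by move=> [? ?].
  - by move=> [? ?] t /=; rewrite mulr0 subr0.
have aI : real_analytic [set t : R | U t%:C%C] (fun t => complex.Im (F t%:C%C)).
  apply: real_analytic_of_complex => //.
  - exact: Im_le_cmod.
  - by move=> [? ?] [? ?].
  - by move=> [? ?].
  - by move=> [? ?] t /=; rewrite mulr0 add0r mulrC.
have [A1 [B1 r1]] := repA_real_analytic hn hq hs Lh hqh ed cd hY aR HJ
  (congr1 (@complex.Re R) hF0).
have [A2 [B2 r2]] := repA_real_analytic hn hq hs Lh hqh ed cd hY aI HJ
  (congr1 (@complex.Im R) hF0).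
exists (fun x => complex.Complex (complex.Re (F (hartley h x)%:C%C)) (complex.Im (F (hartley h x)%:C%C))).
split; first exact: hartley_FLqs r1 r2.
by move=> x; rewrite fh; case: (F _).
Qed.
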